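(* Let $X,Y$ be real nonzero Banach spaces, $S:X\rightrightarrows X^*$ and $T:Y\rightrightarrows Y^*$ maximal monotone operators of Gossez type (D) with strong representative functions $h_S,h_T$, and $A:X\to Y$ linear continuous with $\big(\operatorname{dom}h_T\times\operatorname{pr}_{X^*}(\operatorname{dom}h_S)\big)\cap\big(\operatorname{im}A\times\Delta_{Y^*}^{A^*}\big)\neq\emptyset$ and $D(\overline S)\subseteq X$. Assume condition (a) or (b): (a) $(0,0,0)\in{}^{ic}\big(\operatorname{dom}h_T\times\operatorname{pr}_{X^*}(\operatorname{dom}h_S)-\operatorname{im}A\times\Delta_{Y^*}^{A^*}\big)$; (b) the set $\{(u^*,A^*v^*,A^{**}u^{**}+v^{**},r): r\in\mathbb R,\ h_S^*(u^*,u^{**})+h_T^*(v^*,v^{**})\le r\}$ is closed regarding $\Delta_{X^*}\times\operatorname{im}A^{**}\times\mathbb R$ in $(X^*,w^* )\times(X^*,w^* )\times(Y^{**},w^* )\times\mathbb R$. Then $h:=\operatorname{cl}_{\|\cdot\|\times\|\cdot\|_*}(h_S\bigcirc_1^A h_T)$ is a strong representative function of $S\|_A T$, and $S\|_A T$ is a maximal monotone operator of Gossez type (D).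
   Context: $X$ is identified with its canonical image in $X^{**}$ (same for $Y$). For an operator $M$, $G(M)$ is its graph, $D(M)$ its domain, $M^{-1}$ its inverse. Coupling $c(x,x^* )=\langle x^*,x\rangle$. Conjugate of $h:X\times X^*\to\overline{\mathbb R}$: $h^*(x^*,x^{**})=\sup_{(x,y^* )}\{\langle x^*,x\rangle+\langle x^{**},y^*\rangle-h(x,y^* )\}$. A representative function of a monotone $S$ is a convex, norm-lsc $h_S$ with $h_S\ge c$ and $G(S)\subseteq\{h_S=c\}$; it is strong if also $h_S^*(x^*,x^{**})\ge\langle x^{**},x^*\rangle$ for all $(x^*,x^{**})$. Gossez's closure $\overline S:X^{**}\rightrightarrows X^*$ has graph $\{(x^{**},x^* ):\langle x^{**}-y,x^*-y^*\rangle\ge0\ \forall(y,y^* )\in G(S)\}$; maximal monotone $S$ is of Gossez type (D) if each point of $G(\overline S)$ is the $w^*\times\|\cdot\|_*$-limit of a bounded net in $G(S)$. $A^*,A^{**}$ adjoint/biadjoint; $\operatorname{im}A=A(X)$; $\Delta_{X^*}=\{(x^*,x^* )\}$; $\Delta_{Y^*}^{A^*}=\{(y^*,A^*y^* )\}$. $(h_S\bigcirc_1^A h_T)(x,x^* )=\inf\{h_S(u,x^* )+h_T(Aw,v^* ):u+w=x,\ A^*v^*=x^*\}$. The generalized parallel sum is $S\|_AT(x)=(S^{-1}+(A^*TA)^{-1})^{-1}(x)$. Closed regarding $W$: $\operatorname{cl}D\cap W=D\cap W$. ${}^{ic}D=\operatorname{icr}D$ if $\operatorname{aff}D$ closed,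 else $\emptyset$, where $\operatorname{icr}D=\{u:\forall x\in\operatorname{aff}(D-D)\ \exists\delta>0\ \forall\lambda\in[0,\delta]:u+\lambda x\in D\}$. *)

(* Defs.v *)
From Stdlib Require Import Reals Lra List ClassicalEpsilon.
Open Scope R_scope.

Inductive ER := ERfin (r : R) | ERpinf | ERminf.

Definition ER_le (a b : ER) : Prop :=
  match a, b with
  | _, ERpinf => True
  | ERminf, _ => True
  | ERfin x, ERfin y => x <= y
  | _, _ => False
  end.

Definition ER_is_lub (E : ER -> Prop) (s : ER) : Prop :=
  (forall e, E e -> ER_le e s) /\ (forall t, (forall e, E e -> ER_le e t) -> ER_le s t).
Definition ER_is_glb (E : ER -> Prop) (s : ER) : Prop :=
  (forall e, E e -> ER_le s e) /\ (forall t, (forall e, E e -> ER_le t e) -> ER_le t s).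

(* supremum / infimum (they always exist and are unique in the extended reals) *)
Definition ER_sup (E : ER -> Prop) : ER := epsilon (inhabits ERpinf) (ER_is_lub E).
Definition ER_inf (E : ER -> Prop) : ER := epsilon (inhabits ERpinf) (ER_is_glb E).

(* addition with the convention (+oo) + (-oo) = +oo (inf-addition) *)
Definition ER_plus (a b : ER) : ER :=
  match a, b with
  | ERpinf, _ => ERpinf
  | _, ERpinf => ERpinf
  | ERminf, _ => ERminf
  | _, ERminf => ERminf
  | ERfin x, ERfin y => ERfin (x + y)
  end.

Definition ER_sub (r : R) (e : ER) : ER :=
  match e with
  | ERfin y => ERfin (r - y)
  | ERpinf => ERminf
  | ERminf => ERpinf
  end.

(* Real normed spaces (operations; axioms are a separate predicate)    *)
Record NSpace := mkNS {
  ns_car :> Type;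
  ns_zero : ns_car;
  ns_add : ns_car -> ns_car -> ns_car;
  ns_opp : ns_car -> ns_car;
  ns_scal : R -> ns_car -> ns_car;
  ns_norm : ns_car -> R }.
Arguments ns_zero {n}.
Arguments ns_add {n} _ _.
Arguments ns_opp {n} _.
Arguments ns_scal {n} _ _.
Arguments ns_norm {n} _.

Definition ns_sub {V : NSpace} (x y : V) : V := ns_add x (ns_opp y).

Definition seq_conv {V : NSpace} (u : nat -> V) (l : V) : Prop :=
  forall eps, 0 < eps -> exists N, forall n, (N <= n)%nat -> ns_norm (ns_sub (u n) l) < eps.

Definition cauchy {V : NSpace} (u : nat -> V) : Prop :=
  forall eps, 0 < eps -> exists N, forall m n, (N <= m)%nat -> (N <= n)%nat ->
    ns_norm (ns_sub (u m) (u n)) < eps.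

Definition banach (V : NSpace) : Prop :=
  (forall x y z : V, ns_add x (ns_add y z) = ns_add (ns_add x y) z) /\
  (forall x y : V, ns_add x y = ns_add y x) /\
  (forall x : V, ns_add x ns_zero = x) /\
  (forall x : V, ns_add x (ns_opp x) = ns_zero) /\
  (forall a b (x : V), ns_scal a (ns_scal b x) = ns_scal (a * b) x) /\
  (forall x : V, ns_scal 1 x = x) /\
  (forall a (x y : V), ns_scal a (ns_add x y) = ns_add (ns_scal a x) (ns_scal a y)) /\
  (forall a b (x : V), ns_scal (a + b) x = ns_add (ns_scal a x) (ns_scal b x)) /\
  (forall x : V, 0 <= ns_norm x) /\
  (forall x : V, ns_norm x = 0 -> x = ns_zero) /\
  (forall a (x : V), ns_norm (ns_scal a x) = Rabs a * ns_norm x) /\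
  (forall x y : V, ns_norm (ns_add x y) <= ns_norm x + ns_norm y) /\
  (forall u : nat -> V, cauchy u -> exists l, seq_conv u l).

Definition nonzero_space (V : NSpace) : Prop := exists x : V, x <> ns_zero.

Definition lin_cont (V : NSpace) (f : V -> R) : Prop :=
  (forall x y, f (ns_add x y) = f x + f y) /\
  (forall a x, f (ns_scal a x) = a * f x) /\
  (exists M, 0 <= M /\ forall x, Rabs (f x) <= M * ns_norm x).

Definition DualT (V : NSpace) := { f : V -> R | lin_cont V f }.
Definition dapp {V : NSpace} (f : DualT V) (x : V) : R := proj1_sig f x.

Lemma lc_zero (V : NSpace) : lin_cont V (fun _ => 0).
Proof.
  split; [intros; lra|split; [intros; lra|]].
  exists 0; split; [lra|]. intros x; rewrite Rabs_R0; lra.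
Qed.

Lemma lc_add (V : NSpace) (f g : DualT V) :
  lin_cont V (fun x => dapp f x + dapp g x).
Proof.
  destruct f as [f [Fa [Fs [M [HM Fb]]]]]; destruct g as [g [Ga [Gs [N [HN Gb]]]]];
  unfold dapp; simpl.
  split; [intros; rewrite Fa, Ga; lra|split; [intros; rewrite Fs, Gs; lra|]].
  exists (M + N); split; [lra|]. intros x.
  eapply Rle_trans; [apply Rabs_triang|]. specialize (Fb x); specialize (Gb x); lra.
Qed.

Lemma lc_opp (V : NSpace) (f : DualT V) : lin_cont V (fun x => - dapp f x).
Proof.
  destruct f as [f [Fa [Fs [M [HM Fb]]]]]; unfold dapp; simpl.
  split; [intros; rewrite Fa; lra|split; [intros; rewrite Fs; lra|]].
  exists M; split; [lra|]. intros x; rewrite Rabs_Ropp; apply Fb.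
Qed.

Lemma lc_scal (V : NSpace) (a : R) (f : DualT V) : lin_cont V (fun x => a * dapp f x).
Proof.
  destruct f as [f [Fa [Fs [M [HM Fb]]]]]; unfold dapp; simpl.
  split; [intros; rewrite Fa; lra|split; [intros; rewrite Fs; ring|]].
  exists (Rabs a * M); split; [apply Rmult_le_pos; [apply Rabs_pos|lra]|].
  intros x; rewrite Rabs_mult, Rmult_assoc; apply Rmult_le_compat_l; [apply Rabs_pos|apply Fb].
Qed.

Definition dnorm {V : NSpace} (f : DualT V) : R :=
  epsilon (inhabits 0) (is_lub (fun r => exists x : V, ns_norm x <= 1 /\ r = Rabs (dapp f x))).

Definition Dual (V : NSpace) : NSpace :=
  mkNS (DualT V)
    (exist _ (fun _ => 0) (lc_zero V))
    (fun f g => exist _ (fun x => dapp f x + dapp g x) (lc_add V f g))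
    (fun f => exist _ (fun x => - dapp f x) (lc_opp V f))
    (fun a f => exist _ (fun x => a * dapp f x) (lc_scal V a f))
    dnorm.

Definition nsprod (V W : NSpace) : NSpace :=
  mkNS (V * W)%type (ns_zero, ns_zero)
    (fun p q => (ns_add (fst p) (fst q), ns_add (snd p) (snd q)))
    (fun p => (ns_opp (fst p), ns_opp (snd p)))
    (fun a p => (ns_scal a (fst p), ns_scal a (snd p)))
    (fun p => ns_norm (fst p) + ns_norm (snd p)).

Record BLin (X Y : NSpace) := {
  bl :> X -> Y;
  bl_add : forall x y, bl (ns_add x y) = ns_add (bl x) (bl y);
  bl_scal : forall a x, bl (ns_scal a x) = ns_scal a (bl x);
  bl_bnd : exists N, 0 <= N /\ forall x, ns_norm (bl x) <= N * ns_norm x }.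
Arguments bl {X Y} _ _.

Lemma lc_adj (X Y : NSpace) (A : BLin X Y) (g : DualT Y) :
  lin_cont X (fun x => dapp g (A x)).
Proof.
  destruct A as [A Aa As [N [HN Ab]]]; destruct g as [g [Ga [Gs [M [HM Gb]]]]];
  unfold dapp; simpl.
  split; [intros; rewrite Aa, Ga; lra|split; [intros; rewrite As, Gs; lra|]].
  exists (M * N); split; [apply Rmult_le_pos; lra|]. intros x.
  eapply Rle_trans; [apply Gb|]. rewrite Rmult_assoc.
  apply Rmult_le_compat_l; [lra|apply Ab].
Qed.

Definition adj {X Y : NSpace} (A : BLin X Y) (g : Dual Y) : Dual X :=
  exist _ (fun x => dapp g (A x)) (lc_adj X Y A g).

Definition canon {X : NSpace} (x : X) (xx : Dual (Dual X)) : Prop :=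
  forall f : Dual X, dapp xx f = dapp f x.

Record Directed := {
  dI :> Type;
  dle : dI -> dI -> Prop;
  dle_refl : forall i, dle i i;
  dle_trans : forall i j k, dle i j -> dle j k -> dle i k;
  dle_dir : forall i j, exists k, dle i k /\ dle j k;
  d_inh : dI }.

Definition net_lim {D : Directed} (a : D -> R) (l : R) : Prop :=
  forall eps, 0 < eps -> exists i0, forall i, dle D i0 i -> Rabs (a i - l) < eps.

Definition Op (X : NSpace) := X -> Dual X -> Prop.

Definition monotone {X : NSpace} (S : Op X) : Prop :=
  forall x xs y ys, S x xs -> S y ys -> 0 <= dapp (ns_sub xs ys) (ns_sub x y).

Definition maximal_monotone {X : NSpace} (S : Op X) : Prop :=
  monotone S /\
  forall x xs, (forall y ys, S y ys -> 0 <= dapp (ns_sub xs ys) (ns_sub x y)) -> S x xs.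

(* Gossez's closure: graph in X** x X^*;  <x** - y, x* - y*> >= 0 *)
Definition gossez_cl {X : NSpace} (S : Op X) (xx : Dual (Dual X)) (xs : Dual X) : Prop :=
  forall y ys, S y ys -> 0 <= dapp xx (ns_sub xs ys) - dapp (ns_sub xs ys) y.

Definition gossez_D {X : NSpace} (S : Op X) : Prop :=
  maximal_monotone S /\
  forall xx xs, gossez_cl S xx xs ->
    exists (D : Directed) (xn : D -> X) (xsn : D -> Dual X),
      (forall i, S (xn i) (xsn i)) /\
      (exists M, forall i, ns_norm (xn i) <= M /\ ns_norm (xsn i) <= M) /\
      (forall f : Dual X, net_lim (fun i => dapp f (xn i)) (dapp xx f)) /\
      net_lim (fun i => ns_norm (ns_sub (xsn i) xs)) 0.

Definition rel_inv {P Q : Type} (S : P -> Q -> Prop) : Q -> P -> Prop := fun q p => S p q.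
Definition op_sum {P : Type} {V : NSpace} (R1 R2 : P -> V -> Prop) : P -> V -> Prop :=
  fun p v => exists u w, R1 p u /\ R2 p w /\ v = ns_add u w.
Definition op_AtTA {X Y : NSpace} (A : BLin X Y) (T : Op Y) : Op X :=
  fun x xs => exists ys, T (A x) ys /\ xs = adj A ys.
Definition par_sum {X Y : NSpace} (A : BLin X Y) (S : Op X) (T : Op Y) : Op X :=
  rel_inv (op_sum (rel_inv S) (rel_inv (op_AtTA A T))).

Definition EFun (X : NSpace) := X -> Dual X -> ER.

(* convexity (epigraph convexity) *)
Definition convex_fun {X : NSpace} (h : EFun X) : Prop :=
  forall x1 xs1 x2 xs2 a b l, 0 <= l <= 1 ->
    ER_le (h x1 xs1) (ERfin a) -> ER_le (h x2 xs2) (ERfin b) ->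
    ER_le (h (ns_add (ns_scal l x1) (ns_scal (1 - l) x2))
             (ns_add (ns_scal l xs1) (ns_scal (1 - l) xs2)))
          (ERfin (l * a + (1 - l) * b)).

(* lower semicontinuity w.r.t. ||.|| x ||.||_*  (closed sublevel sets) *)
Definition norm_lsc {X : NSpace} (h : EFun X) : Prop :=
  forall r (xn : nat -> X) (xsn : nat -> Dual X) x xs,
    (forall n, ER_le (h (xn n) (xsn n)) (ERfin r)) -> seq_conv xn x -> seq_conv xsn xs ->
    ER_le (h x xs) (ERfin r).

(* cl_{||.|| x ||.||_*} h : the function whose epigraph is the closure of epi h *)
Definition norm_closure {X : NSpace} (h : EFun X) : EFun X :=
  fun x xs => ER_inf (fun e => exists r, e = ERfin r /\
    exists (xn : nat -> X) (xsn : nat -> Dual X) (rn : nat -> R),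
      (forall n, ER_le (h (xn n) (xsn n)) (ERfin (rn n))) /\
      seq_conv xn x /\ seq_conv xsn xs /\ Un_cv rn r).

Definition conjugate {X : NSpace} (h : EFun X) (xs : Dual X) (xx : Dual (Dual X)) : ER :=
  ER_sup (fun e => exists x ys, e = ER_sub (dapp xs x + dapp xx ys) (h x ys)).

Definition rep_fun {X : NSpace} (S : Op X) (h : EFun X) : Prop :=
  convex_fun h /\ norm_lsc h /\
  (forall x xs, ER_le (ERfin (dapp xs x)) (h x xs)) /\
  (forall x xs, S x xs -> h x xs = ERfin (dapp xs x)).

Definition strong_rep {X : NSpace} (S : Op X) (h : EFun X) : Prop :=
  rep_fun S h /\ forall xs xx, ER_le (ERfin (dapp xx xs)) (conjugate h xs xx).

Definition dom_fun {X : NSpace} (h : EFun X) (x : X) (xs : Dual X) : Prop := h x xs <> ERpinf.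
Definition pr_dom {X : NSpace} (h : EFun X) (xs : Dual X) : Prop := exists x, dom_fun h x xs.

Definition infconv {X Y : NSpace} (A : BLin X Y) (hS : EFun X) (hT : EFun Y) : EFun X :=
  fun x xs => ER_inf (fun e => exists u w vs,
    ns_add u w = x /\ adj A vs = xs /\ e = ER_plus (hS u xs) (hT (A w) vs)).

Definition aff_hull {V : NSpace} (D : V -> Prop) (p : V) : Prop :=
  exists l : list (R * V),
    (forall c, In c l -> D (snd c)) /\
    fold_right (fun c s => fst c + s) 0 l = 1 /\
    p = fold_right (fun c acc => ns_add (ns_scal (fst c) (snd c)) acc) ns_zero l.

Definition minus_set {V : NSpace} (D E : V -> Prop) (z : V) : Prop :=
  exists d e, D d /\ E e /\ z = ns_sub d e.

Definition closed_set {V : NSpace} (C : V -> Prop) : Prop :=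
  forall (u : nat -> V) l, (forall n, C (u n)) -> seq_conv u l -> C l.

Definition icr {V : NSpace} (D : V -> Prop) (u : V) : Prop :=
  forall z, aff_hull (minus_set D D) z ->
    exists delta, 0 < delta /\ forall l, 0 <= l <= delta -> D (ns_add u (ns_scal l z)).

Definition ic_mem {V : NSpace} (D : V -> Prop) (u : V) : Prop :=
  closed_set (aff_hull D) /\ icr D u.

Definition cond_a {X Y : NSpace} (A : BLin X Y) (hS : EFun X) (hT : EFun Y) : Prop :=
  let Z := nsprod Y (nsprod (Dual Y) (Dual X)) in
  @ic_mem Z (fun z => exists (y : Y) (ys : Dual Y) (xs : Dual X) (w : X) (vs : Dual Y),
                 dom_fun hT y ys /\ pr_dom hS xs /\
                 z = @ns_sub Z (y, (ys, xs)) (A w, (vs, adj A vs)))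
         ns_zero.

Definition Bpt (X Y : NSpace) := (Dual X * Dual X * Dual (Dual Y) * R)%type.

Definition cond_b_set {X Y : NSpace} (A : BLin X Y) (hS : EFun X) (hT : EFun Y)
  (p : Bpt X Y) : Prop :=
  exists (us : Dual X) (uu : Dual (Dual X)) (vs : Dual Y) (vv : Dual (Dual Y))
         (zz : Dual (Dual Y)) (r : R),
    (* zz = A^** uu + vv,  where A^** uu = uu o A^* *)
    (forall g : Dual Y, dapp zz g = dapp uu (adj A g) + dapp vv g) /\
    ER_le (ER_plus (conjugate hS us uu) (conjugate hT vs vv)) (ERfin r) /\
    p = (us, adj A vs, zz, r).

Definition cond_b_W {X Y : NSpace} (A : BLin X Y) (p : Bpt X Y) : Prop :=
  let '(a, b, zz, _) := p in
  a = b /\ exists uu : Dual (Dual X), forall g : Dual Y, dapp zz g = dapp uu (adj A g).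

(* closure in (X^*,w^* ) x (X^*,w^* ) x (Y^**,w^* ) x R, via nets *)
Definition wstar_cl {X Y : NSpace} (K : Bpt X Y -> Prop) (p : Bpt X Y) : Prop :=
  let '(a, b, zz, r) := p in
  exists (D : Directed) (pn : D -> Bpt X Y),
    (forall i, K (pn i)) /\
    (forall x : X, net_lim (fun i => let '(a', _, _, _) := pn i in dapp a' x) (dapp a x)) /\
    (forall x : X, net_lim (fun i => let '(_, b', _, _) := pn i in dapp b' x) (dapp b x)) /\
    (forall g : Dual Y, net_lim (fun i => let '(_, _, z', _) := pn i in dapp z' g) (dapp zz g)) /\
    net_lim (fun i => let '(_, _, _, r') := pn i in r') r.

Definition cond_b {X Y : NSpace} (A : BLin X Y) (hS : EFun X) (hT : EFun Y) : Prop :=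
  forall p, (wstar_cl (cond_b_set A hS hT) p /\ cond_b_W A p) <->
            (cond_b_set A hS hT p /\ cond_b_W A p).

(* Main.v *)
Require Import Defs.
From Stdlib Require Import Reals Lra Lia List Psatz ClassicalEpsilon ProofIrrelevance
  FunctionalExtensionality PropExtensionality.
From mathcomp Require classical_sets.
Open Scope R_scope.

(** Let [H] be the closed epigraph of [h]. Under (a) or (b) the conjugate of the infimal
    convolution is given by an attained formula
    [min { hS^*(x^*, u^** ) + hT^*(v^*, v^** ) : A^* v^* = x^*, A^** u^** + v^** = A^** x^** }]:
    under (a) by Lagrange duality, a Baire category argument bounding the perturbed value near 0;
    under (b) because [(x^*, x^*, A^** x^**, value)] always lies in the weak* closure of the set
    in (b). Attainment gives [h^* >= c] and, with [D(cl S)] contained in [X], identifies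
    [{h = c}] with the parallel sum.

    That the contact set [M] of a strong representative function is of type (D) is the theorem of
    Marques Alves and Svaiter. Fenchel duality with a quadratic kernel plus an iteration gives
    a Brondsted-Rockafellar property, hence points of [M] with
    [<m - x, m^* - x^*> + c/2 |m - x|^2 + |m^* - x^*|^2 / (2c)] arbitrarily small. This yields
    maximality and, as [c -> 0], that the conjugate [phi] of the coupling restricted to [M]
    majorizes the coupling on [X^* x X^**]. For a point of the Gossez closure equality holds, so
    the affine function tangent to the coupling there minorizes [phi]; a separation argument then
    produces bounded nets in the convex hull of the graph of the coupling over [M], and
    Brondsted-Rockafellar moves them into [M]. *)


(** Functions enter the duality arguments as relations [K e r], read as points of an epigraph, so
    infinite values and unattained infima need no case analysis; extended reals return only when the
    result is translated. Hahn-Banach is used in two forms: [lagrange_multiplier] turns an upper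
    bound near 0 on a perturbed value into a multiplier, and [nonvertical_separation] turns a conic
    lower bound into a nonvertical hyperplane. No weak* topology is set up: one separates for a
    seminorm whose weak* part is a finite sum of evaluations, and the kernel argument shows that the
    functional obtained is an evaluation there.

    The obstacle in identifying the parallel sum is that the optimal [uu] lies in the bidual,
    whereas a point of [X] is wanted. At a contact point both strong inequalities are tight, which
    puts [uu] and [xs] in the Gossez closure of [S]; there the domain assumption yields [u] in [X],
    and [vv] becomes evaluation at [A (x - u)].

    For type (D) the separation is run on the convex hull of the coupling over the contact set and
    not on the larger epigraph: a point of the Gossez closure is controlled only by pairs of the
    contact set. *)

Class vspace (V : NSpace) : Prop := {
  vs_addA : forall x y z : V, ns_add x (ns_add y z) = ns_add (ns_add x y) z;
  vs_addC : forall x y : V, ns_add x y = ns_add y x;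
  vs_add0 : forall x : V, ns_add x ns_zero = x;
  vs_addN : forall x : V, ns_add x (ns_opp x) = ns_zero;
  vs_scalA : forall a b (x : V), ns_scal a (ns_scal b x) = ns_scal (a * b) x;
  vs_scal1 : forall x : V, ns_scal 1 x = x;
  vs_scalDr : forall a (x y : V), ns_scal a (ns_add x y) = ns_add (ns_scal a x) (ns_scal a y);
  vs_scalDl : forall a b (x : V), ns_scal (a + b) x = ns_add (ns_scal a x) (ns_scal b x) }.

(** The norm axioms are kept apart from [vspace] because [Dual V] satisfies the algebraic ones for
    every [V], while its norm behaves well only when [V] is normed. *)
Class normed (V : NSpace) : Prop := {
  nm_vs :: vspace V;
  nm_ge0 : forall x : V, 0 <= ns_norm x;
  nm_eq0 : forall x : V, ns_norm x = 0 -> x = ns_zero;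
  nm_scal : forall a (x : V), ns_norm (ns_scal a x) = Rabs a * ns_norm x;
  nm_tri : forall x y : V, ns_norm (ns_add x y) <= ns_norm x + ns_norm y }.

Existing Class banach.

#[local] Instance banach_normed (V : NSpace) : banach V -> normed V.
Proof.
intros (a & b & c & d & e & f & g & h & i & j & k & l & _).
now split; [split|..].
Qed.

Lemma banach_complete (V : NSpace) : banach V ->
  forall u : nat -> V, cauchy u -> exists l, seq_conv u l.
Proof. intros H; apply H. Qed.

(** * Equalities in vector spaces by reflection *)

Inductive vexp := VVar (n : nat) | VZero | VAdd (a b : vexp) | VOpp (a : vexp)
  | VScal (r : R) (a : vexp).

Fixpoint vden {V : NSpace} (rho : list V) (e : vexp) : V :=
  match e with
  | VVar n => nth n rho ns_zero
  | VZero => ns_zero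
  | VAdd a b => ns_add (vden rho a) (vden rho b)
  | VOpp a => ns_opp (vden rho a)
  | VScal r a => ns_scal r (vden rho a)
  end.

Fixpoint vcoef (e : vexp) (n : nat) : R :=
  match e with
  | VVar m => if Nat.eqb m n then 1 else 0
  | VZero => 0
  | VAdd a b => vcoef a n + vcoef b n
  | VOpp a => - vcoef a n
  | VScal r a => r * vcoef a n
  end.

Fixpoint vsum {V : NSpace} (rho : list V) (c : nat -> R) : V :=
  match rho with
  | nil => ns_zero
  | x :: l => ns_add (ns_scal (c 0%nat) x) (vsum l (fun n => c (S n)))
  end.

Fixpoint vall {A} (l : list A) (P : nat -> Prop) : Prop :=
  match l with nil => True | _ :: l' => P 0%nat /\ vall l' (fun n => P (S n)) end.

Lemma vs_cancel {V : NSpace} {HV : vspace V} (x y : V) : ns_add x y = x -> y = ns_zero.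
Proof.
intros H. rewrite <- (vs_add0 y), <- (vs_addN x), vs_addA, (vs_addC y x), H.
now rewrite vs_addN.
Qed.

Lemma vs_scal0l {V : NSpace} {HV : vspace V} (x : V) : ns_scal 0 x = ns_zero.
Proof.
apply (vs_cancel (ns_scal 0 x)). rewrite <- vs_scalDl. f_equal; lra.
Qed.

Lemma vs_scal0r {V : NSpace} {HV : vspace V} (a : R) : ns_scal a ns_zero = (ns_zero : V).
Proof.
apply (vs_cancel (ns_scal a ns_zero)). now rewrite <- vs_scalDr, vs_add0.
Qed.

Lemma vs_opp {V : NSpace} {HV : vspace V} (x : V) : ns_opp x = ns_scal (-1) x.
Proof.
rewrite <- (vs_add0 (ns_opp x)), <- (vs_scal0l x).
replace 0 with (1 + -1) by lra.
rewrite vs_scalDl, vs_addA, vs_scal1, (vs_addC _ x), vs_addN, vs_addC.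
apply vs_add0.
Qed.

Lemma vsum_ext {V : NSpace} (rho : list V) c d :
  vall rho (fun n => c n = d n) -> vsum rho c = vsum rho d.
Proof.
revert c d; induction rho as [|x l IH]; simpl; intros c d; [reflexivity|].
intros [H1 H2]; rewrite H1; f_equal; now apply IH.
Qed.

Lemma vall_all {A} (l : list A) (P : nat -> Prop) : (forall n, P n) -> vall l P.
Proof. revert P; induction l; simpl; auto. Qed.

Lemma vsum_add {V : NSpace} {HV : vspace V} (rho : list V) c d :
  vsum rho (fun n => c n + d n) = ns_add (vsum rho c) (vsum rho d).
Proof.
revert c d; induction rho as [|x l IH]; simpl; intros c d; [now rewrite vs_add0|].
rewrite (IH (fun n => c (S n)) (fun n => d (S n))), vs_scalDl.
rewrite <- !vs_addA; f_equal. rewrite !vs_addA; f_equal. apply vs_addC.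
Qed.

Lemma vsum_scal {V : NSpace} {HV : vspace V} (rho : list V) r c :
  vsum rho (fun n => r * c n) = ns_scal r (vsum rho c).
Proof.
revert c; induction rho as [|x l IH]; simpl; intros c; [now rewrite vs_scal0r|].
now rewrite (IH (fun n => c (S n))), vs_scalDr, vs_scalA.
Qed.

Lemma vsum_zero {V : NSpace} {HV : vspace V} (rho : list V) :
  vsum rho (fun _ => 0) = ns_zero.
Proof.
induction rho as [|x l IH]; simpl; [easy|]. now rewrite IH, vs_scal0l, vs_add0.
Qed.

Lemma vsum_var {V : NSpace} {HV : vspace V} (rho : list V) m :
  vsum rho (fun n => if Nat.eqb m n then 1 else 0) = nth m rho ns_zero.
Proof.
revert m; induction rho as [|x l IH]; intros [|m]; simpl; auto.
- now rewrite vsum_zero, vs_scal1, vs_add0.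
- now rewrite IH, vs_scal0l, vs_addC, vs_add0.
Qed.

Lemma vden_vsum {V : NSpace} {HV : vspace V} (rho : list V) e :
  vden rho e = vsum rho (vcoef e).
Proof.
induction e; simpl.
- symmetry; apply vsum_var.
- symmetry; apply vsum_zero.
- now rewrite vsum_add, IHe1, IHe2.
- rewrite IHe, vs_opp, <- vsum_scal. apply vsum_ext, vall_all; intros; ring.
- now rewrite vsum_scal, IHe.
Qed.

(** Equal coefficients suffice whether or not the atoms are independent. [vall] computes along the
    atom list to one real equation per atom, which is left to [ring]. *)
Lemma vec_eq {V : NSpace} {HV : vspace V} (rho : list V) e1 e2 :
  vall rho (fun n => vcoef e1 n = vcoef e2 n) -> vden rho e1 = vden rho e2.
Proof. intros H; rewrite !vden_vsum; now apply vsum_ext. Qed.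

Ltac vfind x l :=
  lazymatch l with
  | x :: _ => constr:(O)
  | _ :: ?l' => let n := vfind x l' in constr:(S n)
  end.
Ltac vatoms e l :=
  lazymatch e with
  | ns_zero => l
  | ns_add ?a ?b => let l1 := vatoms a l in vatoms b l1
  | ns_opp ?a => vatoms a l
  | ns_scal _ ?a => vatoms a l
  | _ => match l with
         | _ => let n := vfind e l in l
         | _ => constr:(e :: l)
         end
  end.
Ltac vreify e l :=
  lazymatch e with
  | ns_zero => constr:(VZero)
  | ns_add ?a ?b => let a' := vreify a l in let b' := vreify b l in constr:(VAdd a' b')
  | ns_opp ?a => let a' := vreify a l in constr:(VOpp a')
  | ns_scal ?r ?a => let a' := vreify a l in constr:(VScal r a')
  | _ => let n := vfind e l in constr:(VVar n)
  end.
Ltac vec_core :=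
  unfold ns_sub;
  lazymatch goal with
  | |- @eq ?T ?a ?b =>
    let V := lazymatch type of a with
             | ns_car ?V => V
             | _ => lazymatch a with
                    | @ns_add ?V _ _ => V | @ns_opp ?V _ => V
                    | @ns_scal ?V _ _ => V | @ns_zero ?V => V
                    | _ => lazymatch b with
                       | @ns_add ?V _ _ => V | @ns_opp ?V _ => V
                       | @ns_scal ?V _ _ => V | @ns_zero ?V => V end
                    end
             end in
    let l1 := vatoms a (@nil (ns_car V)) in
    let l := vatoms b l1 in
    let e1 := vreify a l in
    let e2 := vreify b l in
    change (@vden V l e1 = @vden V l e2);
    apply vec_eq; cbv [vall vcoef Nat.eqb]
  end.
Ltac vec := vec_core; repeat split; try ring.

(** * Hahn-Banach *)

Definition linear_fun {E : NSpace} (L : E -> R) : Prop :=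
  (forall x y, L (ns_add x y) = L x + L y) /\ (forall a x, L (ns_scal a x) = a * L x).

Definition seminorm {E : NSpace} (p : E -> R) : Prop :=
  (forall x, 0 <= p x) /\ (forall a x, p (ns_scal a x) = Rabs a * p x) /\
  (forall x y, p (ns_add x y) <= p x + p y).

Definition convex_rel {E : NSpace} (K : E -> R -> Prop) : Prop :=
  forall x r y s l, 0 <= l <= 1 -> K x r -> K y s ->
    K (ns_add (ns_scal l x) (ns_scal (1 - l) y)) (l * r + (1 - l) * s).

(* The cone [Q] plays the role of the epigraph of the sublinear majorant. *)
Lemma hahn_banach_cone (E : NSpace) {HE : vspace E} (Q : E -> R -> Prop) :
  (forall x u y v, Q x u -> Q y v -> Q (ns_add x y) (u + v)) ->
  (forall t x u, 0 < t -> Q x u -> Q (ns_scal t x) (t * u)) ->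
  (forall x, exists u, Q x u) ->
  (forall u, Q ns_zero u -> 0 <= u) ->
  exists L, linear_fun L /\ forall x u, Q x u -> L x <= u.
Proof.
intros Qadd Qscal Qtot Q0.
pose (P := fun G : E * R -> Prop =>
  (forall x r y s a b, G (x, r) -> G (y, s) ->
     G (ns_add (ns_scal a x) (ns_scal b y), a * r + b * s)) /\
  (forall x r v, G (x, r) -> Q x v -> r <= v)).
destruct (classical_sets.Zorn_bigcup (P := P)) as [G [[Glin Gdom] Gmax]].
{ intros F FP Ftot. split.
  - intros x r y s a b [A FA Ax] [B FB By].
    destruct (Ftot A B FA FB) as [H|H].
    + exists B; [auto|]. exact (proj1 (FP B FB) _ _ _ _ a b (H _ Ax) By).
    + exists A; [auto|]. exact (proj1 (FP A FA) _ _ _ _ a b Ax (H _ By)).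
  - intros x r v [A FA Ax]. exact (proj2 (FP A FA) _ _ _ Ax). }
(* [P] also admits the empty relation, the union of the empty chain, so the origin enters [G] only
   through maximality. *)
assert (G0 : G (ns_zero, 0)).
{ destruct (classic (exists z, G z)) as [[[x r] Hz]|Hn].
  - generalize (Glin x r x r 0 0 Hz Hz).
    replace (0 * r + 0 * r) with 0 by ring.
    now replace (ns_add (ns_scal 0 x) (ns_scal 0 x)) with (ns_zero : E) by vec.
  - exfalso. apply (Gmax (fun z => z = (ns_zero, 0))).
    + split; [intros z Hz; exfalso; eauto|].
      intros H; apply Hn; exists (ns_zero, 0); now apply H.
    + split.
      * intros x r y s a b [= -> ->] [= -> ->]. f_equal; [vec|ring].
      * intros x r v [= -> ->]. apply Q0. }
assert (Gtot : forall x, exists r, G (x, r)).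
{ intros e0. apply NNPP; intros Hno.
  (* An extension may take at [e0] any value above all [r - v] and below all [v' - r']; [key]
     compares the two families, and the supremum of the first one is chosen. *)
  pose (lo := fun c => exists x r v, G (x, r) /\ Q (ns_sub x e0) v /\ c = r - v).
  assert (key : forall x r v x' r' v', G (x, r) -> Q (ns_sub x e0) v -> G (x', r') ->
     Q (ns_add x' e0) v' -> r - v <= v' - r').
  { intros x r v x' r' v' Hx Hv Hx' Hv'.
    generalize (Qadd _ _ _ _ Hv Hv').
    replace (ns_add (ns_sub x e0) (ns_add x' e0)) with
      (ns_add (ns_scal 1 x) (ns_scal 1 x')) by vec.
    intros H. generalize (Gdom _ _ _ (Glin _ _ _ _ 1 1 Hx Hx') H). lra. }
  destruct (Qtot (ns_sub ns_zero e0)) as [v1 Hv1].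
  destruct (Qtot (ns_add ns_zero e0)) as [v2 Hv2].
  destruct (completeness lo) as [c [cub club]].
  { exists (v2 - 0). intros c (x & r & v & Hx & Hv & ->). eapply key; eauto. }
  { exists (0 - v1), ns_zero, 0, v1; auto. }
  assert (c1 : forall x r v, G (x, r) -> Q (ns_sub x e0) v -> r - c <= v).
  { intros x r v Hx Hv. assert (r - v <= c) by (apply cub; now exists x, r, v). lra. }
  assert (c2 : forall x r v, G (x, r) -> Q (ns_add x e0) v -> r + c <= v).
  { intros x r v Hx Hv. assert (c <= v - r); [|lra].
    apply club. intros d (x' & r' & v' & Hx' & Hv' & ->). eapply key; eauto. }
  apply (Gmax (fun z => exists x r t, G (x, r) /\
     z = (ns_add x (ns_scal t e0), r + t * c))).
  - split.
    + intros [x r] Hx. exists x, r, 0. split; auto. f_equal; [vec|ring].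
    + intros H. apply Hno. exists c. apply H.
      exists ns_zero, 0, 1. split; auto. f_equal; [vec|ring].
  - split.
    + intros x r y s a b (x1 & r1 & t1 & H1 & [= -> ->]) (x2 & r2 & t2 & H2 & [= -> ->]).
      exists (ns_add (ns_scal a x1) (ns_scal b x2)), (a * r1 + b * r2), (a * t1 + b * t2).
      split; [auto|]. f_equal; [vec|ring].
    + intros x r v (x1 & r1 & t & H1 & [= -> ->]) Hv.
      destruct (Rtotal_order t 0) as [Ht|[->|Ht]].
      * assert (Ht' : 0 < / (- t)) by (apply Rinv_0_lt_compat; lra).
        generalize (Qscal _ _ _ Ht' Hv).
        replace (ns_scal (/ - t) (ns_add x1 (ns_scal t e0))) with
          (ns_sub (ns_add (ns_scal (/ - t) x1) (ns_scal 0 x1)) e0)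
          by (vec; field; lra).
        intros H. generalize (c1 _ _ _ (Glin _ _ _ _ (/ - t) 0 H1 H1) H).
        intros H2. apply (Rmult_le_reg_l (/ - t)); [auto|].
        eapply Rle_trans; [|exact H2]. right; field; lra.
      * replace (ns_add x1 (ns_scal 0 e0)) with x1 in Hv by vec.
        rewrite Rmult_0_l, Rplus_0_r. eauto.
      * assert (Ht' : 0 < / t) by (apply Rinv_0_lt_compat; lra).
        generalize (Qscal _ _ _ Ht' Hv).
        replace (ns_scal (/ t) (ns_add x1 (ns_scal t e0))) with
          (ns_add (ns_add (ns_scal (/ t) x1) (ns_scal 0 x1)) e0)
          by (vec; field; lra).
        intros H. generalize (c2 _ _ _ (Glin _ _ _ _ (/ t) 0 H1 H1) H).
        intros H2. apply (Rmult_le_reg_l (/ t)); [auto|].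
        eapply Rle_trans; [|exact H2]. right; field; lra. }
(* [P] does not ask [G] to be functional. Two values at [x] would put their difference above 0,
   where small multiples of a single point of [Q] bound it. *)
assert (Gle : forall x r s, G (x, r) -> G (x, s) -> r <= s).
{ intros x r s Hr Hs. destruct (Rle_or_lt r s) as [|Hlt]; auto.
  destruct (Qtot ns_zero) as [v Hv]. generalize (Q0 v Hv); intros Hv0.
  pose (t := (r - s) / (2 * (v + 1))).
  assert (Ht : 0 < t) by (apply Rdiv_lt_0_compat; lra).
  generalize (Qscal _ _ _ Ht Hv).
  replace (ns_scal t (ns_zero : E)) with (ns_add (ns_scal 1 x) (ns_scal (-1) x)) by vec.
  intros H. generalize (Gdom _ _ _ (Glin _ _ _ _ 1 (-1) Hr Hs) H).
  intros H2. assert (t * v * 2 <= r - s); [|lra].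
  unfold t. apply (Rmult_le_reg_r (v + 1)); [lra|]. field_simplify; nra. }
destruct (choice _ Gtot) as [L HL].
exists L. split; [split|].
- intros x y. generalize (Glin _ _ _ _ 1 1 (HL x) (HL y)).
  replace (ns_add (ns_scal 1 x) (ns_scal 1 y)) with (ns_add x y) by vec.
  rewrite !Rmult_1_l. intros H; apply Rle_antisym; eapply Gle; eauto.
- intros a x. generalize (Glin _ _ _ _ a 0 (HL x) (HL x)).
  replace (ns_add (ns_scal a x) (ns_scal 0 x)) with (ns_scal a x) by vec.
  replace (a * L x + 0 * L x) with (a * L x) by ring.
  intros H; apply Rle_antisym; eapply Gle; eauto.
- intros x u Hu; eauto.
Qed.

Lemma seminorm_zero (E : NSpace) {HE : vspace E} (p : E -> R) : seminorm p -> p ns_zero = 0.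
Proof.
intros (_ & ps & _). rewrite <- (vs_scal0l ns_zero), ps, Rabs_R0. ring.
Qed.

(** The cone is the epigraph of the infimum of [p (e + l k) + l s] over [l >= 0] and [K k s]. Taking
    [l = 0] bounds it by [p], taking [l = 1] bounds it by [r] at [- e], and positivity at 0 is the
    hypothesis scaled by [l]. *)
Lemma hahn_banach_lagrange (E : NSpace) {HE : vspace E} (p : E -> R) (K : E -> R -> Prop) :
  seminorm p -> convex_rel K -> (forall e r, K e r -> 0 <= p e + r) ->
  exists L, linear_fun L /\ (forall e, Rabs (L e) <= p e) /\
    forall e r, K e r -> 0 <= L e + r.
Proof.
intros Hp HK Hpos. pose proof (seminorm_zero E p Hp) as p0. destruct Hp as (pge & ps & pt).
destruct (classic (exists k s, K k s)) as [(k0 & s0 & H0)|Hn].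
2:{ exists (fun _ => 0). split; [split; intros; ring|]. split.
    - intros; now rewrite Rabs_R0.
    - intros e r H; exfalso; eauto. }
destruct (hahn_banach_cone E (fun e v => exists l k s,
   0 <= l /\ K k s /\ p (ns_add e (ns_scal l k)) + l * s <= v)) as (L & [La Ls] & HL).
- intros x u y v (l & k & s & Hl & Hk & H) (l' & k' & s' & Hl' & Hk' & H').
  destruct (Req_dec (l + l') 0) as [Hz|Hz].
  + exists 0, k, s. split; [lra|split; auto].
    replace l with 0 in H by lra. replace l' with 0 in H' by lra.
    replace (ns_add (ns_add x y) (ns_scal 0 k)) with
     (ns_add (ns_add x (ns_scal 0 k)) (ns_add y (ns_scal 0 k'))) by vec.
    eapply Rle_trans; [apply Rplus_le_compat_r, pt|]. lra.
  + set (t := l / (l + l')).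
    assert (Hpos' : 0 < l + l') by lra.
    assert (Ht : 0 <= t <= 1).
    { unfold t; split; [apply Rmult_le_pos; [auto|left; now apply Rinv_0_lt_compat]|].
      apply (Rmult_le_reg_r (l + l')); [auto|]. field_simplify; lra. }
    exists (l + l'), (ns_add (ns_scal t k) (ns_scal (1 - t) k')), (t * s + (1 - t) * s').
    split; [lra|split; [now apply HK|]].
    replace (ns_add (ns_add x y) _) with
     (ns_add (ns_add x (ns_scal l k)) (ns_add y (ns_scal l' k')))
     by (unfold t; vec; field; lra).
    replace ((l + l') * (t * s + (1 - t) * s')) with (l * s + l' * s')
      by (unfold t; field; lra).
    eapply Rle_trans; [apply Rplus_le_compat_r, pt|]. lra.
- intros t x u Ht (l & k & s & Hl & Hk & H).
  exists (t * l), k, s. split; [nra|split; auto].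
  replace (ns_add (ns_scal t x) (ns_scal (t * l) k)) with
    (ns_scal t (ns_add x (ns_scal l k))) by vec.
  rewrite ps, Rabs_pos_eq by lra. nra.
- intros x. exists (p (ns_add x (ns_scal 0 k0)) + 0 * s0), 0, k0, s0.
  split; [lra|split; auto; lra].
- intros u (l & k & s & Hl & Hk & H).
  replace (ns_add ns_zero (ns_scal l k)) with (ns_scal l k) in H by vec.
  rewrite ps, Rabs_pos_eq in H by lra. generalize (Hpos _ _ Hk). nra.
- assert (Lp : forall e, L e <= p e).
  { intros e. apply HL. exists 0, k0, s0. split; [lra|split; auto].
    replace (ns_add e (ns_scal 0 k0)) with e by vec. lra. }
  exists L. split; [now split|split].
  + intros e. apply Rabs_le. split; [|auto].
    generalize (Lp (ns_scal (-1) e)). rewrite Ls, ps.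
    rewrite Rabs_left by lra. lra.
  + intros e r He. assert (L (ns_scal (-1) e) <= r).
    { apply HL. exists 1, e, r. split; [lra|split; auto].
      replace (ns_add (ns_scal (-1) e) (ns_scal 1 e)) with (ns_zero : E) by vec.
      rewrite p0; lra. }
    rewrite Ls in H. lra.
Qed.

Lemma norm_seminorm (E : NSpace) {HE : normed E} : seminorm (@ns_norm E).
Proof. split; [apply nm_ge0|split; [apply nm_scal|apply nm_tri]]. Qed.

Lemma seminorm_scal (E : NSpace) (p : E -> R) C :
  0 <= C -> seminorm p -> seminorm (fun x => C * p x).
Proof.
intros HC (pge & ps & pt). split; [|split].
- intros x; now apply Rmult_le_pos.
- intros; rewrite ps; ring.
- intros x y; rewrite <- Rmult_plus_distr_l; now apply Rmult_le_compat_l.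
Qed.

(* Lagrange multiplier for a perturbed problem: [K] is the epigraph of the perturbed value,
   nonnegative at [0] and bounded above near [0] (inside the cone it lives on). *)
Lemma lagrange_multiplier (E : NSpace) {HE : normed E} (K : E -> R -> Prop) delta M :
  convex_rel K -> (forall r, K ns_zero r -> 0 <= r) -> 0 < delta ->
  (forall e r t, K e r -> ns_norm (ns_scal t e) < delta ->
     exists r', r' <= M /\ K (ns_scal t e) r') ->
  exists L C, linear_fun L /\ 0 <= C /\ (forall e, Rabs (L e) <= C * ns_norm e) /\
    forall e r, K e r -> 0 <= L e + r.
Proof.
intros HK H0 Hd Hub.
(* From [e] one crosses 0 to the opposite point of norm [delta / 2], where the value is at most [M].
   Convexity and nonnegativity at 0 then bound [r] below by [- |M|] times [2 |e| / delta]. *)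
set (C := 2 * Rabs M / delta).
assert (HC : 0 <= C).
{ apply Rmult_le_pos; [|left; now apply Rinv_0_lt_compat].
  generalize (Rabs_pos M); lra. }
destruct (hahn_banach_lagrange E (fun x => C * ns_norm x) K) as (L & HL & Hb & HLK);
 [apply seminorm_scal; [auto|apply norm_seminorm; auto]|auto| |now exists L, C].
intros e r Her. destruct (Req_dec (ns_norm e) 0) as [Hz|Hz].
- apply nm_eq0 in Hz; subst e. generalize (H0 _ Her) (nm_ge0 (ns_zero : E)). nra.
- assert (Hn : 0 < ns_norm e) by (generalize (nm_ge0 e); lra).
  set (t := delta / (2 * ns_norm e)).
  assert (Ht : 0 < t) by (apply Rdiv_lt_0_compat; lra).
  destruct (Hub e r (- t) Her) as (r' & Hr' & Kr').
  { rewrite nm_scal, Rabs_Ropp, Rabs_pos_eq by lra. unfold t.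
    replace (delta / (2 * ns_norm e) * ns_norm e) with (delta / 2) by (field; lra). lra. }
  assert (Hl : 0 <= t / (1 + t) <= 1).
  { split; [apply Rmult_le_pos; [lra|left; apply Rinv_0_lt_compat; lra]|].
    apply (Rmult_le_reg_r (1 + t)); [lra|]. field_simplify; lra. }
  generalize (HK _ _ _ _ _ Hl Her Kr').
  replace (ns_add _ _) with (ns_zero : E) by (vec; field; lra).
  intros Hk. apply H0 in Hk.
  assert (Hk' : 0 <= t * r + r').
  { apply (Rmult_le_reg_r (/ (1 + t))); [apply Rinv_0_lt_compat; lra|].
    rewrite Rmult_0_l. eapply Rle_trans; [exact Hk|]. right; field; lra. }
  assert (t * (C * ns_norm e) = Rabs M) by (unfold t, C; field; lra).
  generalize (Rle_abs M); intros. apply (Rmult_le_reg_l t); [auto|]. nra.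
Qed.

(** The slope [N] is large enough for the cone [s - N p (e - e0)] to stay below [K]: within distance
    [delta] because [K] avoids values under [s], and farther out because [|s - B| / delta] times the
    distance makes up for the lower bound [B]. *)
Lemma nonvertical_separation (E : NSpace) {HE : vspace E} (p : E -> R)
    (K : E -> R -> Prop) (e0 : E) (s delta C B : R) :
  seminorm p -> convex_rel K -> 0 < delta -> 0 <= C ->
  (forall e r, K e r -> B <= r + C * p (ns_sub e e0)) ->
  (forall e r, K e r -> p (ns_sub e e0) < delta -> s <= r) ->
  exists L N, linear_fun L /\ 0 <= N /\ (forall e, Rabs (L e) <= N * p e) /\
    forall e r, K e r -> s <= L e - L e0 + r.
Proof.
intros Hp HK Hd HC Hmin Hav.
set (N := C + Rabs (s - B) / delta).
assert (HN : 0 <= Rabs (s - B) / delta).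
{ apply Rmult_le_pos; [apply Rabs_pos|left; now apply Rinv_0_lt_compat]. }
destruct (hahn_banach_lagrange E (fun x => N * p x)
  (fun e r => K (ns_add e e0) (r + s))) as (L & HL & Hb & HLK).
- apply seminorm_scal; [unfold N; lra|auto].
- intros x r y t l Hl Hx Hy. generalize (HK _ _ _ _ _ Hl Hx Hy).
  replace (l * (r + s) + (1 - l) * (t + s)) with (l * r + (1 - l) * t + s) by ring.
  replace (ns_add (ns_scal l (ns_add x e0)) (ns_scal (1 - l) (ns_add y e0))) with
   (ns_add (ns_add (ns_scal l x) (ns_scal (1 - l) y)) e0) by vec.
  easy.
- intros e r Her. generalize (Hmin _ _ Her) (Hav _ _ Her).
  replace (ns_sub (ns_add e e0) e0) with e by vec. intros H1 H2.
  destruct (Rlt_or_le (p e) delta) as [Hlt|Hle].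
  + specialize (H2 Hlt). destruct Hp as [Hp _]. specialize (Hp e). unfold N; nra.
  + unfold N. assert (Rabs (s - B) <= Rabs (s - B) / delta * p e).
    { replace (Rabs (s - B)) with (Rabs (s - B) / delta * delta) at 1 by (field; lra).
      now apply Rmult_le_compat_l. }
    generalize (Rle_abs (s - B)). lra.
- exists L, N. split; [auto|split; [unfold N; lra|split; [auto|]]].
  intros e r Her. destruct HL as [La Ls].
  generalize (HLK (ns_sub e e0) (r - s)).
  replace (ns_add (ns_sub e e0) e0) with e by vec.
  replace (r - s + s) with r by ring. intros H; specialize (H Her).
  unfold ns_sub in H. rewrite La, vs_opp, Ls in H. lra.
Qed.

(** The span of the list is replaced by a class [F] closed under adding multiples. With [F] the
    class of evaluations, the conclusion directly names the point at which [L] evaluates. *)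
Lemma kernel_lemma (E : NSpace) {HE : vspace E} (F : (E -> R) -> Prop) (l : list (E -> R)) :
  (forall f g, F f -> (forall e, f e = g e) -> F g) ->
  F (fun _ => 0) ->
  (forall f g a, F f -> F g -> F (fun e => f e + a * g e)) ->
  (forall f, In f l -> F f /\ linear_fun f) ->
  forall L, linear_fun L -> (forall e, (forall f, In f l -> f e = 0) -> L e = 0) -> F L.
Proof.
intros Fext F0 Fcomb. induction l as [|f l IH]; intros Hl L HL HLz.
- apply Fext with (1 := F0). intros e; symmetry; apply HLz; now intros.
- assert (Hl' : forall g, In g l -> F g /\ linear_fun g) by (intros; apply Hl; now right).
  destruct (Hl f (or_introl eq_refl)) as [Ff [fa fs]].
  destruct (classic (exists e, (forall g, In g l -> g e = 0) /\ f e <> 0)) as [(e1 & H1 & H2)|Hn].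
  + destruct HL as [La Ls].
    apply Fext with (fun e => (L e - L e1 / f e1 * f e) + L e1 / f e1 * f e);
      [|intros; field; auto].
    apply (Fcomb (fun e => L e - L e1 / f e1 * f e) f); auto.
    apply IH; auto.
    * split; intros; rewrite ?La, ?Ls, ?fa, ?fs; field; auto.
    * intros e He.
      assert (H : L (ns_add e (ns_scal (- (f e / f e1)) e1)) = 0).
      { apply HLz. intros g [<-|Hg].
        - rewrite fa, fs. field; auto.
        - destruct (Hl' g Hg) as [_ [ga gs]]. rewrite ga, gs, (He g Hg), (H1 g Hg). ring. }
      rewrite La, Ls in H. rewrite <- H. field; auto.
  + apply IH; auto. intros e He. apply HLz. intros g [<-|Hg]; auto.
    apply NNPP; intros H; apply Hn; eauto.
Qed.


(** * Dual and product spaces *)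

Lemma dual_ext {V : NSpace} (f g : Dual V) : (forall x, dapp f x = dapp g x) -> f = g.
Proof.
destruct f as [f Hf], g as [g Hg]; unfold dapp; simpl; intros H.
assert (f = g) by (now apply functional_extensionality). subst g.
f_equal; apply proof_irrelevance.
Qed.

Lemma dapp_addr {V : NSpace} (f : Dual V) x y : dapp f (ns_add x y) = dapp f x + dapp f y.
Proof. apply (proj2_sig f). Qed.
Lemma dapp_scalr {V : NSpace} (f : Dual V) a x : dapp f (ns_scal a x) = a * dapp f x.
Proof. apply (proj2_sig f). Qed.
Lemma dapp_oppr {V : NSpace} {HV : vspace V} (f : Dual V) x : dapp f (ns_opp x) = - dapp f x.
Proof. rewrite vs_opp, dapp_scalr; ring. Qed.
Lemma dapp_zeror {V : NSpace} {HV : vspace V} (f : Dual V) : dapp f ns_zero = 0.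
Proof. rewrite <- (vs_scal0l ns_zero), dapp_scalr; ring. Qed.
Lemma dapp_subr {V : NSpace} {HV : vspace V} (f : Dual V) x y :
  dapp f (ns_sub x y) = dapp f x - dapp f y.
Proof. unfold ns_sub; rewrite dapp_addr, dapp_oppr; ring. Qed.
Lemma dapp_addl {V : NSpace} (f g : Dual V) x : dapp (ns_add f g) x = dapp f x + dapp g x.
Proof. reflexivity. Qed.
Lemma dapp_scall {V : NSpace} a (f : Dual V) x : dapp (ns_scal a f) x = a * dapp f x.
Proof. reflexivity. Qed.
Lemma dapp_oppl {V : NSpace} (f : Dual V) x : dapp (ns_opp f) x = - dapp f x.
Proof. reflexivity. Qed.
Lemma dapp_zerol {V : NSpace} (x : V) : dapp (ns_zero : Dual V) x = 0.
Proof. reflexivity. Qed.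
Lemma dapp_subl {V : NSpace} (f g : Dual V) x : dapp (ns_sub f g) x = dapp f x - dapp g x.
Proof. reflexivity. Qed.

Ltac linall := repeat progress (rewrite ?dapp_addl, ?dapp_scall, ?dapp_oppl, ?dapp_zerol, ?dapp_subl,
  ?dapp_addr, ?dapp_scalr, ?dapp_oppr, ?dapp_zeror, ?dapp_subr).

#[local] Instance dual_vspace (V : NSpace) : vspace (Dual V).
Proof.
split; intros; apply dual_ext; intros; rewrite ?dapp_addl, ?dapp_scall, ?dapp_addl, ?dapp_oppl,
  ?dapp_zerol, ?dapp_scall; ring.
Qed.

Lemma dnorm_lub {V : NSpace} {HV : normed V} (f : Dual V) :
  is_lub (fun r => exists x : V, ns_norm x <= 1 /\ r = Rabs (dapp f x)) (ns_norm f).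
Proof.
unfold ns_norm; simpl; unfold dnorm. apply epsilon_spec.
destruct (proj2_sig f) as (_ & _ & M & HM & Hb).
destruct (completeness (fun r => exists x : V, ns_norm x <= 1 /\ r = Rabs (dapp f x)))
  as [m Hm]; [| |now exists m].
- exists M. intros r (x & Hx & ->). eapply Rle_trans; [apply Hb|].
  generalize (nm_ge0 x); nra.
- exists 0, ns_zero. split; [|rewrite dapp_zeror; now rewrite Rabs_R0].
  rewrite <- (vs_scal0l ns_zero), nm_scal, Rabs_R0. lra.
Qed.

Lemma dnorm_ge0 {V : NSpace} {HV : normed V} (f : Dual V) : 0 <= ns_norm f.
Proof.
destruct (dnorm_lub f) as [H _]. apply H. exists ns_zero.
split; [|rewrite dapp_zeror; now rewrite Rabs_R0].
rewrite <- (vs_scal0l ns_zero), nm_scal, Rabs_R0. lra.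
Qed.

Lemma dapp_le {V : NSpace} {HV : normed V} (f : Dual V) x :
  Rabs (dapp f x) <= ns_norm f * ns_norm x.
Proof.
destruct (Req_dec (ns_norm x) 0) as [Hz|Hz].
- rewrite Hz. apply nm_eq0 in Hz; subst x. rewrite dapp_zeror, Rabs_R0. lra.
- assert (Hn : 0 < ns_norm x) by (generalize (nm_ge0 x); lra).
  assert (H : Rabs (dapp f (ns_scal (/ ns_norm x) x)) <= ns_norm f).
  { apply (proj1 (dnorm_lub f)). eexists; split; [|reflexivity].
    rewrite nm_scal, Rabs_pos_eq; [|left; now apply Rinv_0_lt_compat].
    rewrite Rinv_l; lra. }
  rewrite dapp_scalr, Rabs_mult, Rabs_pos_eq in H; [|left; now apply Rinv_0_lt_compat].
  apply (Rmult_le_compat_r (ns_norm x)) in H; [|lra].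
  rewrite (Rmult_comm (/ _)), Rmult_assoc, Rinv_l in H; lra.
Qed.

Lemma dapp_ub {V : NSpace} {HV : normed V} (f : Dual V) x :
  dapp f x <= ns_norm f * ns_norm x.
Proof. eapply Rle_trans; [apply Rle_abs|apply dapp_le]. Qed.

Lemma dapp_lb {V : NSpace} {HV : normed V} (f : Dual V) x :
  - (ns_norm f * ns_norm x) <= dapp f x.
Proof. generalize (dapp_le f x) (Rle_abs (- dapp f x)). rewrite Rabs_Ropp; lra. Qed.

Lemma dnorm_le {V : NSpace} {HV : normed V} (f : Dual V) B :
  (forall x, ns_norm x <= 1 -> Rabs (dapp f x) <= B) -> ns_norm f <= B.
Proof. intros H. apply (proj2 (dnorm_lub f)). intros r (x & Hx & ->); auto. Qed.

Lemma dnorm_le_lin {V : NSpace} {HV : normed V} (f : Dual V) B : 0 <= B ->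
  (forall x, Rabs (dapp f x) <= B * ns_norm x) -> ns_norm f <= B.
Proof.
intros HB H. apply dnorm_le. intros x Hx. eapply Rle_trans; [apply H|].
generalize (nm_ge0 x); nra.
Qed.

#[local] Instance dual_normed (V : NSpace) : normed V -> normed (Dual V).
Proof.
intros HV. split.
- apply dual_vspace.
- apply dnorm_ge0.
- intros f Hf. apply dual_ext; intros x. generalize (dapp_le f x).
  rewrite Hf, Rmult_0_l, dapp_zerol. intros H.
  apply NNPP; intros Hn. apply Rabs_pos_lt in Hn. lra.
- assert (key : forall a (f : Dual V), ns_norm (ns_scal a f) <= Rabs a * ns_norm f).
  { intros a f. apply dnorm_le_lin.
    - apply Rmult_le_pos; [apply Rabs_pos|apply dnorm_ge0].
    - intros x; rewrite dapp_scall, Rabs_mult, Rmult_assoc.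
      apply Rmult_le_compat_l; [apply Rabs_pos|apply dapp_le]. }
  intros a f. apply Rle_antisym; [auto|].
  destruct (Req_dec a 0) as [->|Ha].
  + rewrite Rabs_R0, Rmult_0_l. apply dnorm_ge0.
  + generalize (key (/ a) (ns_scal a f)).
    replace (ns_scal (/ a) (ns_scal a f)) with f
      by (apply dual_ext; intros; rewrite !dapp_scall; field; auto).
    intros H. apply (Rmult_le_compat_l (Rabs a)) in H; [|apply Rabs_pos].
    rewrite <- Rmult_assoc, <- Rabs_mult, Rinv_r, Rabs_R1, Rmult_1_l in H; auto.
- intros f g. apply dnorm_le_lin.
  + generalize (dnorm_ge0 f) (dnorm_ge0 g); lra.
  + intros x. rewrite dapp_addl. eapply Rle_trans; [apply Rabs_triang|].
    generalize (dapp_le f x) (dapp_le g x); lra.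
Qed.

Lemma dual_of_linear {V : NSpace} (L : V -> R) C :
  linear_fun L -> 0 <= C -> (forall x, Rabs (L x) <= C * ns_norm x) ->
  exists f : Dual V, forall x, dapp f x = L x.
Proof.
intros [La Ls] HC Hb.
assert (H : lin_cont V L) by (split; [auto|split; eauto]).
now exists (exist _ L H).
Qed.

Lemma Un_cv_bound (a : nat -> R) l c B N :
  Un_cv a l -> (forall n, (N <= n)%nat -> Rabs (a n - c) <= B) -> Rabs (l - c) <= B.
Proof.
intros Ha Hb. apply Rnot_lt_le; intros Hlt.
destruct (Ha (Rabs (l - c) - B)) as [N' HN']; [lra|].
generalize (HN' (Nat.max N N') ltac:(lia)) (Hb (Nat.max N N') ltac:(lia)).
unfold Rdist. set (x := a _). intros H1 H2.
assert (Rabs (l - c) <= Rabs (x - l) + Rabs (x - c)); [|lra].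
replace (l - c) with (- (x - l) + (x - c)) by ring.
eapply Rle_trans; [apply Rabs_triang|]. rewrite Rabs_Ropp; lra.
Qed.

#[local] Instance dual_banach (V : NSpace) : banach V -> banach (Dual V).
Proof.
intros HV.
assert (HN : normed (Dual V)) by (apply dual_normed; exact _).
repeat split; try apply HN; try apply dual_vspace.
intros u Hu.
assert (Hc : forall x, exists l, Un_cv (fun n => dapp (u n) x) l).
{ intros x. destruct (R_complete (fun n => dapp (u n) x)) as [l Hl]; [|eauto].
  intros eps He. assert (Hx := nm_ge0 x).
  destruct (Hu (eps / (ns_norm x + 1))) as [N HN']; [apply Rdiv_lt_0_compat; lra|].
  exists N. intros n m Hn Hm. unfold Rdist. rewrite <- dapp_subl.
  eapply Rle_lt_trans; [apply dapp_le|].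
  specialize (HN' n m Hn Hm).
  apply Rle_lt_trans with (ns_norm (ns_sub (u n) (u m)) * (ns_norm x + 1)).
  - apply Rmult_le_compat_l; [apply nm_ge0|lra].
  - apply (Rmult_lt_compat_r (ns_norm x + 1)) in HN'; [|lra].
    unfold Rdiv in HN'. rewrite Rmult_assoc, Rinv_l in HN' by lra. lra. }
destruct (choice _ Hc) as [L HL].
assert (Llin : linear_fun L).
{ split.
  - intros x y. apply UL_sequence with (1 := HL _).
    apply Un_cv_ext with (fun n => dapp (u n) x + dapp (u n) y);
      [intros; now rewrite dapp_addr|now apply CV_plus].
  - intros a x. apply UL_sequence with (1 := HL _).
    apply Un_cv_ext with (fun n => a * dapp (u n) x); [intros; now rewrite dapp_scalr|].
    apply (CV_mult (fun _ => a)); auto.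
    intros eps He; exists 0%nat; intros. unfold Rdist. now rewrite Rminus_diag, Rabs_R0. }
assert (key : forall eps, 0 < eps -> exists N, forall n, (N <= n)%nat -> forall x,
   Rabs (L x - dapp (u n) x) <= eps * ns_norm x).
{ intros eps He. destruct (Hu eps He) as [N HN']. exists N. intros n Hn x.
  apply Un_cv_bound with (1 := HL x) (N := N). intros m Hm.
  rewrite <- dapp_subl. eapply Rle_trans; [apply dapp_le|].
  apply Rmult_le_compat_r; [apply nm_ge0|]. left; auto. }
destruct (key 1) as [N0 HN0]; [lra|].
destruct (dual_of_linear L (ns_norm (u N0) + 1)) as [f Hf]; auto.
- generalize (nm_ge0 (u N0)); lra.
- intros x. specialize (HN0 N0 ltac:(lia) x). generalize (dapp_le (u N0) x).
  replace (L x) with ((L x - dapp (u N0) x) + dapp (u N0) x) by ring. intros.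
  eapply Rle_trans; [apply Rabs_triang|]. lra.
- exists f. intros eps He. destruct (key (eps / 2)) as [N HN']; [lra|].
  exists N. intros n Hn. apply Rle_lt_trans with (eps / 2); [|lra].
  apply dnorm_le_lin; [lra|]. intros x. rewrite dapp_subl, Hf, Rabs_minus_sym. auto.
Qed.

Lemma prod_addE {V W : NSpace} (a c : V) (b d : W) :
  @ns_add (nsprod V W) (a, b) (c, d) = (ns_add a c, ns_add b d).
Proof. reflexivity. Qed.
Lemma prod_scalE {V W : NSpace} t (a : V) (b : W) :
  @ns_scal (nsprod V W) t (a, b) = (ns_scal t a, ns_scal t b).
Proof. reflexivity. Qed.
Lemma prod_subE {V W : NSpace} (a c : V) (b d : W) :
  @ns_sub (nsprod V W) (a, b) (c, d) = (ns_sub a c, ns_sub b d).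
Proof. reflexivity. Qed.
Lemma prod_normE {V W : NSpace} (a : V) (b : W) :
  @ns_norm (nsprod V W) (a, b) = ns_norm a + ns_norm b.
Proof. reflexivity. Qed.

#[local] Instance nsprod_vspace (V W : NSpace) : vspace V -> vspace W -> vspace (nsprod V W).
Proof.
intros HV HW.
split; intros; repeat match goal with x : ns_car (nsprod _ _) |- _ => destruct x end;
 unfold ns_add, ns_scal, ns_opp, ns_zero; simpl; f_equal.
all: first [apply vs_addA|apply vs_addC|apply vs_add0|apply vs_addN|apply vs_scalA|
  apply vs_scal1|apply vs_scalDr|apply vs_scalDl].
Qed.

#[local] Instance nsprod_normed (V W : NSpace) : normed V -> normed W -> normed (nsprod V W).
Proof.
intros HV HW. split; [exact _|..].
- intros [v w]. rewrite prod_normE. generalize (nm_ge0 v) (nm_ge0 w); lra.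
- intros [v w]. rewrite prod_normE. generalize (nm_ge0 v) (nm_ge0 w); intros.
  change (@ns_zero (nsprod V W)) with (@ns_zero V, @ns_zero W).
  f_equal; apply nm_eq0; lra.
- intros a [v w]. rewrite prod_scalE, !prod_normE, !nm_scal. ring.
- intros [v w] [v' w']. rewrite prod_addE, !prod_normE.
  generalize (nm_tri v v') (nm_tri w w'); lra.
Qed.

Lemma seq_conv_pair {V W : NSpace} (u : nat -> nsprod V W) v w :
  seq_conv (fun n => fst (u n)) v -> seq_conv (fun n => snd (u n)) w -> seq_conv u (v, w).
Proof.
intros H1 H2 eps He.
destruct (H1 (eps / 2)) as [N1 HN1]; [lra|]. destruct (H2 (eps / 2)) as [N2 HN2]; [lra|].
exists (Nat.max N1 N2). intros n Hn.
specialize (HN1 n ltac:(lia)). specialize (HN2 n ltac:(lia)).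
destruct (u n) as [a b]; cbn [fst snd] in *. rewrite prod_subE, prod_normE. lra.
Qed.

Lemma seq_conv_fst {V W : NSpace} {HV : normed V} {HW : normed W} (u : nat -> nsprod V W) p :
  seq_conv u p -> seq_conv (fun n => fst (u n)) (fst p).
Proof.
intros H eps He. destruct (H eps He) as [N HN]. exists N; intros n Hn. specialize (HN n Hn).
destruct (u n) as [a b], p; cbn [fst snd] in *. rewrite prod_subE, prod_normE in HN.
generalize (nm_ge0 (ns_sub b n1)); lra.
Qed.

Lemma seq_conv_snd {V W : NSpace} {HV : normed V} {HW : normed W} (u : nat -> nsprod V W) p :
  seq_conv u p -> seq_conv (fun n => snd (u n)) (snd p).
Proof.
intros H eps He. destruct (H eps He) as [N HN]. exists N; intros n Hn. specialize (HN n Hn).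
destruct (u n) as [a b], p; cbn [fst snd] in *. rewrite prod_subE, prod_normE in HN.
generalize (nm_ge0 (ns_sub a n0)); lra.
Qed.

#[local] Instance nsprod_banach (V W : NSpace) : banach V -> banach W -> banach (nsprod V W).
Proof.
intros HV HW.
assert (HN : normed (nsprod V W)) by exact _.
repeat split; try apply HN; try apply nm_vs.
intros u Hu.
destruct (banach_complete V HV (fun n => fst (u n))) as [v Hv].
{ intros eps He. destruct (Hu eps He) as [N HN']. exists N; intros m n Hm Hn.
  specialize (HN' m n Hm Hn). destruct (u m), (u n). rewrite prod_subE, prod_normE in HN'.
  cbn [fst snd]. generalize (nm_ge0 (ns_sub n1 n3)); lra. }
destruct (banach_complete W HW (fun n => snd (u n))) as [w Hw].
{ intros eps He. destruct (Hu eps He) as [N HN']. exists N; intros m n Hm Hn.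
  specialize (HN' m n Hm Hn). destruct (u m), (u n). rewrite prod_subE, prod_normE in HN'.
  cbn [fst snd]. generalize (nm_ge0 (ns_sub n0 n2)); lra. }
exists (v, w). now apply seq_conv_pair.
Qed.

Definition RS : NSpace := mkNS R 0 Rplus Ropp Rmult Rabs.

#[local] Instance RS_banach : banach RS.
Proof.
repeat split; unfold ns_add, ns_scal, ns_opp, ns_zero, ns_norm; simpl; intros; try ring.
- apply Rabs_pos.
- apply NNPP; intros Hn; now apply Rabs_no_R0 in Hn.
- apply Rabs_mult.
- apply Rabs_triang.
- destruct (R_complete u) as [l Hl]; [|now exists l].
  intros eps He. destruct (H eps He) as [N HN]. exists N; intros; now apply HN.
Qed.

Lemma nm_zero {V : NSpace} {HV : normed V} : ns_norm (ns_zero : V) = 0.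
Proof. rewrite <- (vs_scal0l ns_zero), nm_scal, Rabs_R0. ring. Qed.

Lemma nm_opp {V : NSpace} {HV : normed V} (x : V) : ns_norm (ns_opp x) = ns_norm x.
Proof. rewrite vs_opp, nm_scal, Rabs_left; lra. Qed.

Lemma nm_subC {V : NSpace} {HV : normed V} (x y : V) :
  ns_norm (ns_sub x y) = ns_norm (ns_sub y x).
Proof. rewrite <- nm_opp. f_equal. vec. Qed.

Lemma nm_sub_tri {V : NSpace} {HV : normed V} (x y z : V) :
  ns_norm (ns_sub x z) <= ns_norm (ns_sub x y) + ns_norm (ns_sub y z).
Proof.
replace (ns_sub x z) with (ns_add (ns_sub x y) (ns_sub y z)) by vec. apply nm_tri.
Qed.

Lemma nm_sub_zero {V : NSpace} {HV : normed V} (x : V) : ns_norm (ns_sub x x) = 0.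
Proof. replace (ns_sub x x) with (ns_zero : V) by vec. apply nm_zero. Qed.

Lemma bl_sub {V W : NSpace} {HV : vspace V} {HW : vspace W} (A : BLin V W) x y :
  A (ns_sub x y) = ns_sub (A x) (A y).
Proof. unfold ns_sub. now rewrite bl_add, (vs_opp y), bl_scal, <- vs_opp. Qed.

Lemma bl_zero {V W : NSpace} {HV : vspace V} {HW : vspace W} (A : BLin V W) :
  A ns_zero = ns_zero.
Proof. rewrite <- (vs_scal0l (ns_zero : V)), bl_scal. apply vs_scal0l. Qed.

Lemma adjE {V W : NSpace} (A : BLin V W) (g : Dual W) x : dapp (adj A g) x = dapp g (A x).
Proof. reflexivity. Qed.

Lemma adj_add {V W : NSpace} (A : BLin V W) f g :
  adj A (ns_add f g) = ns_add (adj A f) (adj A g).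
Proof. reflexivity || (apply dual_ext; reflexivity). Qed.

Lemma adj_scal {V W : NSpace} (A : BLin V W) a f : adj A (ns_scal a f) = ns_scal a (adj A f).
Proof. reflexivity || (apply dual_ext; reflexivity). Qed.

Lemma adj_le {V W : NSpace} {HV : normed V} {HW : normed W} (A : BLin V W) :
  exists N, 0 <= N /\ forall g, ns_norm (adj A g) <= N * ns_norm g.
Proof.
destruct (bl_bnd _ _ A) as (N & HN & Hb). exists N. split; [auto|]. intros g.
apply dnorm_le_lin; [apply Rmult_le_pos; auto; apply nm_ge0|].
intros x. rewrite adjE. eapply Rle_trans; [apply dapp_le|].
rewrite (Rmult_comm N), Rmult_assoc. apply Rmult_le_compat_l; [apply nm_ge0|auto].
Qed.

Lemma canon_ex {V : NSpace} {HV : normed V} (x : V) :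
  exists xx : Dual (Dual V), canon x xx /\ ns_norm xx <= ns_norm x.
Proof.
destruct (@dual_of_linear (Dual V) (fun f => dapp f x) (ns_norm x)) as [xx Hxx].
- split; reflexivity.
- apply nm_ge0.
- intros f; rewrite Rmult_comm; apply dapp_le.
- exists xx. split; [exact Hxx|].
  apply dnorm_le_lin; [apply nm_ge0|]. intros f. rewrite Hxx, Rmult_comm; apply dapp_le.
Qed.


(** * Maximality and type (D) of operators with a strong representative function *)

(** Expresses that the conjugate of the function with epigraph [H] is at most [s]; a conjugate equal
    to +oo is one that admits no [s]. *)
Definition conj_le {X : NSpace} (H : nsprod X (Dual X) -> R -> Prop)
    (xs : Dual X) (xx : Dual (Dual X)) (s : R) : Prop :=
  forall y ys r, H (y, ys) r -> dapp xs y + dapp xx ys - r <= s.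

Definition above_coupling {X : NSpace} (H : nsprod X (Dual X) -> R -> Prop) : Prop :=
  forall x xs r, H (x, xs) r -> dapp xs x <= r.

(** The one-sided condition [s < r + eps] combines closedness with upward closedness in [r]. *)
Definition epi_closed {X : NSpace} (H : nsprod X (Dual X) -> R -> Prop) : Prop :=
  forall x xs r,
    (forall eps, 0 < eps -> exists y ys s, H (y, ys) s /\ ns_norm (ns_sub y x) < eps /\
        ns_norm (ns_sub ys xs) < eps /\ s < r + eps) -> H (x, xs) r.

Definition strong_epi {X : NSpace} (H : nsprod X (Dual X) -> R -> Prop) : Prop :=
  convex_rel H /\ epi_closed H /\ above_coupling H /\
  forall xs xx s, conj_le H xs xx s -> dapp xx xs <= s.

Definition contact_set {X : NSpace} (H : nsprod X (Dual X) -> R -> Prop) : Op X :=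
  fun x xs => H (x, xs) (dapp xs x).

Lemma dual_of_prod {V W : NSpace} {HV : normed V} {HW : normed W} (L : nsprod V W -> R) C :
  linear_fun L -> 0 <= C -> (forall e, Rabs (L e) <= C * ns_norm e) ->
  exists (f : Dual V) (g : Dual W), forall a b, L (a, b) = dapp f a + dapp g b.
Proof.
intros [La Ls] HC Hb.
destruct (dual_of_linear (fun a : V => L (a, ns_zero)) C) as [f Hf]; [split| |..]; auto.
- intros x y. rewrite <- La, prod_addE. do 2 f_equal. vec.
- intros a x. rewrite <- Ls, prod_scalE. do 2 f_equal. vec.
- intros x. eapply Rle_trans; [apply Hb|]. rewrite prod_normE, nm_zero. lra.
- destruct (dual_of_linear (fun b : W => L (ns_zero, b)) C) as [g Hg]; [split| |..]; auto.
  + intros x y. rewrite <- La, prod_addE. do 2 f_equal. vec.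
  + intros a x. rewrite <- Ls, prod_scalE. do 2 f_equal. vec.
  + intros x. eapply Rle_trans; [apply Hb|]. rewrite prod_normE, nm_zero. lra.
  + exists f, g. intros a b. rewrite Hf, Hg, <- La, prod_addE. do 2 f_equal; vec.
Qed.

Lemma sq_convex a b l : 0 <= l <= 1 -> (l * a + (1 - l) * b)² <= l * a² + (1 - l) * b².
Proof.
intros H. assert (H1 : 0 <= l * (1 - l) * (a - b)²).
{ apply Rmult_le_pos; [apply Rmult_le_pos; lra|apply Rle_0_sqr]. }
replace (l * a² + (1 - l) * b²) with ((l * a + (1 - l) * b)² + l * (1 - l) * (a - b)²)
  by (unfold Rsqr; ring).
lra.
Qed.

Lemma nm_sq_convex {V : NSpace} {HV : normed V} (a b : V) l : 0 <= l <= 1 ->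
  (ns_norm (ns_add (ns_scal l a) (ns_scal (1 - l) b)))² <=
  l * (ns_norm a)² + (1 - l) * (ns_norm b)².
Proof.
intros Hl. eapply Rle_trans; [|now apply sq_convex].
apply Rsqr_incr_1; [|apply nm_ge0|].
- eapply Rle_trans; [apply nm_tri|]. rewrite !nm_scal, !Rabs_pos_eq; lra.
- generalize (nm_ge0 a) (nm_ge0 b); nra.
Qed.

Lemma conjugate_half_square {V : NSpace} {HV : normed V} (f : Dual V) c B : 0 < c ->
  (forall a, dapp f a - c / 2 * (ns_norm a)² <= B) -> (ns_norm f)² / (2 * c) <= B.
Proof.
intros Hc H.
assert (HB : 0 <= B).
{ generalize (H ns_zero). rewrite dapp_zeror, nm_zero. unfold Rsqr; lra. }
assert (Hf : ns_norm f <= sqrt (2 * c * B)).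
{ apply dnorm_le. intros x Hx. apply Rsqr_incr_0_var; [|apply sqrt_pos].
  rewrite Rsqr_sqrt by nra. rewrite <- Rsqr_abs.
  (* On the line through [x], [t = dapp f x / c] maximizes [t * dapp f x - c / 2 * t²], which bounds
     the objective from below when [x] is in the unit ball. *)
  generalize (H (ns_scal (dapp f x / c) x)). rewrite dapp_scalr, nm_scal, Rsqr_mult, <- Rsqr_abs.
  set (t := dapp f x). assert (Hn : (ns_norm x)² <= 1).
  { rewrite <- Rsqr_1. apply Rsqr_incr_1; [auto|apply nm_ge0|lra]. }
  assert (Hq : 0 <= (t / c)²) by apply Rle_0_sqr.
  intros H1.
  assert (H3 : c / 2 * ((t / c)² * (ns_norm x)²) <= c / 2 * ((t / c)² * 1)).
  { apply Rmult_le_compat_l; [lra|]. apply Rmult_le_compat_l; auto. }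
  assert (H2 : t / c * t - c / 2 * (t / c)² <= B) by lra.
  replace (t / c * t - c / 2 * (t / c)²) with (t² / (2 * c)) in H2
    by (unfold Rsqr; field; lra).
  apply (Rmult_le_compat_l (2 * c)) in H2; [|lra].
  replace (2 * c * (t² / (2 * c))) with (t²) in H2 by (field; lra). lra. }
assert (H1 : (ns_norm f)² <= 2 * c * B).
{ rewrite <- (Rsqr_sqrt (2 * c * B)) by nra.
  apply Rsqr_incr_1; [auto|apply nm_ge0|apply sqrt_pos]. }
apply (Rmult_le_reg_l (2 * c)); [lra|].
replace (2 * c * ((ns_norm f)² / (2 * c))) with ((ns_norm f)²) by (field; lra). lra.
Qed.

(** An empty [H] would have conjugate -oo, below the coupling at the origin. *)
Lemma conj_le_nonempty {X : NSpace} (H : nsprod X (Dual X) -> R -> Prop) :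
  (forall xs xx s, conj_le H xs xx s -> dapp xx xs <= s) -> exists y ys r, H (y, ys) r.
Proof.
intros Hst. apply NNPP; intros Hn.
generalize (Hst ns_zero ns_zero (-1)). rewrite dapp_zerol. intros H1.
assert (0 <= -1); [|lra]. apply H1. intros y ys r Hr. exfalso; eauto 6.
Qed.

Lemma am_gm a b c : 0 < c -> a * b <= c / 2 * a² + b² / (2 * c).
Proof.
intros Hc. apply (Rmult_le_reg_l (2 * c)); [lra|].
replace (2 * c * (c / 2 * a² + b² / (2 * c))) with (c * c * a² + b²) by (field; lra).
generalize (Rle_0_sqr (c * a - b)). unfold Rsqr. nra.
Qed.

(** If the infimum were at least [eta], a multiplier [(zs, zz)] would bound the conjugate of [H] at
    [(xs - zs, cx - zz)]. The strong inequality there, with the conjugates of the two squares, gives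
    [c/2 |zz|^2 + |zs|^2 / (2c) <= - eta - <zz, zs>], which contradicts the inequality of means. *)
Lemma regularized_infimum {X : NSpace} {HX : normed X} (H : nsprod X (Dual X) -> R -> Prop) :
  strong_epi H -> forall (x : X) (xs : Dual X) c eta, 0 < c -> 0 < eta ->
  exists y ys r, H (y, ys) r /\
    r - dapp xs y - dapp ys x + dapp xs x + c / 2 * (ns_norm (ns_sub y x))²
      + (ns_norm (ns_sub ys xs))² / (2 * c) < eta.
Proof.
intros (Hcv & _ & _ & Hst) x xs c eta Hc He.
destruct (conj_le_nonempty H Hst) as (y0 & ys0 & r0 & H0).
apply NNPP; intros Hno.
assert (Hc' : 0 < / (2 * c)) by (apply Rinv_0_lt_compat; lra).
(* The perturbation frees the arguments [a], [b] of the squares from the point of [H]. Near 0 the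
   point [(y0, ys0)] is kept and [a], [b] absorb a perturbation of norm below 1, hence the radius 1
   and the two [+ 1] in the bound. *)
destruct (lagrange_multiplier (nsprod X (Dual X)) (fun e r => exists y ys s a b,
   H (y, ys) s /\ e = (ns_sub (ns_sub y x) a, ns_sub (ns_sub ys xs) b) /\
   s - dapp xs y - dapp ys x + dapp xs x + c / 2 * (ns_norm a)² + (ns_norm b)² / (2 * c) - eta
     <= r) 1 (r0 - dapp xs y0 - dapp ys0 x + dapp xs x +
       c / 2 * (ns_norm (ns_sub y0 x) + 1)² + (ns_norm (ns_sub ys0 xs) + 1)² / (2 * c) - eta))
  as (L & C & HL & HC & Hb & HK).
- intros e1 r1 e2 r2 l Hl (y1 & ys1 & s1 & a1 & b1 & H1 & -> & E1)
    (y2 & ys2 & s2 & a2 & b2 & H2 & -> & E2).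
  exists (ns_add (ns_scal l y1) (ns_scal (1 - l) y2)),
   (ns_add (ns_scal l ys1) (ns_scal (1 - l) ys2)), (l * s1 + (1 - l) * s2),
   (ns_add (ns_scal l a1) (ns_scal (1 - l) a2)), (ns_add (ns_scal l b1) (ns_scal (1 - l) b2)).
  split; [exact (Hcv _ _ _ _ _ Hl H1 H2)|split].
  + rewrite !prod_scalE, prod_addE. f_equal; vec.
  + linall.
    assert (A := nm_sq_convex a1 a2 l Hl). assert (B := nm_sq_convex b1 b2 l Hl).
    apply (Rmult_le_compat_l (c / 2)) in A; [|lra].
    apply (Rmult_le_compat_r (/ (2 * c))) in B; [|lra].
    apply (Rmult_le_compat_l l) in E1; [|lra]. apply (Rmult_le_compat_l (1 - l)) in E2; [|lra].
    unfold Rdiv in *. lra.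
- intros r (y & ys & s & a & b & H1 & E & Hr).
  apply Rnot_lt_le; intros Hlt. apply Hno. exists y, ys, s. split; [auto|].
  assert (E1 : ns_zero = ns_sub (ns_sub y x) a) by exact (f_equal fst E).
  assert (E2 : ns_zero = ns_sub (ns_sub ys xs) b) by exact (f_equal snd E).
  assert (E3 : ns_sub y x = a).
  { replace (ns_sub y x) with (ns_add (ns_sub (ns_sub y x) a) a) by vec. rewrite <- E1; vec. }
  assert (E4 : ns_sub ys xs = b).
  { replace (ns_sub ys xs) with (ns_add (ns_sub (ns_sub ys xs) b) b) by vec. rewrite <- E2; vec. }
  rewrite E3, E4. lra.
- lra.
- intros e r t _. destruct (ns_scal t e) as [e1 e2]. rewrite prod_normE; intros Hlt.
  eexists; split; [apply Rle_refl|].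
  exists y0, ys0, r0, (ns_sub (ns_sub y0 x) e1), (ns_sub (ns_sub ys0 xs) e2).
  split; [auto|split; [f_equal; vec|]].
  assert (A1 : (ns_norm (ns_sub (ns_sub y0 x) e1))² <= (ns_norm (ns_sub y0 x) + 1)²).
  { apply Rsqr_incr_1; [|apply nm_ge0|generalize (nm_ge0 (ns_sub y0 x)); lra].
    unfold ns_sub at 1. eapply Rle_trans; [apply nm_tri|]. rewrite nm_opp.
    generalize (nm_ge0 e2); lra. }
  assert (A2 : (ns_norm (ns_sub (ns_sub ys0 xs) e2))² <= (ns_norm (ns_sub ys0 xs) + 1)²).
  { apply Rsqr_incr_1; [|apply nm_ge0|generalize (nm_ge0 (ns_sub ys0 xs)); lra].
    unfold ns_sub at 1. eapply Rle_trans; [apply nm_tri|]. rewrite nm_opp.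
    generalize (nm_ge0 e1); lra. }
  apply (Rmult_le_compat_r (/ (2 * c))) in A2; [|lra]. unfold Rdiv. nra.
- destruct (dual_of_prod L C HL HC Hb) as (zs & zz & Hz).
  destruct (canon_ex x) as (cx & Hcx & _).
  assert (key : forall a b, dapp zz zs <= - dapp zs a - dapp zz b + c / 2 * (ns_norm a)² +
            (ns_norm b)² / (2 * c) - eta).
  { intros a b.
    generalize (Hst (ns_sub xs zs) (ns_sub cx zz) (- dapp zs x - dapp zs a - dapp zz xs
       - dapp zz b + dapp xs x + c / 2 * (ns_norm a)² + (ns_norm b)² / (2 * c) - eta)).
    intros H1. assert (H2 : conj_le H (ns_sub xs zs) (ns_sub cx zz) (- dapp zs x - dapp zs a
       - dapp zz xs - dapp zz b + dapp xs x + c / 2 * (ns_norm a)²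
       + (ns_norm b)² / (2 * c) - eta)).
    { intros y ys r Hr.
      generalize (HK _ _ (ex_intro _ y (ex_intro _ ys (ex_intro _ r (ex_intro _ a
        (ex_intro _ b (conj Hr (conj eq_refl (Rle_refl _))))))))).
      rewrite Hz. linall. rewrite (Hcx ys). lra. }
    specialize (H1 H2). revert H1. linall. rewrite (Hcx xs), (Hcx zs). lra. }
  assert (K1 : forall b, (ns_norm zs)² / (2 * c) <=
     - eta - dapp zz zs - dapp zz b + (ns_norm b)² / (2 * c)).
  { intros b. apply conjugate_half_square; [auto|]. intros a.
    generalize (key a b). lra. }
  assert (K2 : (ns_norm zz)² / (2 * / c) <= - eta - dapp zz zs - (ns_norm zs)² / (2 * c)).
  { apply conjugate_half_square; [now apply Rinv_0_lt_compat|]. intros b.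
    generalize (K1 b).
    replace (/ c / 2 * (ns_norm b)²) with ((ns_norm b)² / (2 * c)) by (field; lra). lra. }
  replace ((ns_norm zz)² / (2 * / c)) with (c / 2 * (ns_norm zz)²) in K2 by (field; lra).
  generalize (am_gm (ns_norm zz) (ns_norm zs) c Hc) (dapp_lb zz zs). lra.
Qed.

(** The coupling at a midpoint equals the mean of the couplings minus a quarter of the pairing of
    the differences, and [H] lies above it. *)
Lemma midpoint_gap {X : NSpace} {HX : normed X} (H : nsprod X (Dual X) -> R -> Prop) x xs r y ys s :
  convex_rel H -> above_coupling H -> H (x, xs) r -> H (y, ys) s ->
  - dapp (ns_sub ys xs) (ns_sub y x) <= 2 * (r - dapp xs x) + 2 * (s - dapp ys y).
Proof.
intros Hcv Hab H1 H2. assert (Hl : 0 <= / 2 <= 1) by lra.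
generalize (Hcv _ _ _ _ _ Hl H1 H2). rewrite !prod_scalE, prod_addE.
intros H3; apply Hab in H3. revert H3. linall. lra.
Qed.

Lemma above_ge {X : NSpace} {HX : normed X} (x y : X) (xs ys : Dual X) :
  0 <= dapp (ns_sub ys xs) (ns_sub y x) + ns_norm (ns_sub ys xs) * ns_norm (ns_sub y x).
Proof. generalize (dapp_lb (ns_sub ys xs) (ns_sub y x)). lra. Qed.

(** Dividing the gap by 4 halves its square root, so the steps of an iteration decrease
    geometrically. The estimate bounds the sum of the two squares by [5 e]; 9 is a perfect square
    above 5. *)
Lemma gap_step {X : NSpace} {HX : normed X} (H : nsprod X (Dual X) -> R -> Prop) x xs r e :
  strong_epi H -> 0 < e -> H (x, xs) r -> r - dapp xs x < e ->
  exists y ys s, H (y, ys) s /\ s - dapp ys y < e / 4 /\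
    (ns_norm (ns_sub y x))² <= 9 * e /\ (ns_norm (ns_sub ys xs))² <= 9 * e.
Proof.
intros HH He H1 Hgap.
destruct (regularized_infimum H HH x xs 1 (e / 4)) as (y & ys & s & H2 & Hlt); try lra.
exists y, ys, s. split; [auto|]. destruct HH as (Hcv & _ & Hab & _).
generalize (midpoint_gap H _ _ _ _ _ _ Hcv Hab H1 H2) (Hab _ _ _ H2) (above_ge x y xs ys).
revert Hlt. linall.
set (a := ns_norm (ns_sub y x)). set (b := ns_norm (ns_sub ys xs)).
unfold Rsqr. intros. assert (K1 := Rle_0_sqr (a - b)).
assert (K2 := Rle_0_sqr a). assert (K3 := Rle_0_sqr b). unfold Rsqr in K1, K2, K3. repeat split; lra.
Qed.

Lemma geometric_limit {V : NSpace} (HV : banach V) (u : nat -> V) c :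
  (forall n, ns_norm (ns_sub (u (S n)) (u n)) <= c * (/ 2) ^ n) ->
  exists l, seq_conv u l /\ ns_norm (ns_sub l (u 0%nat)) <= 2 * c.
Proof.
intros Hu.
assert (Hc : 0 <= c).
{ generalize (Hu 0%nat) (nm_ge0 (ns_sub (u 1%nat) (u 0%nat))). simpl. lra. }
assert (Hp : forall n, 0 < (/ 2) ^ n) by (intros; apply pow_lt; lra).
assert (key : forall n k, ns_norm (ns_sub (u (n + k)%nat) (u n)) <=
   2 * c * (/ 2) ^ n - 2 * c * (/ 2) ^ (n + k)).
{ intros n k; induction k as [|k IH].
  - rewrite Nat.add_0_r, nm_sub_zero. lra.
  - rewrite Nat.add_succ_r. eapply Rle_trans; [apply (nm_sub_tri _ (u (n + k)%nat))|].
    generalize (Hu (n + k)%nat). simpl. lra. }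
assert (key' : forall n m, (n <= m)%nat -> ns_norm (ns_sub (u m) (u n)) <= 2 * c * (/ 2) ^ n).
{ intros n m Hm. replace m with (n + (m - n))%nat by lia. eapply Rle_trans; [apply key|].
  generalize (Rmult_le_pos _ _ Hc (Rlt_le _ _ (Hp (n + (m - n))%nat))). lra. }
destruct (banach_complete V HV u) as [l Hl].
{ intros eps He.
  destruct (pow_lt_1_zero (/ 2)) with (y := eps / (4 * c + 1)) as [N HN].
  { rewrite Rabs_pos_eq; lra. }
  { apply Rdiv_lt_0_compat; lra. }
  specialize (HN N (le_n N)). rewrite Rabs_pos_eq in HN by (left; apply Hp).
  apply (Rmult_lt_compat_l (4 * c + 1)) in HN; [|lra].
  replace ((4 * c + 1) * (eps / (4 * c + 1))) with eps in HN by (field; lra).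
  exists N. intros m n Hm Hn.
  eapply Rle_lt_trans; [apply (nm_sub_tri _ (u N))|]. rewrite (nm_subC (u N)).
  generalize (key' N m Hm) (key' N n Hn) (Hp N). lra. }
exists l. split; [auto|].
apply Rle_plus_epsilon. intros eps He. destruct (Hl eps He) as [N HN].
specialize (HN N (le_n N)). rewrite nm_subC in HN.
generalize (nm_sub_tri l (u N) (u 0%nat)) (key' 0%nat N (Nat.le_0_l N)). simpl. lra.
Qed.

Lemma coupling_continuous {X : NSpace} {HX : normed X} (m : X) (ms : Dual X) eps : 0 < eps ->
  exists delta, 0 < delta /\ forall y ys, ns_norm (ns_sub y m) < delta ->
    ns_norm (ns_sub ys ms) < delta -> Rabs (dapp ys y - dapp ms m) < eps.
Proof.
intros He. set (B := ns_norm m + ns_norm ms + 2).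
assert (Hm := nm_ge0 m). assert (Hms := nm_ge0 ms).
assert (HB : 0 < B) by (unfold B; lra).
exists (Rmin 1 (eps / B)). split; [apply Rmin_pos; [lra|now apply Rdiv_lt_0_compat]|].
intros y ys H1 H2.
assert (H1' := Rlt_le_trans _ _ _ H1 (Rmin_l _ _)).
assert (H2' := Rlt_le_trans _ _ _ H2 (Rmin_l _ _)).
replace (dapp ys y - dapp ms m) with
  (dapp (ns_sub ys ms) (ns_sub y m) + dapp (ns_sub ys ms) m + dapp ms (ns_sub y m))
  by (linall; ring).
set (d := Rmin 1 (eps / B)) in *.
assert (Hd : d * B <= eps).
{ apply Rle_trans with (eps / B * B); [apply Rmult_le_compat_r; [lra|apply Rmin_r]|].
  right; field; lra. }
eapply Rle_lt_trans; [apply Rabs_triang|].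
eapply Rle_lt_trans; [apply Rplus_le_compat_r, Rabs_triang|].
generalize (dapp_le (ns_sub ys ms) (ns_sub y m)) (dapp_le (ns_sub ys ms) m)
  (dapp_le ms (ns_sub y m)) (nm_ge0 (ns_sub y m)) (nm_ge0 (ns_sub ys ms)).
unfold B in Hd. nra.
Qed.

(* Iterating [gap_step] gives a Cauchy sequence along which the gap [H - c] tends to [0]. *)
Lemma bronsted_rockafellar {X : NSpace} {HX : banach X} (H : nsprod X (Dual X) -> R -> Prop)
   x xs r t :
  strong_epi H -> 0 < t -> H (x, xs) r -> r - dapp xs x < t² ->
  exists m ms, contact_set H m ms /\ ns_norm (ns_sub m x) <= 6 * t /\
    ns_norm (ns_sub ms xs) <= 6 * t.
Proof.
intros HH Ht H0 Hgap.
pose (good := fun (k : nat) (z : X * Dual X * R) =>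
  H (fst z) (snd z) /\ snd z - dapp (snd (fst z)) (fst (fst z)) < (t * (/ 2) ^ k)²).
assert (Hstep : forall kz : nat * (X * Dual X * R), exists z',
   good (fst kz) (snd kz) -> good (S (fst kz)) z' /\
   ns_norm (ns_sub (fst (fst z')) (fst (fst (snd kz)))) <= 3 * t * (/ 2) ^ (fst kz) /\
   ns_norm (ns_sub (snd (fst z')) (snd (fst (snd kz)))) <= 3 * t * (/ 2) ^ (fst kz)).
{ intros [k z]. cbn [fst snd].
  destruct (classic (good k z)) as [Hg|]; [|exists z; tauto].
  destruct z as [[y ys] s]. destruct Hg as [Hg1 Hg2]; cbn [fst snd] in *.
  assert (Hpk : 0 < t * (/ 2) ^ k) by (apply Rmult_lt_0_compat; [auto|apply pow_lt; lra]).
  destruct (gap_step H y ys s ((t * (/ 2) ^ k)²)) as (y' & ys' & s' & A & B & C & D); auto.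
  { unfold Rsqr; now apply Rmult_lt_0_compat. }
  exists ((y', ys'), s'). intros _. unfold good; cbn [fst snd]. split; [split; [auto|]|split].
  - eapply Rlt_le_trans; [exact B|]. right; unfold Rsqr; simpl; field.
  - apply Rsqr_incr_0_var; [|lra]. eapply Rle_trans; [exact C|]. right; unfold Rsqr; ring.
  - apply Rsqr_incr_0_var; [|lra]. eapply Rle_trans; [exact D|]. right; unfold Rsqr; ring. }
destruct (choice _ Hstep) as [nxt Hnxt].
pose (z := fix z n := match n with O => ((x, xs), r) | S k => nxt (k, z k) end).
assert (Hz : forall n, good n (z n)).
{ induction n as [|n IH]; [|exact (proj1 (Hnxt (n, z n) IH))].
  split; cbn [z fst snd pow]; [auto|]. now rewrite Rmult_1_r. }
destruct (geometric_limit HX (fun n => fst (fst (z n))) (3 * t)) as (m & Hm & Hm').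
{ intros n. exact (proj1 (proj2 (Hnxt (n, z n) (Hz n)))). }
destruct (geometric_limit (dual_banach X HX) (fun n => snd (fst (z n))) (3 * t)) as (ms & Hms & Hms').
{ intros n. exact (proj2 (proj2 (Hnxt (n, z n) (Hz n)))). }
exists m, ms. split; [|cbn [z fst snd] in *; split; lra].
apply HH. intros eps He.
destruct (coupling_continuous m ms (eps / 2)) as (d & Hd & Hc); [lra|].
destruct (Hm (Rmin d eps)) as [N1 HN1]; [now apply Rmin_pos|].
destruct (Hms (Rmin d eps)) as [N2 HN2]; [now apply Rmin_pos|].
assert (Ht2 : 0 < t²) by (unfold Rsqr; nra).
destruct (pow_lt_1_zero (/ 2)) with (y := eps / 2 / t²) as [N3 HN3].
{ rewrite Rabs_pos_eq; lra. }
{ apply Rdiv_lt_0_compat; lra. }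
set (n := Nat.max N1 (Nat.max N2 N3)).
specialize (HN1 n ltac:(lia)). specialize (HN2 n ltac:(lia)). specialize (HN3 n ltac:(lia)).
destruct (Hz n) as [G1 G2]. destruct (z n) as [[y ys] s]; cbn [fst snd] in *.
exists y, ys, s. split; [auto|].
assert (P1 := Rmin_l d eps). assert (P2 := Rmin_r d eps).
split; [lra|split; [lra|]].
specialize (Hc y ys ltac:(lra) ltac:(lra)). apply Rabs_def2 in Hc.
assert (Hp : 0 < (/ 2) ^ n <= 1).
{ split; [apply pow_lt; lra|]. rewrite <- (pow1 n). apply pow_incr; lra. }
rewrite Rabs_pos_eq in HN3 by lra.
apply (Rmult_lt_compat_l (t²)) in HN3; [|auto].
replace (t² * (eps / 2 / t²)) with (eps / 2) in HN3 by (field; lra).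
rewrite Rsqr_mult in G2. unfold Rsqr at 2 in G2. nra.
Qed.

(** First-order condition at the start of a segment: the left side is the bilinear coupling along
    it, with end values [c0], [c1] and mixed term [k]. Divide by [t] and let [t] tend to 0. *)
Lemma difference_quotient_limit c0 k c1 s :
  (forall t, 0 < t <= 1 -> (1 - t) * (1 - t) * c0 + t * (1 - t) * k + t * t * c1
      <= (1 - t) * c0 + t * s) -> k - c0 <= s.
Proof.
intros H. apply Rle_plus_epsilon. intros eps He.
set (D := Rabs (k - c0 - c1) + 1).
assert (HD : 1 <= D) by (unfold D; generalize (Rabs_pos (k - c0 - c1)); lra).
set (t := Rmin 1 (eps / D)).
assert (Ht : 0 < t <= 1).
{ split; [apply Rmin_pos; [lra|apply Rdiv_lt_0_compat; lra]|apply Rmin_l]. }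
assert (Ht' : t * D <= eps).
{ apply Rle_trans with (eps / D * D); [apply Rmult_le_compat_r; [lra|apply Rmin_r]|].
  right; field; lra. }
specialize (H t Ht).
assert (H1 : (1 - t) * (k - c0) + t * c1 <= s) by (apply (Rmult_le_reg_l t); nra).
generalize (Rle_abs (k - c0 - c1)). unfold D in Ht'. nra.
Qed.

(** [H] stays above the coupling and meets it at the contact point, so by convexity the tangent of
    the coupling there lies below [H]. *)
Lemma contact_minorant {X : NSpace} {HX : normed X} (H : nsprod X (Dual X) -> R -> Prop)
   m ms (mm : Dual (Dual X)) :
  convex_rel H -> above_coupling H -> contact_set H m ms -> canon m mm ->
  conj_le H ms mm (dapp ms m).
Proof.
intros Hcv Hab Hm Hmm y ys r Hr. rewrite (Hmm ys).
apply Rplus_le_reg_r with (r - dapp ms m). ring_simplify.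
apply Rle_trans with ((dapp ms y + dapp ys m) - dapp ms m); [lra|].
apply Rle_trans with r; [|lra].
apply difference_quotient_limit with (dapp ys y). intros t Ht.
assert (Ht' : 0 <= 1 - t <= 1) by lra.
generalize (Hcv _ _ _ _ _ Ht' Hm Hr). rewrite !prod_scalE, prod_addE.
intros H1; apply Hab in H1. revert H1. linall. nra.
Qed.

Lemma quadratic_bound c0 c1 c2 c : 0 < c -> 0 <= c0 -> 0 <= c1 -> 0 <= c2 ->
  exists B, 0 <= B /\ forall a b, 0 <= a -> 0 <= b ->
    c / 2 * a² + b² / (2 * c) <= c0 + c1 * a + c2 * b -> a <= B /\ b <= B.
Proof.
intros Hc H0 H1 H2.
(* AM-GM absorbs half of each linear term into the quadratic one. *)
set (Q := c0 + c1² / c + c * c2²).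
assert (HQ : 0 <= Q).
{ unfold Q. assert (0 <= c1² / c) by (apply Rmult_le_pos; [apply Rle_0_sqr|left; now apply Rinv_0_lt_compat]).
  assert (0 <= c * c2²) by (apply Rmult_le_pos; [lra|apply Rle_0_sqr]). lra. }
set (B := 4 * Q / c + 4 * c * Q + 1).
assert (HB1 : 0 <= 4 * Q / c) by (apply Rmult_le_pos; [lra|left; now apply Rinv_0_lt_compat]).
assert (HB2 : 0 <= 4 * c * Q) by nra.
exists B. split; [unfold B; lra|]. intros a b Ha Hb Hab.
assert (K1 : c1 * a <= c / 4 * a² + c1² / c).
{ generalize (am_gm a c1 (c / 2) ltac:(lra)).
  replace (c / 2 / 2) with (c / 4) by field.
  replace (c1² / (2 * (c / 2))) with (c1² / c) by (field; lra). lra. }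
assert (K2 : c2 * b <= b² / (4 * c) + c * c2²).
{ generalize (am_gm b c2 (/ (2 * c)) ltac:(apply Rinv_0_lt_compat; lra)).
  replace (/ (2 * c) / 2 * b²) with (b² / (4 * c)) by (field; lra).
  replace (c2² / (2 * / (2 * c))) with (c * c2²) by (field; lra). lra. }
replace (b² / (2 * c)) with (2 * (b² / (4 * c))) in Hab by (field; lra).
assert (K3 : 0 <= b² / (4 * c)) by (apply Rmult_le_pos; [apply Rle_0_sqr|left; apply Rinv_0_lt_compat; lra]).
assert (K4 : 0 <= c / 4 * a²) by (apply Rmult_le_pos; [lra|apply Rle_0_sqr]).
assert (K5 : c / 4 * a² <= Q) by (unfold Q; lra).
assert (K6 : b² / (4 * c) <= Q) by (unfold Q; lra).
assert (Ka : a² <= 4 * Q / c).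
{ apply (Rmult_le_compat_l (4 / c)) in K5; [|left; apply Rdiv_lt_0_compat; lra].
  replace (4 / c * (c / 4 * a²)) with (a²) in K5 by (field; lra).
  eapply Rle_trans; [exact K5|]. right; field; lra. }
assert (Kb : b² <= 4 * c * Q).
{ apply (Rmult_le_compat_l (4 * c)) in K6; [|lra].
  replace (4 * c * (b² / (4 * c))) with (b²) in K6 by (field; lra). lra. }
unfold Rsqr in Ka, Kb. unfold B. split; nra.
Qed.

Lemma contact_nonempty {X : NSpace} {HX : banach X} (H : nsprod X (Dual X) -> R -> Prop) :
  strong_epi H -> exists m ms, contact_set H m ms.
Proof.
intros HH. destruct (conj_le_nonempty H) as (y & ys & r & Hr); [apply HH|].
assert (Hg : 0 <= r - dapp ys y).
{ generalize ((proj1 (proj2 (proj2 HH))) _ _ _ Hr). lra. }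
destruct (bronsted_rockafellar H y ys r (r - dapp ys y + 1) HH) as (m & ms & Hm & _); eauto.
- lra.
- unfold Rsqr; nra.
Qed.

(** [regularized_infimum] yields only a point of [H], which [bronsted_rockafellar] moves into the
    contact set. The cost of the move depends on the distances [a], [b], so these are first bounded
    independently of [t], using the tangent minorant at one fixed contact point. *)
Lemma contact_dense_range {X : NSpace} {HX : banach X} (H : nsprod X (Dual X) -> R -> Prop) :
  strong_epi H -> forall (x : X) (xs : Dual X) c eps, 0 < c -> 0 < eps ->
  exists m ms, contact_set H m ms /\
    dapp (ns_sub ms xs) (ns_sub m x) + c / 2 * (ns_norm (ns_sub m x))²
      + (ns_norm (ns_sub ms xs))² / (2 * c) < eps.
Proof.
intros HH x xs c eps Hc He.
destruct (contact_nonempty H HH) as (s & ss & Hs).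
destruct (canon_ex s) as (cs & Hcs & _).
set (c0 := 1 + Rabs (dapp (ns_sub ss xs) (ns_sub s x))).
destruct (quadratic_bound c0 (ns_norm (ns_sub ss xs)) (ns_norm (ns_sub s x)) c) as (B & HB & HBnd);
 [auto|unfold c0; generalize (Rabs_pos (dapp (ns_sub ss xs) (ns_sub s x))); lra
 |apply nm_ge0|apply nm_ge0|].
assert (Hic : 0 < / (2 * c)) by (apply Rinv_0_lt_compat; lra).
(* A move of length [6 t <= 1] changes the pairing and each square by at most [6 t (2 B + 1)]; the
   initial value adds [t² <= t]. In total the change is at most [t K]. *)
set (K := 1 + 6 * (2 * B + 1) * (1 + c / 2 + / (2 * c))).
assert (HK : 1 < K) by (unfold K; nra).
set (t := Rmin (/ 6) (eps / (2 * K))).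
assert (Ht : 0 < t) by (apply Rmin_pos; [lra|apply Rdiv_lt_0_compat; lra]).
assert (Ht6 : t <= / 6) by apply Rmin_l.
assert (HtK : t * K < eps).
{ apply Rle_lt_trans with (eps / (2 * K) * K); [apply Rmult_le_compat_r; [lra|apply Rmin_r]|].
  replace (eps / (2 * K) * K) with (eps / 2) by (field; lra). lra. }
assert (Ht2 : t² <= t) by (unfold Rsqr; nra).
assert (Ht2' : 0 < t²) by (unfold Rsqr; nra).
destruct (regularized_infimum H HH x xs c (t²) Hc Ht2') as (y & ys & r & Hr & Hlt).
assert (Hr1 := proj1 (proj2 (proj2 HH)) _ _ _ Hr).
set (a := ns_norm (ns_sub y x)) in *. set (b := ns_norm (ns_sub ys xs)) in *.
assert (Ha : 0 <= a) by apply nm_ge0. assert (Hb : 0 <= b) by apply nm_ge0.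
assert (Hlt' : dapp (ns_sub ys xs) (ns_sub y x) + c / 2 * a² + b² / (2 * c) + (r - dapp ys y) < t²)
  by (linall; lra).
assert (Hab : a <= B /\ b <= B).
{ apply HBnd; auto. unfold c0.
  generalize (contact_minorant H s ss cs (proj1 HH) (proj1 (proj2 (proj2 HH))) Hs Hcs y ys r Hr).
  rewrite (Hcs ys).
  generalize (dapp_lb (ns_sub ss xs) (ns_sub y x)) (dapp_lb (ns_sub ys xs) (ns_sub s x))
   (Rle_abs (dapp (ns_sub ss xs) (ns_sub s x))).
  fold a b. revert Hlt. linall. nra. }
assert (Hgap : r - dapp ys y < t²).
{ generalize (above_ge x y xs ys) (am_gm a b c Hc). fold a b. lra. }
destruct (bronsted_rockafellar H y ys r t HH Ht Hr Hgap) as (m & ms & Hm & D1 & D2).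
exists m, ms. split; [auto|].
set (d := 6 * t) in *.
assert (Hd : 0 < d <= 1) by (unfold d; lra).
assert (Hma : ns_norm (ns_sub m x) <= a + d).
{ generalize (nm_sub_tri m y x). fold a. lra. }
assert (Hmb : ns_norm (ns_sub ms xs) <= b + d).
{ generalize (nm_sub_tri ms ys xs). fold b. lra. }
assert (Hc1 : dapp (ns_sub ms xs) (ns_sub m x) <= dapp (ns_sub ys xs) (ns_sub y x) + d * (2 * B + 1)).
{ replace (dapp (ns_sub ms xs) (ns_sub m x)) with (dapp (ns_sub ys xs) (ns_sub y x) +
    dapp (ns_sub ms ys) (ns_sub m x) + dapp (ns_sub ys xs) (ns_sub m y)) by (linall; ring).
  generalize (dapp_ub (ns_sub ms ys) (ns_sub m x)) (dapp_ub (ns_sub ys xs) (ns_sub m y))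
   (nm_ge0 (ns_sub ms ys)) (nm_ge0 (ns_sub m x)) (nm_ge0 (ns_sub m y)). fold b. nra. }
assert (Hq : forall p q, 0 <= p -> 0 <= q -> q <= B -> p <= q + d -> p² <= q² + d * (2 * B + 1)).
{ intros p q P1 P2 P3 P4. unfold Rsqr.
  assert (p * p <= (q + d) * (q + d)) by nra. nra. }
assert (Q1 := Hq _ _ (nm_ge0 (ns_sub m x)) Ha (proj1 Hab) Hma).
assert (Q2 := Hq _ _ (nm_ge0 (ns_sub ms xs)) Hb (proj2 Hab) Hmb).
apply (Rmult_le_compat_l (c / 2)) in Q1; [|lra].
apply (Rmult_le_compat_r (/ (2 * c))) in Q2; [|lra].
unfold Rdiv in *. assert (d * (2 * B + 1) * (1 + c * / 2 + / (2 * c)) + t = t * K)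
  by (unfold K, d, Rdiv; ring).
nra.
Qed.

(** For a monotonically related pair the pairing term is nonnegative, so both squares become small:
    contact points converge to the pair in norm, and [H] is closed. *)
Lemma contact_maximal {X : NSpace} {HX : banach X} (H : nsprod X (Dual X) -> R -> Prop) :
  strong_epi H -> maximal_monotone (contact_set H).
Proof.
intros HH. split.
- intros x xs y ys H1 H2.
  generalize (midpoint_gap H _ _ _ _ _ _ (proj1 HH) (proj1 (proj2 (proj2 HH))) H1 H2).
  linall. lra.
- intros x xs Hmon. apply HH. intros eps He.
  destruct (coupling_continuous x xs eps He) as (d & Hd & Hcont).
  set (e := Rmin d eps). assert (He' : 0 < e) by (now apply Rmin_pos).
  assert (Hed := Rmin_l d eps). assert (Hee := Rmin_r d eps). fold e in Hed, Hee.
  destruct (contact_dense_range H HH x xs 1 (e² / 2)) as (m & ms & Hm & Hlt);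
    [lra|unfold Rsqr; nra|].
  specialize (Hmon m ms Hm).
  assert (Hmon' : 0 <= dapp (ns_sub ms xs) (ns_sub m x)).
  { revert Hmon. linall. lra. }
  assert (A1 := Rle_0_sqr (ns_norm (ns_sub m x))).
  assert (A2 := Rle_0_sqr (ns_norm (ns_sub ms xs))).
  assert (B1 : ns_norm (ns_sub m x) < e) by (apply Rsqr_incrst_0; [lra|apply nm_ge0|lra]).
  assert (B2 : ns_norm (ns_sub ms xs) < e) by (apply Rsqr_incrst_0; [lra|apply nm_ge0|lra]).
  exists m, ms, (dapp ms m). split; [exact Hm|].
  specialize (Hcont m ms ltac:(lra) ltac:(lra)). apply Rabs_def2 in Hcont. lra.
Qed.


(** * Points of the Gossez closure as limits of bounded nets *)

Ltac pvec := first [refine (f_equal2 (@pair _ _) _ _); cbn [fst snd]; pvec | vec].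

(** The bidual element [zz] cannot serve as a base point in [X], so contact points are sought near
    [(0, zs)]. The error [<zz, ms - zs>] is absorbed by the square with weight [1 / (2c)] at the
    price [c/2 |zz|^2], which vanishes with [c]. *)
Lemma contact_conjugate_above {X : NSpace} {HX : banach X} (H : nsprod X (Dual X) -> R -> Prop)
   (zs : Dual X) (zz : Dual (Dual X)) s :
  strong_epi H ->
  (forall m ms, contact_set H m ms -> dapp zs m + dapp zz ms - dapp ms m <= s) ->
  dapp zz zs <= s.
Proof.
intros HH Hs. apply Rle_plus_epsilon. intros eps He.
set (n := ns_norm zz). assert (Hn : 0 <= n) by apply nm_ge0.
assert (Hn2 := Rle_0_sqr n).
set (c := eps / (n² + 1)).
assert (Hc : 0 < c) by (apply Rdiv_lt_0_compat; lra).
destruct (contact_dense_range H HH ns_zero zs c (eps / 2)) as (m & ms & Hm & Hlt); [auto|lra|].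
specialize (Hs m ms Hm).
assert (Hq : c / 2 * n² <= eps / 2).
{ assert (c * (n² + 1) = eps) by (unfold c; field; lra). nra. }
generalize (am_gm n (ns_norm (ns_sub ms zs)) c Hc) (dapp_lb zz (ns_sub ms zs))
  (Rle_0_sqr (ns_norm (ns_sub m ns_zero))).
fold n. intros K1 K2 K3. apply (Rmult_le_compat_l (c / 2)) in K3; [|lra].
revert Hlt K2. linall. lra.
Qed.

(** Being the intersection of all convex relations containing [G], it inherits a bound by
    instantiating [K] with a half-space, or with [H] itself. *)
Definition convex_hull {E : NSpace} (G : E -> R -> Prop) : E -> R -> Prop :=
  fun e r => forall K, convex_rel K -> (forall e' r', G e' r' -> K e' r') -> K e r.

Lemma convex_hull_convex {E : NSpace} (G : E -> R -> Prop) : convex_rel (convex_hull G).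
Proof. intros x r y s l Hl Hx Hy K HK HG. apply HK; auto; [now apply Hx|now apply Hy]. Qed.

Definition contact_graph {X : NSpace} (H : nsprod X (Dual X) -> R -> Prop) :
    nsprod X (Dual X) -> R -> Prop :=
  fun p r => contact_set H (fst p) (snd p) /\ r = dapp (snd p) (fst p).

Lemma hull_conj_le {X : NSpace} (H : nsprod X (Dual X) -> R -> Prop) zs zz s :
  (forall m ms, contact_set H m ms -> dapp zs m + dapp zz ms - dapp ms m <= s) ->
  conj_le (convex_hull (contact_graph H)) zs zz s.
Proof.
intros Hs y ys r Hr.
apply (Hr (fun p r => dapp zs (fst p) + dapp zz (snd p) - r <= s)).
- intros [x1 x2] r1 [y1 y2] r2 l Hl H1 H2. rewrite !prod_scalE, prod_addE.
  cbn [fst snd] in *. linall.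
  apply (Rmult_le_compat_l l) in H1; [|lra]. apply (Rmult_le_compat_l (1 - l)) in H2; lra.
- intros [m ms] r' [H1 ->]. cbn [fst snd] in *. auto.
Qed.

Lemma list_norm_bound {V : NSpace} {HV : normed V} (l : list (Dual V)) :
  exists B, 0 <= B /\ forall f, In f l -> ns_norm f <= B.
Proof.
induction l as [|f l (B & HB & IH)].
- exists 0. split; [lra|]. intros f [].
- exists (B + ns_norm f). assert (Hf := nm_ge0 f). split; [lra|].
  intros g [<-|Hg]; [lra|]. specialize (IH g Hg). lra.
Qed.

Definition eval_sum {E : NSpace} (l : list (Dual E)) (e : E) : R :=
  fold_right (fun f s => Rabs (dapp f e) + s) 0 l.

Lemma eval_sum_seminorm {E : NSpace} (l : list (Dual E)) : seminorm (eval_sum l).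
Proof.
induction l as [|f l (I1 & I2 & I3)]; (split; [|split]); simpl; intros; try lra.
- generalize (I1 x) (Rabs_pos (dapp f x)); lra.
- rewrite I2, dapp_scalr, Rabs_mult; ring.
- rewrite dapp_addr. generalize (I3 x y) (Rabs_triang (dapp f x) (dapp f y)); lra.
Qed.

Lemma eval_sum_in {E : NSpace} (l : list (Dual E)) f e : In f l -> Rabs (dapp f e) <= eval_sum l e.
Proof.
induction l as [|g l IH]; [easy|]. intros [->|Hf]; simpl.
- generalize (proj1 (eval_sum_seminorm l) e). lra.
- specialize (IH Hf). generalize (Rabs_pos (dapp g e)). lra.
Qed.

Lemma eval_sum_zero {E : NSpace} (l : list (Dual E)) e :
  (forall f, In f l -> dapp f e = 0) -> eval_sum l e = 0.
Proof.
induction l as [|g l IH]; simpl; intros H; [easy|].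
rewrite (H g), Rabs_R0, IH; auto; lra.
Qed.

Lemma seminorm_add {E : NSpace} (p q : E -> R) :
  seminorm p -> seminorm q -> seminorm (fun x => p x + q x).
Proof.
intros (p1 & p2 & p3) (q1 & q2 & q3). split; [|split]; intros.
- generalize (p1 x) (q1 x); lra.
- rewrite p2, q2; ring.
- generalize (p3 x y) (q3 x y); lra.
Qed.

Lemma fst_subE {V W : NSpace} (p q : nsprod V W) : fst (ns_sub p q) = ns_sub (fst p) (fst q).
Proof. reflexivity. Qed.
Lemma snd_subE {V W : NSpace} (p q : nsprod V W) : snd (ns_sub p q) = ns_sub (snd p) (snd q).
Proof. reflexivity. Qed.

Lemma seminorm_comp {E F : NSpace} {p : F -> R} (Hp : seminorm p) (g : E -> F) :
  (forall x y, g (ns_add x y) = ns_add (g x) (g y)) ->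
  (forall a x, g (ns_scal a x) = ns_scal a (g x)) -> seminorm (fun x => p (g x)).
Proof.
intros ga gs. destruct Hp as (p1 & p2 & p3). split; [|split]; intros; rewrite ?ga, ?gs; auto.
Qed.

Lemma dual_attain {V : NSpace} {HV : normed V} (f : Dual V) rho d :
  0 <= rho -> 0 < d -> exists y, ns_norm y <= rho /\ rho * ns_norm f < dapp f y + d.
Proof.
intros Hr Hd. apply NNPP; intros Hno.
assert (H : forall y, ns_norm y <= rho -> dapp f y <= rho * ns_norm f - d).
{ intros y Hy. apply Rnot_lt_le; intros Hlt. apply Hno. exists y; lra. }
destruct (Req_dec rho 0) as [->|Hz].
- generalize (H ns_zero). rewrite nm_zero, dapp_zeror. lra.
- assert (Hf : ns_norm f <= (rho * ns_norm f - d) / rho).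
  { apply dnorm_le. intros x Hx.
    assert (H1 : forall t, Rabs t = rho -> t * dapp f x <= rho * ns_norm f - d).
    { intros t Ht. rewrite <- dapp_scalr. apply H. rewrite nm_scal, Ht. nra. }
    assert (H2 := H1 rho (Rabs_pos_eq _ Hr)).
    assert (H3 := H1 (- rho) (eq_trans (Rabs_Ropp _) (Rabs_pos_eq _ Hr))).
    apply (Rmult_le_reg_l rho); [lra|].
    replace (rho * ((rho * ns_norm f - d) / rho)) with (rho * ns_norm f - d) by (field; auto).
    unfold Rabs. destruct (Rcase_abs (dapp f x)); lra. }
  apply (Rmult_le_compat_l rho) in Hf; [|lra].
  replace (rho * ((rho * ns_norm f - d) / rho)) with (rho * ns_norm f - d) in Hf by (field; auto).
  lra.
Qed.

(* The auxiliary variable [y'] in the separation argument keeps the first component in a fixed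
   ball, so that Goldstine's theorem is not needed. *)
Lemma closure_approximation {X : NSpace} {HX : banach X} (H : nsprod X (Dual X) -> R -> Prop)
   (xx : Dual (Dual X)) (xs : Dual X) :
  strong_epi H -> gossez_cl (contact_set H) xx xs ->
  forall (l : list (Dual X)) d, 0 < d <= 1 -> exists y ys r,
    convex_hull (contact_graph H) (y, ys) r /\ ns_norm y <= ns_norm xx + 1 /\
    (forall f, In f l -> Rabs (dapp f y - dapp xx f) < d) /\
    ns_norm (ns_sub ys xs) < d /\ r < dapp xx xs + d.
Proof.
intros HH Hcl l d Hd.
set (c0 := dapp xx xs).
assert (Hphi : forall m ms, contact_set H m ms -> dapp xs m + dapp xx ms - dapp ms m <= c0).
{ intros m ms Hm. generalize (Hcl m ms Hm). unfold c0. linall. lra. }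
assert (Hhull := hull_conj_le H xs xx c0 Hphi).
assert (Htan : forall (zs : Dual X) (zz : Dual (Dual X)) s,
  (forall m ms, contact_set H m ms -> dapp zs m + dapp zz ms - dapp ms m <= s) ->
  dapp xx zs + dapp zz xs - c0 <= s).
{ intros zs zz s Hs. apply difference_quotient_limit with (dapp zz zs). intros t Ht.
  generalize (contact_conjugate_above H
    (ns_add (ns_scal (1 - t) xs) (ns_scal t zs)) (ns_add (ns_scal (1 - t) xx) (ns_scal t zz))
    ((1 - t) * c0 + t * s) HH).
  linall. fold c0. intros K. assert (K' : _) by (apply K; clear K; intros m ms Hm;
    generalize (Hphi m ms Hm) (Hs m ms Hm); linall; intros A B;
    apply (Rmult_le_compat_l (1 - t)) in A; [|lra]; apply (Rmult_le_compat_l t) in B; [|lra]; lra).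
  lra. }
apply NNPP; intros Hno.
set (E := nsprod (Dual (Dual X)) (nsprod (Dual X) X)).
(* Evaluation at [xs] is included because the conic lower bound of the separation has to control
   [<xs, y>]. *)
set (l' := xs :: l).
assert (HE : vspace E) by (apply nsprod_vspace; exact _).
set (N := ns_norm xx). assert (HN : 0 <= N) by apply nm_ge0.
assert (Hcanon : exists J : Dual X -> Dual (Dual (Dual X)), forall f e, dapp (J f) e = dapp e f).
{ destruct (choice (fun (f : Dual X) (J : Dual (Dual (Dual X))) => forall e, dapp J e = dapp e f))
    as [J HJ]; [|now exists J].
  intros f. destruct (canon_ex f) as (ff & Hff & _). now exists ff. }
destruct Hcanon as [J HJ].
assert (Hev : forall f e, In f l' -> Rabs (dapp e f) <= eval_sum (map J l') e).
{ intros f e Hf. rewrite <- HJ. apply eval_sum_in. now apply in_map. }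
destruct (nonvertical_separation E
  (fun e => eval_sum (map J l') (fst e) + (ns_norm (fst (snd e)) + ns_norm (snd (snd e))))
  (fun e r => exists y y' ys, canon y (fst e) /\ ns_norm y' <= N /\
     convex_hull (contact_graph H) (y, ys) r /\ snd e = (ys, ns_sub y y'))
  (xx, (xs, ns_zero)) (c0 + d) d (1 + N) c0) as (L & M & HL & HM & Hb & HK).
- apply seminorm_add; [|apply seminorm_add].
  + now apply (seminorm_comp (eval_sum_seminorm (map J l'))).
  + now apply (seminorm_comp (norm_seminorm (Dual X)) (fun e : E => fst (snd e))).
  + now apply (seminorm_comp (norm_seminorm X) (fun e : E => snd (snd e))).
- intros [e1 [e2 e3]] r1 [f1 [f2 f3]] r2 t Ht (y1 & y1' & ys1 & A1 & A2 & A3 & A4)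
   (y2 & y2' & ys2 & B1 & B2 & B3 & B4).
  cbn [fst snd] in *. injection A4; intros -> ->. injection B4; intros -> ->.
  exists (ns_add (ns_scal t y1) (ns_scal (1 - t) y2)),
    (ns_add (ns_scal t y1') (ns_scal (1 - t) y2')),
    (ns_add (ns_scal t ys1) (ns_scal (1 - t) ys2)).
  unfold E. rewrite !prod_scalE, !prod_addE. cbn [fst snd].
  split; [|split; [|split]].
  + intros f. linall. rewrite (A1 f), (B1 f). ring.
  + eapply Rle_trans; [apply nm_tri|]. rewrite !nm_scal, !Rabs_pos_eq by lra. nra.
  + exact (convex_hull_convex _ _ _ _ _ _ Ht A3 B3).
  + f_equal. vec.
- lra.
- lra.
- intros [e1 [e2 e3]] r (y & y' & ys & A1 & A2 & A3 & A4).
  cbn [fst snd] in *. injection A4; intros -> ->.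
  unfold E. rewrite ?fst_subE, ?snd_subE, ?fst_subE. cbn [fst snd].
  generalize (Hhull y ys r A3) (Hev xs (ns_sub e1 xx) (or_introl eq_refl)) (dapp_lb xx (ns_sub ys xs))
    (Rle_abs (- dapp (ns_sub e1 xx) xs)) (nm_ge0 (ns_sub (ns_sub y y') ns_zero))
    (nm_ge0 (ns_sub ys xs)).
  rewrite Rabs_Ropp, dapp_subl, (A1 xs). linall. fold c0 N.
  set (S := eval_sum _ _). set (a := ns_norm (ns_sub ys xs)). set (b := ns_norm (ns_sub (ns_sub y y') ns_zero)).
  intros K1 K2 K3 K4 K5 K6.
  assert (0 <= S) by (eapply Rle_trans; [apply Rabs_pos|exact K2]).
  assert (0 <= N * S) by nra. assert (0 <= N * b) by nra. lra.
- intros [e1 [e2 e3]] r (y & y' & ys & A1 & A2 & A3 & A4).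
  cbn [fst snd] in *. injection A4; intros -> ->.
  unfold E. rewrite ?fst_subE, ?snd_subE, ?fst_subE. cbn [fst snd]. intros Hlt.
  apply Rnot_lt_le; intros Hr. apply Hno. exists y, ys, r.
  assert (P1 := proj1 (eval_sum_seminorm (map J l')) (ns_sub e1 xx)).
  assert (P2 := nm_ge0 (ns_sub ys xs)).
  assert (P3 := nm_ge0 (ns_sub (ns_sub y y') ns_zero)).
  split; [auto|split; [|split; [|split; [lra|fold c0; lra]]]].
  + assert (Hy : ns_norm (ns_sub (ns_sub y y') ns_zero) <= 1) by lra.
    replace y with (ns_add (ns_sub (ns_sub y y') ns_zero) y') by vec.
    eapply Rle_trans; [apply nm_tri|]. fold N. lra.
  + intros f Hf. generalize (Hev f (ns_sub e1 xx) (or_intror Hf)).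
    rewrite dapp_subl, (A1 f). lra.
- destruct HL as [La Ls].
  assert (HL3 : forall a b c, L (a, (b, c)) = L (a, (ns_zero, ns_zero)) + L (ns_zero, (b, c))).
  { intros a b c. rewrite <- La. f_equal. pvec. }
  assert (Hbd : forall b c, Rabs (L (ns_zero, (b, c))) <= M * (ns_norm b + ns_norm c)).
  { intros b c. eapply Rle_trans; [apply Hb|]. cbn [fst snd].
    rewrite eval_sum_zero; [lra|]. intros f _. apply dapp_zeror. }
  destruct (dual_of_prod (fun e => L (ns_zero, e)) M) as (w & th & Hw); [split|auto| |].
  { intros x y. rewrite <- La. f_equal. pvec. }
  { intros a x. rewrite <- Ls. f_equal. pvec. }
  { intros [b c]. apply Hbd. }
  (* On the bidual coordinate [L] is dominated by finitely many evaluations, so it vanishes on their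
     common kernel and is itself an evaluation. *)
  assert (Hg : exists g : Dual X, forall a, L (a, (ns_zero, ns_zero)) = dapp a g).
  { apply (kernel_lemma (Dual (Dual X)) (fun phi => exists g : Dual X, forall a, phi a = dapp a g)
       (map (fun f a => dapp a f) l')) with (L := fun a => L (a, (ns_zero, ns_zero))).
    - intros f g [h Hh] Hfg. exists h. intros a; now rewrite <- Hfg.
    - exists ns_zero. intros a; now rewrite dapp_zeror.
    - intros f g a [h Hh] [k Hk]. exists (ns_add h (ns_scal a k)).
      intros b. rewrite Hh, Hk. linall. ring.
    - intros f Hf. apply in_map_iff in Hf. destruct Hf as (g & <- & _).
      split; [now exists g|]. split; intros; linall; ring.
    - split.
      + intros x y. rewrite <- La. f_equal. pvec.
      + intros a x. rewrite <- Ls. f_equal. pvec.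
    - intros e He. generalize (Hb (e, (ns_zero, ns_zero))). cbn [fst snd].
      rewrite !nm_zero, eval_sum_zero.
      + rewrite !Rplus_0_r, Rmult_0_r. intros K.
        apply NNPP; intros Hn. apply Rabs_pos_lt in Hn. lra.
      + intros f Hf. apply in_map_iff in Hf. destruct Hf as (g & <- & Hg).
        rewrite HJ. apply (He (fun a => dapp a g)).
        apply in_map_iff. now exists g. }
  destruct Hg as [g Hg].
  (* The separating inequality bounds the conjugate over the contact set at [(- (g + th), - w)], and
     [Htan] compares this with the tangent. What is left, taken over the ball of radius [N], says
     [N |th| + d <= <xx, th>], impossible as [N] is the norm of [xx]. *)
  assert (key : forall y', ns_norm y' <= N -> dapp th y' + d <= dapp xx th).
  { intros y' Hy'.
    generalize (Htan (ns_opp (ns_add g th)) (ns_opp w)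
      (- (c0 + d) - dapp th y' - dapp xx g - dapp w xs)).
    intros K. assert (K' : dapp xx (ns_opp (ns_add g th)) + dapp (ns_opp w) xs - c0
       <= - (c0 + d) - dapp th y' - dapp xx g - dapp w xs).
    { apply K. intros m ms Hm. destruct (canon_ex m) as (mm & Hmm & _).
      generalize (HK (mm, (ms, ns_sub m y')) (dapp ms m)). cbn [fst snd].
      intros K1. assert (K2 : _) by (apply K1; exists m, y', ms; split; [exact Hmm|split; [auto|
        split; [|reflexivity]]]; intros K0 _ HK0; apply HK0; now split).
      rewrite HL3, Hg, Hw, (Hmm g) in K2. rewrite (HL3 xx), Hg, Hw in K2.
      revert K2. linall. lra. }
    revert K'. linall. lra. }
  destruct (dual_attain th N d) as (y' & Hy' & Hlt); [auto|lra|].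
  generalize (key y' Hy') (dapp_ub xx th). fold N. lra.
Qed.

(** Indices are finite lists of conditions together with a precision [1 / (n + 1)]. With [option] as
    index type, one real-valued quantity such as a norm joins the evaluations as a further
    condition. *)
Lemma net_of_finite_approximations (P J : Type) (good : P -> Prop) (ev : J -> P -> R) (t : J -> R) :
  (forall l eps, 0 < eps -> exists p, good p /\ forall j, In j l -> Rabs (ev j p - t j) < eps) ->
  exists (D : Directed) (pn : D -> P),
    (forall i, good (pn i)) /\ forall j, net_lim (fun i => ev j (pn i)) (t j).
Proof.
intros H.
assert (H' : forall i : list J * nat, exists p, good p /\
  forall j, In j (fst i) -> Rabs (ev j p - t j) < / (INR (snd i) + 1)).
{ intros [l n]. apply H. apply Rinv_0_lt_compat. generalize (pos_INR n). simpl. lra. }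
destruct (choice _ H') as [pn Hpn].
assert (Hdir : forall i j : list J * nat, exists k, (incl (fst i) (fst k) /\ (snd i <= snd k)%nat) /\
   (incl (fst j) (fst k) /\ (snd j <= snd k)%nat)).
{ intros [l n] [l' n']. exists (l ++ l', Nat.max n n'). simpl.
  repeat split; try lia; [apply incl_appl|apply incl_appr]; apply incl_refl. }
exists {| dI := list J * nat; dle := fun i k => incl (fst i) (fst k) /\ (snd i <= snd k)%nat;
  dle_refl := fun i => conj (incl_refl _) (le_n _);
  dle_trans := fun i j k a b => conj (incl_tran (proj1 a) (proj1 b))
                                 (Nat.le_trans _ _ _ (proj2 a) (proj2 b));
  dle_dir := Hdir; d_inh := (nil, 0%nat) |}, pn.
split; [intros i; apply Hpn|].
intros j eps He. destruct (archimed_cor1 eps He) as (n & Hn & Hn0).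
exists (j :: nil, n). intros [l m] [Hl Hm]; cbn [fst snd] in *.
eapply Rlt_trans; [apply Hpn; apply Hl; now left|].
eapply Rle_lt_trans; [|exact Hn]. cbn [snd].
apply le_INR in Hm. apply lt_INR in Hn0. simpl in Hn0.
apply Rinv_le_contravar; lra.
Qed.

Lemma contact_gossez_D {X : NSpace} {HX : banach X} (H : nsprod X (Dual X) -> R -> Prop) :
  strong_epi H -> gossez_D (contact_set H).
Proof.
intros HH. split; [now apply contact_maximal|]. intros xx xs Hcl.
set (N := ns_norm xx). assert (HN : 0 <= N) by apply nm_ge0.
destruct (net_of_finite_approximations (X * Dual X) (option (Dual X))
  (fun p => contact_set H (fst p) (snd p) /\ ns_norm (fst p) <= N + 2 /\
     ns_norm (snd p) <= ns_norm xs + 1)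
  (fun j p => match j with Some f => dapp f (fst p) | None => ns_norm (ns_sub (snd p) xs) end)
  (fun j => match j with Some f => dapp xx f | None => 0 end)) as (D & pn & Hgood & Hlim).
- intros l eps He.
  destruct (list_norm_bound (map (fun o => match o with Some f => f | None => ns_zero end) l))
    as (B & HB & HBl).
  (* [t] is the radius allowed by Brøndsted-Rockafellar, [d] the resulting tolerance. *)
  set (e := Rmin eps 1).
  assert (He' : 0 < e <= 1) by (split; [apply Rmin_pos; lra|apply Rmin_r]).
  assert (Hee : e <= eps) by apply Rmin_l.
  set (t := e / (24 * (B + 1))).
  assert (Ht : 0 < t) by (apply Rdiv_lt_0_compat; lra).
  assert (HtB : 6 * t * (B + 1) = e / 4) by (unfold t; field; lra).
  set (d := Rmin (e / 4) (t² / (2 * (N + 3)))).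
  assert (Ht2 : 0 < t²) by (unfold Rsqr; nra).
  assert (Hd : 0 < d) by (apply Rmin_pos; [lra|apply Rdiv_lt_0_compat; lra]).
  assert (Hd1 : d <= e / 4) by apply Rmin_l.
  assert (Hd2 : d * (N + 3) < t²).
  { apply Rle_lt_trans with (t² / (2 * (N + 3)) * (N + 3)).
    - apply Rmult_le_compat_r; [lra|apply Rmin_r].
    - replace (t² / (2 * (N + 3)) * (N + 3)) with (t² / 2) by (field; lra). lra. }
  destruct (closure_approximation H xx xs HH Hcl
    (xs :: map (fun o => match o with Some f => f | None => ns_zero end) l) d)
    as (y & ys & r & A1 & A2 & A3 & A4 & A5); [lra|].
  assert (Hr : H (y, ys) r).
  { apply A1; [apply HH|]. intros [m ms] r' [Hm ->]. exact Hm. }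
  (* The gap collects [d] from [r], [d] from evaluation at [xs], and [d (N + 1)] from [ys - xs]
     paired with [y]; this is where [N + 3] comes from. *)
  assert (Hgap : r - dapp ys y < t²).
  { generalize (A3 xs (or_introl eq_refl)) (dapp_lb (ns_sub ys xs) y). intros K1 K2.
    apply Rabs_def2 in K1. rewrite dapp_subl in K2. fold N in A2.
    assert (ns_norm (ns_sub ys xs) * ns_norm y <= d * (N + 1)).
    { apply Rmult_le_compat; try apply nm_ge0; lra. }
    lra. }
  destruct (bronsted_rockafellar H y ys r t HH Ht Hr Hgap) as (m & ms & Hm & D1 & D2).
  assert (Ht1 : 6 * t <= e / 4) by nra.
  exists (m, ms). cbn [fst snd]. split; [split; [auto|split]|].
  + replace m with (ns_add (ns_sub m y) y) by vec.
    eapply Rle_trans; [apply nm_tri|]. fold N in A2. lra.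
  + replace ms with (ns_add (ns_add (ns_sub ms ys) (ns_sub ys xs)) xs) by vec.
    eapply Rle_trans; [apply nm_tri|]. eapply Rle_trans; [apply Rplus_le_compat_r, nm_tri|]. lra.
  + intros [f|] Hj.
    * assert (Hf : In f (map (fun o => match o with Some f => f | None => ns_zero end) l))
        by (apply in_map_iff; now exists (Some f)).
      generalize (A3 f (or_intror Hf)) (HBl f Hf) (dapp_le f (ns_sub m y)). intros K1 K2 K3.
      replace (dapp f m - dapp xx f) with (dapp f (ns_sub m y) + (dapp f y - dapp xx f))
        by (linall; ring).
      eapply Rle_lt_trans; [apply Rabs_triang|].
      assert (ns_norm f * ns_norm (ns_sub m y) <= B * (6 * t)).
      { apply Rmult_le_compat; try apply nm_ge0; lra. }
      lra.
    * rewrite Rminus_0_r, Rabs_pos_eq by apply nm_ge0.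
      eapply Rle_lt_trans; [apply (nm_sub_tri _ ys)|]. lra.
- exists D, (fun i => fst (pn i)), (fun i => snd (pn i)).
  split; [intros i; apply Hgood|split; [|split]].
  + exists (N + 2 + (ns_norm xs + 1)). intros i. destruct (Hgood i) as (_ & K1 & K2).
    generalize (nm_ge0 xs) (nm_ge0 (fst (pn i))) (nm_ge0 (snd (pn i))). lra.
  + intros f. exact (Hlim (Some f)).
  + exact (Hlim None).
Qed.


(** * Conjugate of the generalized infimal convolution *)

(** If the point at height [r] were not in the closed [H], some height [r + eps] could be separated
    from it. The given bound on the conjugate is an affine minorant, which makes the hyperplane
    nonvertical and hence an affine minorant above [r] at the point. *)
Lemma fenchel_moreau {X : NSpace} {HX : normed X} (H : nsprod X (Dual X) -> R -> Prop)
   (x : X) (xs : Dual X) r :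
  convex_rel H -> epi_closed H -> (exists zs zz s, conj_le H zs zz s) ->
  (forall zs zz s, conj_le H zs zz s -> dapp zs x + dapp zz xs - s <= r) -> H (x, xs) r.
Proof.
intros Hcv Hcl (z0 & zz0 & s0 & H0) Hr.
apply Hcl. intros eps He. apply NNPP; intros Hno.
assert (N1 := nm_ge0 z0). assert (N2 := nm_ge0 zz0).
destruct (nonvertical_separation (nsprod X (Dual X)) (@ns_norm (nsprod X (Dual X))) H (x, xs)
  (r + eps) eps (ns_norm z0 + ns_norm zz0) (dapp z0 x + dapp zz0 xs - s0))
  as (L & N & HL & HN & Hb & HK).
- apply norm_seminorm; exact _.
- exact Hcv.
- exact He.
- lra.
- intros [y ys] t Ht. rewrite prod_subE, prod_normE.
  generalize (H0 y ys t Ht) (dapp_lb z0 (ns_sub y x)) (dapp_lb zz0 (ns_sub ys xs))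
    (Rmult_le_pos _ _ N2 (nm_ge0 (ns_sub y x))) (Rmult_le_pos _ _ N1 (nm_ge0 (ns_sub ys xs))).
  linall. lra.
- intros [y ys] t Ht. rewrite prod_subE, prod_normE.
  generalize (nm_ge0 (ns_sub y x)) (nm_ge0 (ns_sub ys xs)). intros K1 K2 Hlt.
  apply Rnot_lt_le; intros Hlt2. apply Hno. exists y, ys, t. repeat split; auto; lra.
- destruct (dual_of_prod L N HL HN Hb) as (f & g & Hfg).
  assert (K : conj_le H (ns_opp f) (ns_opp g) (- (r + eps) - dapp f x - dapp g xs)).
  { intros y ys t Ht. generalize (HK _ _ Ht). rewrite !Hfg. linall. lra. }
  generalize (Hr _ _ _ K). linall. lra.
Qed.

(** Collects heights above sums that are actually taken; the infimum itself may be missing, a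
    difference that the later closure removes. *)
Definition inf_conv {X Y : NSpace} (A : BLin X Y) (HS : nsprod X (Dual X) -> R -> Prop)
    (HT : nsprod Y (Dual Y) -> R -> Prop) : nsprod X (Dual X) -> R -> Prop :=
  fun p r => exists (u w : X) (vs : Dual Y) s t, fst p = ns_add u w /\ snd p = adj A vs /\
    HS (u, snd p) s /\ HT (A w, vs) t /\ s + t <= r.

(** Epigraph form of the set in (b). The coordinates [us] and [bs] stay independent because the
    diagonal is imposed only after the weak* closure. *)
Definition dual_pair {X Y : NSpace} (A : BLin X Y) (HS : nsprod X (Dual X) -> R -> Prop)
    (HT : nsprod Y (Dual Y) -> R -> Prop)
    (us bs : Dual X) (zz : Dual (Dual Y)) (r : R) : Prop :=
  exists (uu : Dual (Dual X)) (vs : Dual Y) (vv : Dual (Dual Y)) s t,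
    conj_le HS us uu s /\ conj_le HT vs vv t /\ bs = adj A vs /\
    (forall g, dapp zz g = dapp uu (adj A g) + dapp vv g) /\ s + t <= r.

Definition conjugate_exact {X Y : NSpace} (A : BLin X Y) (HS : nsprod X (Dual X) -> R -> Prop)
    (HT : nsprod Y (Dual Y) -> R -> Prop) : Prop :=
  forall xs xx m zz, conj_le (inf_conv A HS HT) xs xx m ->
    (forall g, dapp zz g = dapp xx (adj A g)) -> dual_pair A HS HT xs xs zz m.

Lemma conj_le_convex {X : NSpace} (H : nsprod X (Dual X) -> R -> Prop) xs xx s ys yy t l :
  0 <= l <= 1 -> conj_le H xs xx s -> conj_le H ys yy t ->
  conj_le H (ns_add (ns_scal l xs) (ns_scal (1 - l) ys))
    (ns_add (ns_scal l xx) (ns_scal (1 - l) yy)) (l * s + (1 - l) * t).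
Proof.
intros Hl H1 H2 y zs r Hr. specialize (H1 y zs r Hr). specialize (H2 y zs r Hr). linall.
apply (Rmult_le_compat_l l) in H1; [|lra]. apply (Rmult_le_compat_l (1 - l)) in H2; lra.
Qed.

(** The weak* continuous functionals on the product of [Dual X], [Dual X] and the bidual of [Y]. *)
Definition triple_eval {X Y : NSpace} (q : X * (X * Dual Y))
    (e : Dual X * (Dual X * Dual (Dual Y))) : R :=
  dapp (fst e) (fst q) + dapp (fst (snd e)) (fst (snd q)) + dapp (snd (snd e)) (snd (snd q)).

Lemma triple_eval_dual {X Y : NSpace} {HX : normed X} {HY : normed Y} (q : X * (X * Dual Y)) :
  exists J : Dual (nsprod (Dual X) (nsprod (Dual X) (Dual (Dual Y)))),
    forall e, dapp J e = triple_eval q e.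
Proof.
destruct q as [a [b g]].
assert (Na := nm_ge0 a). assert (Nb := nm_ge0 b). assert (Ng := nm_ge0 g).
apply (@dual_of_linear (nsprod (Dual X) (nsprod (Dual X) (Dual (Dual Y))))
  (triple_eval (a, (b, g))) (ns_norm a + ns_norm b + ns_norm g)).
- unfold triple_eval; split.
  + intros [x1 [x2 x3]] [y1 [y2 y3]].
    change (dapp (ns_add x1 y1) a + dapp (ns_add x2 y2) b + dapp (ns_add x3 y3) g =
     dapp x1 a + dapp x2 b + dapp x3 g + (dapp y1 a + dapp y2 b + dapp y3 g)).
    linall; ring.
  + intros t [x1 [x2 x3]].
    change (dapp (ns_scal t x1) a + dapp (ns_scal t x2) b + dapp (ns_scal t x3) g =
     t * (dapp x1 a + dapp x2 b + dapp x3 g)).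
    linall; ring.
- lra.
- intros [x1 [x2 x3]]. unfold triple_eval; cbn [fst snd].
  change (Rabs (dapp x1 a + dapp x2 b + dapp x3 g) <=
    (ns_norm a + ns_norm b + ns_norm g) * (ns_norm x1 + (ns_norm x2 + ns_norm x3))).
  eapply Rle_trans; [apply Rabs_triang|].
  eapply Rle_trans; [apply Rplus_le_compat_r, Rabs_triang|].
  generalize (dapp_le x1 a) (dapp_le x2 b) (dapp_le x3 g) (nm_ge0 x1) (nm_ge0 x2) (nm_ge0 x3).
  intros. assert (0 <= ns_norm a * (ns_norm x2 + ns_norm x3)) by nra.
  assert (0 <= ns_norm b * (ns_norm x1 + ns_norm x3)) by nra.
  assert (0 <= ns_norm g * (ns_norm x1 + ns_norm x2)) by nra. nra.
Qed.

(* If the point were outside the weak* closure, a separating functional would be an evaluation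
   at some [(a, b, g)]; by biconjugation this bounds the infimal convolution at
   [(- a - b, - A^* g)] and contradicts the value of its conjugate. *)
Lemma dual_pair_weak_star_dense {X Y : NSpace} {HX : normed X} {HY : normed Y} (A : BLin X Y)
    (HS : nsprod X (Dual X) -> R -> Prop) (HT : nsprod Y (Dual Y) -> R -> Prop)
    (xs : Dual X) (xx : Dual (Dual X)) (m : R) (zz : Dual (Dual Y)) :
  convex_rel HS -> epi_closed HS -> (exists zs zz s, conj_le HS zs zz s) ->
  convex_rel HT -> epi_closed HT -> (exists zs zz s, conj_le HT zs zz s) ->
  (exists p r, inf_conv A HS HT p r) ->
  conj_le (inf_conv A HS HT) xs xx m ->
  (forall g, dapp zz g = dapp xx (adj A g)) ->
  forall l eps, 0 < eps -> exists us bs z r, dual_pair A HS HT us bs z r /\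
    Rabs (r - m) < eps /\
    forall q, In q l -> Rabs (triple_eval q (us, (bs, z)) - triple_eval q (xs, (xs, zz))) < eps.
Proof.
intros HS1 HS2 HS3 HT1 HT2 HT3 (p0 & r0 & u0 & w0 & vs0 & s0 & t0 & E1 & E2 & HS0 & HT0 & Hst0)
  Hm Hzz l eps He.
rewrite E2 in HS0.
apply NNPP; intros Hno.
destruct (choice (fun q (J : Dual (nsprod (Dual X) (nsprod (Dual X) (Dual (Dual Y))))) =>
  forall e, dapp J e = triple_eval q e)) as [J HJ]; [exact triple_eval_dual|].
set (E := nsprod (Dual X) (nsprod (Dual X) (Dual (Dual Y)))) in *.
assert (HE : vspace E) by (unfold E; exact _).
(* By the definition of the conjugates, evaluation at a feasible primal point bounds [r] from below
   on all dual pairs; this supplies the conic minorant. *)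
set (q0 := (u0, (w0, vs0)) : X * (X * Dual Y)).
set (l' := map J (q0 :: l)).
destruct (nonvertical_separation E (eval_sum l')
  (fun e r => dual_pair A HS HT (fst e) (fst (snd e)) (snd (snd e)) r)
  (xs, (xs, zz)) (m + eps) eps 1 (dapp (J q0) (xs, (xs, zz)) - s0 - t0))
  as (L & N & HL & HN & Hb & HK).
- apply eval_sum_seminorm.
- intros e1 r1 e2 r2 t Ht (uu1 & vs1 & vv1 & s1 & t1 & A1 & A2 & A3 & A4 & A5)
    (uu2 & vs2 & vv2 & s2 & t2 & B1 & B2 & B3 & B4 & B5).
  exists (ns_add (ns_scal t uu1) (ns_scal (1 - t) uu2)),
    (ns_add (ns_scal t vs1) (ns_scal (1 - t) vs2)),
    (ns_add (ns_scal t vv1) (ns_scal (1 - t) vv2)),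
    (t * s1 + (1 - t) * s2), (t * t1 + (1 - t) * t2).
  split; [exact (conj_le_convex HS _ _ _ _ _ _ t Ht A1 B1)|].
  split; [exact (conj_le_convex HT _ _ _ _ _ _ t Ht A2 B2)|].
  split; [|split].
  + rewrite adj_add, !adj_scal, <- A3, <- B3. reflexivity.
  + intros g. change (dapp (ns_add (ns_scal t (snd (snd e1))) (ns_scal (1 - t) (snd (snd e2)))) g =
      dapp (ns_add (ns_scal t uu1) (ns_scal (1 - t) uu2)) (adj A g) +
      dapp (ns_add (ns_scal t vv1) (ns_scal (1 - t) vv2)) g).
    linall. rewrite A4, B4. ring.
  + apply (Rmult_le_compat_l t) in A5; [|lra]. apply (Rmult_le_compat_l (1 - t)) in B5; lra.
- lra.
- lra.
- intros e r Hd.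
  assert (K : dapp (J q0) e <= r + s0 + t0).
  { rewrite HJ. destruct e as [e1 [e2 e3]].
    destruct Hd as (uu & vs & vv & s & t & A1 & A2 & A3 & A4 & A5). cbn [fst snd] in *.
    specialize (A1 _ _ _ HS0). specialize (A2 _ _ _ HT0). specialize (A4 vs0).
    unfold triple_eval, q0; cbn [fst snd]. rewrite A3, adjE, A4. lra. }
  generalize (eval_sum_in l' (J q0) (ns_sub e (xs, (xs, zz))) (or_introl eq_refl)).
  rewrite dapp_subr. intros K2.
  generalize (Rle_abs (- (dapp (J q0) e - dapp (J q0) (xs, (xs, zz))))). rewrite Rabs_Ropp. lra.
- intros [us [bs z]] r Hd Hlt. cbn [fst snd] in Hd.
  (* Dual pairs are upward closed in the height, so one that is too low is raised to [m]; the height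
     is then within [eps] of [m]. *)
  apply Rnot_lt_le; intros Hr. apply Hno. exists us, bs, z, (Rmax r m).
  split; [|split].
  + destruct Hd as (uu & vs & vv & s & t & A1 & A2 & A3 & A4 & A5).
    exists uu, vs, vv, s, t. repeat split; auto. generalize (Rmax_l r m); lra.
  + rewrite Rabs_pos_eq by (generalize (Rmax_r r m); lra).
    unfold Rmax; destruct (Rle_dec r m); lra.
  + intros q Hq. rewrite <- !HJ, <- dapp_subr.
    eapply Rle_lt_trans; [|exact Hlt]. apply eval_sum_in. unfold l'.
    apply in_map. now right.
- assert (Hq : exists q : X * (X * Dual Y), forall e, L e = triple_eval q e).
  { apply (kernel_lemma E (fun phi => exists q : X * (X * Dual Y), forall e, phi e = triple_eval q e)
       (map (fun f e => dapp f e) l')) with (L := L).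
    - intros f g [h Hh] Hfg. exists h. intros a; now rewrite <- Hfg.
    - exists (ns_zero, (ns_zero, ns_zero)). intros a; unfold triple_eval; cbn [fst snd].
      rewrite !dapp_zeror. ring.
    - intros f g a [[h1 [h2 h3]] Hh] [[k1 [k2 k3]] Hk].
      exists (ns_add h1 (ns_scal a k1), (ns_add h2 (ns_scal a k2), ns_add h3 (ns_scal a k3))).
      intros b. rewrite Hh, Hk. unfold triple_eval; cbn [fst snd]. linall. ring.
    - intros f Hf. apply in_map_iff in Hf. destruct Hf as (g & <- & Hg).
      apply in_map_iff in Hg. destruct Hg as (q & <- & _).
      split; [exists q; apply HJ|]. split; intros; linall; ring.
    - auto.
    - intros e Hz. generalize (Hb e). rewrite eval_sum_zero.
      + rewrite Rmult_0_r. intros K. apply NNPP; intros Hn. apply Rabs_pos_lt in Hn. lra.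
      + intros f Hf. apply (Hz (fun e => dapp f e)). apply in_map_iff. now exists f. }
  destruct Hq as [[a [b g]] Hq].
  set (ys := ns_opp g).
  set (u := ns_opp a). set (w := ns_opp b).
  set (R0 := dapp xs u + dapp xs w + dapp xx (adj A ys) - m - eps).
  assert (key : forall us uu s vs vv t, conj_le HS us uu s -> conj_le HT vs vv t ->
    (dapp us u + dapp uu (adj A ys) - s) + (dapp vs (A w) + dapp vv ys - t) <= R0).
  { intros us uu s vs vv t K1 K2.
    destruct (adj_le A) as (NA & HNA & HA).
    destruct (@dual_of_linear (Dual Y) (fun g => dapp uu (adj A g) + dapp vv g)
       (ns_norm uu * NA + ns_norm vv)) as [z Hz].
    - split; intros; rewrite ?adj_add, ?adj_scal; linall; ring.
    - generalize (nm_ge0 uu) (nm_ge0 vv); nra.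
    - intros f. eapply Rle_trans; [apply Rabs_triang|].
      generalize (dapp_le uu (adj A f)) (dapp_le vv f)
        (Rmult_le_compat_l _ _ _ (nm_ge0 uu) (HA f)). lra.
    - generalize (HK (us, (adj A vs, z)) (s + t)). cbn [fst snd]. intros K3.
      assert (K4 : _) by (apply K3; exists uu, vs, vv, s, t; repeat split; auto; lra).
      clear K3. rewrite !Hq in K4. unfold triple_eval in K4; cbn [fst snd] in K4.
      rewrite Hz, Hzz, adjE in K4.
      assert (Eg : adj A ys = ns_opp (adj A g)) by (apply dual_ext; reflexivity).
      assert (Ew : A w = ns_opp (A b)) by (unfold w; rewrite vs_opp, bl_scal, <- vs_opp; reflexivity).
      unfold R0. rewrite Eg, Ew. unfold u, w, ys. linall. lra. }
  (* The joint bound [R0] is split at the supremum [rho] of the first summand, so that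
     [fenchel_moreau] applies to [HS] and to [HT] separately. *)
  pose (vals := fun v => exists us uu s, conj_le HS us uu s /\
    v = dapp us u + dapp uu (adj A ys) - s).
  destruct HT3 as (vs1 & vv1 & t1 & HT3). destruct HS3 as (us1 & uu1 & s1 & HS3).
  destruct (completeness vals) as [rho [Hr1 Hr2]].
  { exists (R0 - (dapp vs1 (A w) + dapp vv1 ys - t1)).
    intros v (us & uu & s & Hs & ->). generalize (key _ _ _ _ _ _ Hs HT3). lra. }
  { eexists; exists us1, uu1, s1; split; [auto|reflexivity]. }
  assert (FS : HS (u, adj A ys) rho).
  { apply fenchel_moreau; auto; [eauto|]. intros zs z s Hs. apply Hr1. now exists zs, z, s. }
  assert (FT : HT (A w, ys) (R0 - rho)).
  { apply fenchel_moreau; auto; [eauto|]. intros zs z t Ht.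
    assert (rho <= R0 - (dapp zs (A w) + dapp z ys - t)); [|lra].
    apply Hr2. intros v (us & uu & s & Hs & ->). generalize (key _ _ _ _ _ _ Hs Ht). lra. }
  generalize (Hm (ns_add u w) (adj A ys) R0). intros K.
  assert (K' : _) by (apply K; exists u, w, ys, rho, (R0 - rho); cbn [fst snd];
    repeat split; auto; lra).
  revert K'. rewrite dapp_addr. unfold R0. lra.
Qed.


(** * An open mapping theorem for closed convex sets *)

Lemma seq_conv_unique {V : NSpace} {HV : normed V} (u : nat -> V) k l l' :
  seq_conv u l -> seq_conv (fun n => u (k + n)%nat) l' -> l = l'.
Proof.
intros H1 H2.
assert (E : ns_norm (ns_sub l l') <= 0).
{ apply Rle_plus_epsilon. intros eps He.
  destruct (H1 (eps / 2)) as [N1 HN1]; [lra|]. destruct (H2 (eps / 2)) as [N2 HN2]; [lra|].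
  specialize (HN1 (k + Nat.max N1 N2)%nat ltac:(lia)).
  specialize (HN2 (Nat.max N1 N2) ltac:(lia)).
  rewrite nm_subC in HN1. generalize (nm_sub_tri l (u (k + Nat.max N1 N2)%nat) l'). lra. }
assert (Z : ns_sub l l' = ns_zero) by (apply nm_eq0; generalize (nm_ge0 (ns_sub l l')); lra).
replace l with (ns_add (ns_sub l l') l') by vec. rewrite Z. vec.
Qed.

(** Otherwise one picks centres in [W] and radii at most halving, the ball at stage [n + 1] missing
    [B n]. The centres converge inside [W] to a point that lies in none of the sets. *)
Lemma baire_closed_set {Z : NSpace} (HZ : banach Z) (W : Z -> Prop) (B : nat -> Z -> Prop) :
  Defs.closed_set W -> (exists z, W z) -> (forall z, W z -> exists n, B n z) ->
  exists n z0 d, W z0 /\ 0 < d /\ forall z, W z -> ns_norm (ns_sub z z0) < d ->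
    forall eps, 0 < eps -> exists b, B n b /\ ns_norm (ns_sub b z) < eps.
Proof.
intros HW [z0 Hz0] HB. apply NNPP; intros Hno.
assert (Hstep : forall s : nat * (Z * R), exists s' : Z * R,
  W (fst (snd s)) -> 0 < snd (snd s) ->
  W (fst s') /\ 0 < snd s' <= snd (snd s) / 2 /\
  ns_norm (ns_sub (fst s') (fst (snd s))) <= snd (snd s) / 2 /\
  forall b, B (fst s) b -> snd s' < ns_norm (ns_sub b (fst s'))).
{ intros [n [z d]]; cbn [fst snd].
  destruct (classic (W z /\ 0 < d)) as [[Hz Hd]|Hn]; [|exists (z, d); tauto].
  apply NNPP; intros Hn. apply Hno. exists n, z, (d / 2). split; [auto|split; [lra|]].
  intros z' Hz' Hd' eps He. apply NNPP; intros Hb. apply Hn.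
  exists (z', Rmin (d / 2) (eps / 2)). intros _ _. cbn [fst snd].
  split; [auto|split; [split; [apply Rmin_pos; lra|apply Rmin_l]|split; [lra|]]].
  intros b Hb'. apply Rnot_le_lt; intros Hle. apply Hb. exists b. split; [auto|].
  generalize (Rmin_r (d / 2) (eps / 2)). lra. }
destruct (choice _ Hstep) as [nxt Hnxt].
pose (s := fix s n := match n with O => (z0, 1) | S k => nxt (k, s k) end).
assert (Hs : forall n, W (fst (s n)) /\ 0 < snd (s n)).
{ induction n as [|n [I1 I2]]; [split; cbn [s fst snd]; [auto|lra]|].
  destruct (Hnxt (n, s n) I1 I2) as (K1 & K2 & _). split; [exact K1|apply K2]. }
assert (Hd : forall n k, snd (s (n + k)%nat) <= snd (s n) * (/ 2) ^ k).
{ intros n; induction k as [|k IH]; [rewrite Nat.add_0_r; simpl; lra|].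
  rewrite Nat.add_succ_r.
  destruct (Hnxt ((n + k)%nat, s (n + k)%nat) (proj1 (Hs _)) (proj2 (Hs _))) as (_ & K2 & _).
  cbn [fst snd] in K2. change (nxt ((n + k)%nat, s (n + k)%nat)) with (s (S (n + k))) in K2.
  simpl pow. lra. }
assert (Hz : forall n k, ns_norm (ns_sub (fst (s (n + S k)%nat)) (fst (s (n + k)%nat))) <=
   snd (s n) / 2 * (/ 2) ^ k).
{ intros n k. rewrite Nat.add_succ_r.
  destruct (Hnxt ((n + k)%nat, s (n + k)%nat) (proj1 (Hs _)) (proj2 (Hs _))) as (_ & _ & K3 & _).
  cbn [fst snd] in K3. change (nxt ((n + k)%nat, s (n + k)%nat)) with (s (S (n + k))) in K3.
  generalize (Hd n k). lra. }
destruct (geometric_limit HZ (fun k => fst (s k)) _ (Hz 0%nat)) as (l & Hl & _).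
assert (Wl : W l) by (apply (HW (fun k => fst (s k))); [apply Hs|auto]).
destruct (HB l Wl) as [n Hn].
(* Restarting the sequence at [S n] places the limit in the closed ball of that stage, which misses
   [B n]. *)
destruct (geometric_limit HZ (fun k => fst (s (S n + k)%nat)) _ (Hz (S n))) as (l' & Hl' & Hb).
rewrite <- (seq_conv_unique _ (S n) _ _ Hl Hl') in Hb.
destruct (Hnxt (n, s n) (proj1 (Hs _)) (proj2 (Hs _))) as (_ & _ & _ & K4).
specialize (K4 l Hn). cbn [fst] in K4. change (nxt (n, s n)) with (s (S n)) in K4.
rewrite Nat.add_0_r in Hb. lra.
Qed.

Lemma pow_half_small eps c : 0 < eps -> exists N, forall n, (N <= n)%nat -> c * (/ 2) ^ n < eps.
Proof.
intros He. destruct (pow_lt_1_zero (/ 2)) with (y := eps / (Rabs c + 1)) as [N HN].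
- rewrite Rabs_pos_eq; lra.
- apply Rdiv_lt_0_compat; [auto|generalize (Rabs_pos c); lra].
- exists N. intros n Hn. specialize (HN n Hn).
  assert (Hp : 0 < (/ 2) ^ n) by (apply pow_lt; lra).
  assert (Hc := Rabs_pos c). assert (Hc' := Rle_abs c).
  rewrite Rabs_pos_eq in HN by lra.
  apply (Rmult_lt_compat_l (Rabs c + 1)) in HN; [|lra].
  replace ((Rabs c + 1) * (eps / (Rabs c + 1))) with eps in HN by (field; lra). nra.
Qed.

Definition convex_pred {V : NSpace} (C : V -> Prop) : Prop :=
  forall x y l, 0 <= l <= 1 -> C x -> C y -> C (ns_add (ns_scal l x) (ns_scal (1 - l) y)).

Definition subspace {V : NSpace} (W : V -> Prop) : Prop :=
  forall x y a b, W x -> W y -> W (ns_add (ns_scal a x) (ns_scal b y)).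

(* Removing the closure: [z] is written as [sum_k 2^-k G (v k)] with [v k] in [C] bounded. *)
Lemma bounded_preimage_of_dense {V Z : NSpace} (HV : banach V) (HZ : banach Z)
    (C : V -> Prop) (W : Z -> Prop) (G : BLin V Z) delta N v0 :
  convex_pred C -> Defs.closed_set C -> subspace W -> (forall v, C v -> W (G v)) ->
  C v0 -> G v0 = ns_zero -> 0 < delta ->
  (forall z, W z -> ns_norm z < delta -> forall eps, 0 < eps ->
     exists v, C v /\ ns_norm v <= N /\ ns_norm (ns_sub (G v) z) < eps) ->
  forall z, W z -> ns_norm z < delta / 2 ->
    exists v, C v /\ ns_norm v <= N + 2 * ns_norm v0 /\ G v = z.
Proof.
intros HC1 HC2 HW HGW Hv0 Gv0 Hd Happ z Hz Hzd.
assert (Hstep : forall r, exists v, W r -> ns_norm r < delta / 2 ->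
  C v /\ ns_norm v <= N /\ ns_norm (ns_sub (G v) (ns_scal 2 r)) < delta / 2).
{ intros r. destruct (classic (W r /\ ns_norm r < delta / 2)) as [[K1 K2]|Hn]; [|exists v0; tauto].
  destruct (Happ (ns_scal 2 r)) with (eps := delta / 2) as (v & K); [| |lra|now exists v].
  - replace (ns_scal 2 r) with (ns_add (ns_scal 2 r) (ns_scal 0 r)) by vec. now apply HW.
  - rewrite nm_scal, Rabs_pos_eq; lra. }
destruct (choice _ Hstep) as [f Hf].
pose (r := fix r n := match n with O => z | S k => ns_sub (ns_scal 2 (r k)) (G (f (r k))) end).
assert (Hr : forall n, W (r n) /\ ns_norm (r n) < delta / 2).
{ induction n as [|n [I1 I2]]; [now split|].
  destruct (Hf _ I1 I2) as (K1 & K2 & K3). cbn [r]. split; [|now rewrite nm_subC].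
  replace (ns_sub (ns_scal 2 (r n)) (G (f (r n)))) with
    (ns_add (ns_scal 2 (r n)) (ns_scal (-1) (G (f (r n))))) by vec.
  apply HW; auto. }
pose (P := fix P n := match n with O => ns_zero | S k =>
   ns_add (P k) (ns_scal ((/ 2) ^ (S k)) (f (r k))) end).
(* The weights used in [P n] add up to [1 - 2^-n]; the missing mass goes to any point of [C], below
   to [v0], which [G] sends to 0. *)
assert (HP : forall n x, C x -> C (ns_add (P n) (ns_scal ((/ 2) ^ n) x))).
{ induction n as [|n IH]; intros x Hx; cbn [P pow].
  - replace (ns_add ns_zero (ns_scal 1 x)) with x by vec. auto.
  - replace (ns_add (ns_add (P n) (ns_scal (/ 2 * (/ 2) ^ n) (f (r n))))
      (ns_scal (/ 2 * (/ 2) ^ n) x)) with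
      (ns_add (P n) (ns_scal ((/ 2) ^ n) (ns_add (ns_scal (/ 2) (f (r n))) (ns_scal (1 - / 2) x))))
      by (vec; field).
    apply IH. apply HC1; [lra| |exact Hx]. apply (Hf _ (proj1 (Hr n)) (proj2 (Hr n))). }
set (s := fun n => ns_add (P n) (ns_scal ((/ 2) ^ n) v0)).
destruct (geometric_limit HV s ((N + ns_norm v0) / 2)) as (v & Hv & Hb).
{ intros n. unfold s; cbn [P pow].
  replace (ns_sub _ _) with (ns_scal (/ 2 * (/ 2) ^ n) (ns_sub (f (r n)) v0)) by (vec; field).
  rewrite nm_scal. assert (Hp : 0 < (/ 2) ^ n) by (apply pow_lt; lra).
  rewrite Rabs_pos_eq by lra.
  assert (K : ns_norm (ns_sub (f (r n)) v0) <= N + ns_norm v0).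
  { unfold ns_sub. eapply Rle_trans; [apply nm_tri|]. rewrite nm_opp.
    destruct (Hf _ (proj1 (Hr n)) (proj2 (Hr n))) as (_ & K2 & _). lra. }
  apply (Rmult_le_compat_l (/ 2 * (/ 2) ^ n)) in K; [|lra]. lra. }
assert (Gs : forall n, G (s n) = ns_sub z (ns_scal ((/ 2) ^ n) (r n))).
{ assert (GP : forall n, G (P n) = ns_sub z (ns_scal ((/ 2) ^ n) (r n))).
  { induction n as [|n IH]; cbn [P r pow].
    - replace (ns_zero : V) with (ns_scal 0 (ns_zero : V)) by vec. rewrite bl_scal. vec.
    - rewrite bl_add, bl_scal, IH. vec; field. }
  intros n. unfold s. rewrite bl_add, bl_scal, GP, Gv0. vec. }
exists v. split; [apply (HC2 s); auto; intros n; now apply HP|split].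
- replace v with (ns_add (ns_sub v (s 0%nat)) v0) by (unfold s; cbn [P pow]; vec).
  eapply Rle_trans; [apply nm_tri|]. lra.
- assert (E : ns_norm (ns_sub (G v) z) <= 0).
  { destruct (bl_bnd _ _ G) as (M & HM & HG).
    apply Rle_plus_epsilon. intros eps He.
    destruct (Hv (eps / (2 * (M + 1)))) as [N1 HN1]; [apply Rdiv_lt_0_compat; lra|].
    destruct (pow_half_small (eps / 2) (delta / 2)) as [N2 HN2]; [lra|].
    set (n := Nat.max N1 N2). specialize (HN1 n ltac:(lia)). specialize (HN2 n ltac:(lia)).
    eapply Rle_trans; [apply (nm_sub_tri _ (G (s n)))|].
    rewrite (nm_subC (G v)), <- bl_sub.
    generalize (HG (ns_sub (s n) v)). intros K.
    assert (K2 : M * ns_norm (ns_sub (s n) v) <= eps / 2).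
    { apply Rle_trans with ((M + 1) * (eps / (2 * (M + 1)))).
      - apply Rmult_le_compat; try lra. apply nm_ge0.
      - right; field; lra. }
    assert (K3 : ns_norm (ns_sub (G (s n)) z) <= eps / 2).
    { rewrite Gs. replace (ns_sub (ns_sub z (ns_scal ((/ 2) ^ n) (r n))) z) with
        (ns_scal (- (/ 2) ^ n) (r n)) by vec.
      assert (Hp : 0 < (/ 2) ^ n) by (apply pow_lt; lra).
      rewrite nm_scal, Rabs_Ropp, Rabs_pos_eq by lra.
      generalize (proj2 (Hr n)). nra. }
    lra. }
  assert (E0 : ns_sub (G v) z = ns_zero)
    by (apply nm_eq0; generalize (nm_ge0 (ns_sub (G v) z)); lra).
  replace (G v) with (ns_add (ns_sub (G v) z) z) by vec. rewrite E0. vec.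
Qed.

(** By absorption, multiples of the images of bounded parts of [C] cover [W], so Baire makes one of
    them dense in a ball of [W]. Mixing with a point mapped to the opposite side recentres that ball
    at 0, and [bounded_preimage_of_dense] replaces density by equality. *)
Lemma convex_open_mapping {V Z : NSpace} (HV : banach V) (HZ : banach Z)
    (C : V -> Prop) (W : Z -> Prop) (G : BLin V Z) :
  convex_pred C -> Defs.closed_set C -> subspace W -> Defs.closed_set W -> W ns_zero ->
  (forall v, C v -> W (G v)) ->
  (forall z, W z -> exists t v, 0 < t /\ C v /\ G v = ns_scal t z) ->
  exists delta N, 0 < delta /\ forall z, W z -> ns_norm z < delta ->
    exists v, C v /\ ns_norm v <= N /\ G v = z.
Proof.
intros HC1 HC2 HW1 HW2 HW0 HGW Habs.
destruct (Habs ns_zero HW0) as (t0 & v0 & Ht0 & Hv0 & Gv0). rewrite vs_scal0r in Gv0.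
assert (N0 := nm_ge0 v0).
(* For large [n], moving [v] towards [v0] shrinks the factor [t] to exactly [1 / (n + 1)] and keeps
   the norm below [n], so these sets do cover [W]. *)
destruct (baire_closed_set HZ W (fun n z => exists v, C v /\ ns_norm v <= INR n /\
   G v = ns_scal (/ (INR n + 1)) z)) as (n & z0 & d & Wz0 & Hd & Hball); auto.
{ now exists ns_zero. }
{ intros z Hz. destruct (Habs z Hz) as (t & v & Ht & Hv & Gv).
  assert (Nv := nm_ge0 v).
  destruct (INR_archimed 1 (ns_norm v + ns_norm v0 + / t)) as [n Hn]; [lra|].
  assert (Hit : 0 < / t) by (now apply Rinv_0_lt_compat).
  exists n. set (l := / ((INR n + 1) * t)).
  assert (Hm : 1 <= (INR n + 1) * t).
  { apply Rle_trans with (/ t * t); [right; field; lra|apply Rmult_le_compat_r; lra]. }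
  assert (Hl : 0 <= l <= 1).
  { unfold l; split; [left; apply Rinv_0_lt_compat; lra|].
    rewrite <- Rinv_1. apply Rinv_le_contravar; lra. }
  exists (ns_add (ns_scal l v) (ns_scal (1 - l) v0)). split; [now apply HC1|split].
  - eapply Rle_trans; [apply nm_tri|]. rewrite !nm_scal, !Rabs_pos_eq by lra. nra.
  - rewrite bl_add, !bl_scal, Gv, Gv0, vs_scal0r, vs_add0, vs_scalA.
    f_equal. unfold l. field. generalize (pos_INR n); lra. }
set (m := INR n + 1). assert (Hm : 0 < m) by (unfold m; generalize (pos_INR n); lra).
set (w0 := ns_scal (/ m) z0).
destruct (Habs (ns_opp w0)) as (t & v1 & Ht & Hv1 & Gv1).
{ replace (ns_opp w0) with (ns_add (ns_scal (- / m) z0) (ns_scal 0 z0)) by (unfold w0; vec).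
  now apply HW1. }
(* This weight cancels the centre: [a w0 - (1 - a) t w0 = 0]. *)
set (a := t / (1 + t)).
assert (Ha : 0 < a < 1).
{ unfold a; split; [apply Rdiv_lt_0_compat; lra|].
  apply (Rmult_lt_reg_r (1 + t)); [lra|]. field_simplify; lra. }
exists (a * d / m / 2), (INR n + ns_norm v1 + 2 * ns_norm v0).
split; [apply Rdiv_lt_0_compat; [apply Rdiv_lt_0_compat; nra|lra]|].
apply (bounded_preimage_of_dense HV HZ C W G); auto; [apply Rdiv_lt_0_compat; nra|].
intros z Hz Hzd eps He.
destruct (Hball (ns_add (ns_scal (m / a) z) (ns_scal 1 z0))) with (eps := m * eps)
  as (b & (v & Hv & Nv & Gv) & Hb); [now apply HW1| |nra|].
{ replace (ns_sub (ns_add (ns_scal (m / a) z) (ns_scal 1 z0)) z0) with (ns_scal (m / a) z) by vec.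
  rewrite nm_scal, Rabs_pos_eq by (left; apply Rdiv_lt_0_compat; lra).
  apply (Rmult_lt_compat_l (m / a)) in Hzd; [|apply Rdiv_lt_0_compat; lra].
  replace (m / a * (a * d / m)) with d in Hzd by (field; lra). auto. }
exists (ns_add (ns_scal a v) (ns_scal (1 - a) v1)).
split; [apply HC1; auto; lra|split].
- eapply Rle_trans; [apply nm_tri|]. rewrite !nm_scal, !Rabs_pos_eq by lra.
  generalize (nm_ge0 v1) (pos_INR n); nra.
- rewrite bl_add, !bl_scal, Gv, Gv1. fold m.
  replace (ns_sub _ _) with
    (ns_scal (a / m) (ns_sub b (ns_add (ns_scal (m / a) z) (ns_scal 1 z0)))).
  + rewrite nm_scal, Rabs_pos_eq by (left; apply Rdiv_lt_0_compat; lra).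
    apply Rlt_le_trans with (a / m * (m * eps)).
    * apply Rmult_lt_compat_l; [apply Rdiv_lt_0_compat; lra|auto].
    * replace (a / m * (m * eps)) with (a * eps) by (field; lra). nra.
  + unfold w0, a. vec; field; lra.
Qed.

Lemma aff_hull_subspace {V : NSpace} {HV : vspace V} (D : V -> Prop) :
  D ns_zero -> subspace (aff_hull D).
Proof.
intros D0 x y a b (l1 & A1 & A2 & ->) (l2 & B1 & B2 & ->).
set (sc := fun (t : R) (l : list (R * V)) => map (fun c => (t * fst c, snd c)) l).
assert (Hin : forall t l, (forall c, In c l -> D (snd c)) -> forall c, In c (sc t l) -> D (snd c)).
{ intros t l Hl c Hc. apply in_map_iff in Hc. destruct Hc as (c' & <- & Hc'). cbn [snd]. auto. }
(* The origin takes the coefficient that makes the total 1. *)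
exists ((1 - a - b, ns_zero) :: sc a l1 ++ sc b l2). split; [|split].
- intros c [<-|Hc]; [exact D0|]. apply in_app_or in Hc. destruct Hc; eauto.
- cbn [fold_right fst]. rewrite fold_right_app.
  assert (K : forall t l z, fold_right (fun c s => fst c + s) z (sc t l) =
    t * fold_right (fun c s => fst c + s) 0 l + z).
  { intros t l z; induction l as [|c l IH]; simpl in *; [ring|]. rewrite IH; ring. }
  rewrite !K, A2, B2. ring.
- cbn [fold_right fst snd]. rewrite fold_right_app.
  set (g := fun (c : R * V) acc => ns_add (ns_scal (fst c) (snd c)) acc).
  assert (K : forall t l z, fold_right g z (sc t l) =
    ns_add (ns_scal t (fold_right g ns_zero l)) z).
  { intros t l z; induction l as [|c l IH]; cbn [fold_right map sc]; [vec|].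
    unfold sc in *. rewrite IH. unfold g at 1 3. cbn [fst snd]. vec. }
  rewrite !K. vec.
Qed.

Lemma aff_hull_incl {V : NSpace} {HV : vspace V} (D : V -> Prop) z : D z -> aff_hull D z.
Proof.
intros Hz. exists ((1, z) :: nil). split; [intros c [<-|[]]; exact Hz|].
cbn [fold_right fst snd]. split; [ring|vec].
Qed.

(** With 0 in [D], each point of [D] is a difference of points of [D], so the affine hull of [D]
    lies in that of [D - D]. *)
Lemma icr_absorbing {V : NSpace} {HV : vspace V} (D : V -> Prop) z :
  D ns_zero -> icr D ns_zero -> aff_hull D z -> exists t, 0 < t /\ D (ns_scal t z).
Proof.
intros D0 Hicr (l & A1 & A2 & A3).
destruct (Hicr z) as (d & Hd & HD).
- exists l. split; [|now split]. intros c Hc. exists (snd c), ns_zero.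
  split; [auto|split; [auto|vec]].
- exists d. split; [auto|]. specialize (HD d ltac:(lra)).
  now replace (ns_add ns_zero (ns_scal d z)) with (ns_scal d z) in HD by vec.
Qed.

(** Distributes a joint bound over two independent families, one constant for each conjugate. *)
Lemma split_supremum (P Q : R -> Prop) m :
  (exists a, P a) -> (exists b, Q b) -> (forall a b, P a -> Q b -> a + b <= m) ->
  exists s t, (forall a, P a -> a <= s) /\ (forall b, Q b -> b <= t) /\ s + t <= m.
Proof.
intros [a0 Ha0] [b0 Hb0] H.
destruct (completeness P) as [s [S1 S2]]; [|now exists a0|].
- exists (m - b0). intros a Ha. specialize (H a b0 Ha Hb0). lra.
- exists s, (m - s). split; [exact S1|split; [|lra]].
  intros b Hb. assert (s <= m - b); [|lra]. apply S2. intros a Ha. specialize (H a b Ha Hb). lra.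
Qed.

Lemma affine_nonneg c k : (forall t, 0 <= c + t * k) -> k = 0.
Proof.
intros H. destruct (Req_dec k 0) as [|Hk]; [auto|exfalso].
specialize (H (- (c + 1) / k)).
replace (c + - (c + 1) / k * k) with (-1) in H by (field; auto). lra.
Qed.

(** * Exactness under the interiority condition (a) *)

Definition interiority_set {X Y : NSpace} (A : BLin X Y) (HS : nsprod X (Dual X) -> R -> Prop)
    (HT : nsprod Y (Dual Y) -> R -> Prop) (z : nsprod Y (nsprod (Dual Y) (Dual X))) : Prop :=
  exists u xi r1 y ys r2 w vs, HS (u, xi) r1 /\ HT (y, ys) r2 /\
    z = (ns_sub y (A w), (ns_sub ys vs, ns_sub xi (adj A vs))).

Definition data_space (X Y : NSpace) : NSpace :=
  nsprod (nsprod (nsprod X (Dual X)) RS)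
    (nsprod (nsprod (nsprod Y (Dual Y)) RS) (nsprod X (Dual Y))).

Definition constraint_map {X Y : NSpace} (A : BLin X Y) (v : data_space X Y) :
    nsprod Y (nsprod (Dual Y) (Dual X)) :=
  (ns_sub (fst (fst (fst (snd v)))) (A (fst (snd (snd v)))),
   (ns_sub (snd (fst (fst (snd v)))) (snd (snd (snd v))),
    ns_sub (snd (fst (fst v))) (adj A (snd (snd (snd v)))))).

Lemma constraint_map_BLin {X Y : NSpace} {HX : normed X} {HY : normed Y} (A : BLin X Y) :
  exists G : BLin (data_space X Y) (nsprod Y (nsprod (Dual Y) (Dual X))),
    forall v, G v = constraint_map A v.
Proof.
destruct (bl_bnd _ _ A) as (N1 & HN1 & HA1). destruct (adj_le A) as (N2 & HN2 & HA2).
assert (Hadd : forall x y : data_space X Y,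
  constraint_map A (ns_add x y) = ns_add (constraint_map A x) (constraint_map A y)).
{ intros [[[u xi] r1] [[[y ys] r2] [w vs]]] [[[u' xi'] r1'] [[[y' ys'] r2'] [w' vs']]].
  change ((ns_sub (ns_add y y') (A (ns_add w w')), (ns_sub (ns_add ys ys') (ns_add vs vs'),
     ns_sub (ns_add xi xi') (adj A (ns_add vs vs')))) =
    (ns_add (ns_sub y (A w)) (ns_sub y' (A w')), (ns_add (ns_sub ys vs) (ns_sub ys' vs'),
      ns_add (ns_sub xi (adj A vs)) (ns_sub xi' (adj A vs'))))).
  rewrite bl_add, adj_add. f_equal; [|f_equal]; vec. }
assert (Hscal : forall a (x : data_space X Y),
  constraint_map A (ns_scal a x) = ns_scal a (constraint_map A x)).
{ intros a [[[u xi] r1] [[[y ys] r2] [w vs]]].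
  change ((ns_sub (ns_scal a y) (A (ns_scal a w)), (ns_sub (ns_scal a ys) (ns_scal a vs),
     ns_sub (ns_scal a xi) (adj A (ns_scal a vs)))) =
    (ns_scal a (ns_sub y (A w)), (ns_scal a (ns_sub ys vs),
      ns_scal a (ns_sub xi (adj A vs))))).
  rewrite bl_scal, adj_scal. f_equal; [|f_equal]; vec. }
assert (Hbnd : exists N, 0 <= N /\ forall x : data_space X Y,
  ns_norm (constraint_map A x) <= N * ns_norm x).
{ exists (1 + N1 + N2). split; [lra|]. intros [[[u xi] r1] [[[y ys] r2] [w vs]]].
  change (ns_norm (ns_sub y (A w)) + (ns_norm (ns_sub ys vs) + ns_norm (ns_sub xi (adj A vs))) <=
   (1 + N1 + N2) * (ns_norm u + ns_norm xi + Rabs r1 + (ns_norm y + ns_norm ys + Rabs r2 +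
      (ns_norm w + ns_norm vs)))).
  unfold ns_sub.
  generalize (nm_tri y (ns_opp (A w))) (nm_tri ys (ns_opp vs)) (nm_tri xi (ns_opp (adj A vs))).
  rewrite !nm_opp.
  generalize (HA1 w) (HA2 vs) (nm_ge0 u) (nm_ge0 xi) (Rabs_pos r1) (nm_ge0 y) (nm_ge0 ys)
    (Rabs_pos r2) (nm_ge0 w) (nm_ge0 vs).
  set (n1 := ns_norm u). set (n2 := ns_norm xi). set (n3 := Rabs r1). set (n4 := ns_norm y).
  set (n5 := ns_norm ys). set (n6 := Rabs r2). set (n7 := ns_norm w). set (n8 := ns_norm vs).
  intros. assert (0 <= N1 * (n1 + n2 + n3 + n4 + n5 + n6 + n8)) by (apply Rmult_le_pos; lra).
  assert (0 <= N2 * (n1 + n2 + n3 + n4 + n5 + n6 + n7)) by (apply Rmult_le_pos; lra). lra. }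
now exists (Build_BLin _ _ (constraint_map A) Hadd Hscal Hbnd).
Qed.

Definition in_epigraphs {X Y : NSpace} (HS : nsprod X (Dual X) -> R -> Prop)
    (HT : nsprod Y (Dual Y) -> R -> Prop) (v : data_space X Y) : Prop :=
  HS (fst (fst v)) (snd (fst v)) /\ HT (fst (fst (snd v))) (snd (fst (snd v))).

Lemma epi_closed_seq {X : NSpace} {HX : normed X} (H : nsprod X (Dual X) -> R -> Prop)
    (u : nat -> nsprod (nsprod X (Dual X)) RS) p :
  epi_closed H -> (forall n, H (fst (u n)) (snd (u n))) -> seq_conv u p -> H (fst p) (snd p).
Proof.
intros Hc Hu Hp. destruct p as [[x xs] r]. cbn [fst snd]. apply Hc. intros eps He.
destruct (Hp eps He) as [N HN]. specialize (HN N (le_n N)). specialize (Hu N).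
destruct (u N) as [[y ys] s]. cbn [fst snd] in Hu. exists y, ys, s. split; [auto|].
change (ns_norm (ns_sub y x) + ns_norm (ns_sub ys xs) + Rabs (s + - r) < eps) in HN.
generalize (nm_ge0 (ns_sub y x)) (nm_ge0 (ns_sub ys xs)) (Rabs_pos (s + - r)) (Rle_abs (s + - r)).
lra.
Qed.

(** Minimize [r1 + r2 - <xs, u + w> - <xx, A^* vs> + m] over [data_space] under
    [constraint_map = 0]; the value is nonnegative by [Hm]. Open mapping bounds the perturbed value,
    and the multiplier [(al, be, ga)], with signs changed, gives [vs], [vv] and [uu] of the dual
    pair. *)
Lemma conjugate_exact_interior {X Y : NSpace} (HX : banach X) (HY : banach Y) (A : BLin X Y)
    (HS : nsprod X (Dual X) -> R -> Prop) (HT : nsprod Y (Dual Y) -> R -> Prop) :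
  convex_rel HS -> epi_closed HS -> convex_rel HT -> epi_closed HT ->
  interiority_set A HS HT ns_zero -> ic_mem (interiority_set A HS HT) ns_zero ->
  conjugate_exact A HS HT.
Proof.
intros HS1 HS2 HT1 HT2 D0 [HD1 HD2] xs xx m zz Hm Hzz.
set (Z := nsprod Y (nsprod (Dual Y) (Dual X))) in *.
assert (HV : banach (data_space X Y)) by (unfold data_space; exact _).
assert (HZ : banach Z) by (unfold Z; exact _).
set (D := interiority_set A HS HT) in *.
destruct (constraint_map_BLin A) as [G HG].
assert (GD : forall v, in_epigraphs HS HT v -> D (G v)).
{ intros [[[u xi] r1] [[[y ys] r2] [w vs]]] [K1 K2]. rewrite HG.
  exists u, xi, r1, y, ys, r2, w, vs. now split. }
destruct (convex_open_mapping HV HZ (in_epigraphs HS HT) (aff_hull D) G)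
  as (delta & N & Hd & Hopen).
- intros v v' l Hl [K1 K2] [K3 K4]. split.
  + exact (HS1 _ _ _ _ _ Hl K1 K3).
  + exact (HT1 _ _ _ _ _ Hl K2 K4).
- intros u p Hu Hp. split.
  + apply (epi_closed_seq HS (fun n => fst (u n))); [auto|intros; apply Hu|].
    unfold data_space in *. now apply seq_conv_fst.
  + apply (epi_closed_seq HT (fun n => fst (snd (u n)))); [auto|intros; apply Hu|].
    unfold data_space in *.
    apply (seq_conv_fst (fun n => snd (u n)) (snd p)). now apply seq_conv_snd.
- now apply aff_hull_subspace.
- exact HD1.
- now apply aff_hull_incl.
- intros v Hv. apply aff_hull_incl. now apply GD.
- intros z Hz. destruct (icr_absorbing D z D0 HD2 Hz) as (t & Ht & Hz').
  destruct Hz' as (u & xi & r1 & y & ys & r2 & w & vs & K1 & K2 & K3).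
  exists t, ((((u, xi), r1), (((y, ys), r2), (w, vs))) : data_space X Y).
  split; [auto|split; [now split|]]. rewrite HG. exact (eq_sym K3).
- destruct (adj_le A) as (NA & HNA & HA).
  assert (HN' : 0 <= N).
  { destruct (Hopen ns_zero) as (v & _ & K & _); [now apply aff_hull_incl|now rewrite nm_zero|].
    generalize (nm_ge0 v); lra. }
  (* The upper bound estimates this objective on data of norm at most [N], which open mapping
     provides for every perturbation in the affine hull of norm below [delta]; [NA] bounds [A^*]. *)
  destruct (lagrange_multiplier Z (fun z r => exists u xi r1 y ys r2 w vs,
    HS (u, xi) r1 /\ HT (y, ys) r2 /\
    z = (ns_sub y (A w), (ns_sub ys vs, ns_sub xi (adj A vs))) /\
    r1 + r2 - dapp xs u - dapp xs w - dapp xx (adj A vs) + m <= r) delta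
    (2 * N + 2 * (ns_norm xs * N) + ns_norm xx * (NA * N) + m)) as (L & C & HL & HC & Hb & HK).
  + intros z1 t1 z2 t2 l Hl (u & xi & r1 & y & ys & r2 & w & vs & A1 & A2 & -> & A3)
      (u' & xi' & r1' & y' & ys' & r2' & w' & vs' & B1 & B2 & -> & B3).
    exists (ns_add (ns_scal l u) (ns_scal (1 - l) u')),
      (ns_add (ns_scal l xi) (ns_scal (1 - l) xi')), (l * r1 + (1 - l) * r1'),
      (ns_add (ns_scal l y) (ns_scal (1 - l) y')),
      (ns_add (ns_scal l ys) (ns_scal (1 - l) ys')), (l * r2 + (1 - l) * r2'),
      (ns_add (ns_scal l w) (ns_scal (1 - l) w')), (ns_add (ns_scal l vs) (ns_scal (1 - l) vs')).
    split; [exact (HS1 _ _ _ _ _ Hl A1 B1)|split; [exact (HT1 _ _ _ _ _ Hl A2 B2)|split]].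
    * transitivity (ns_add (ns_scal l (ns_sub y (A w))) (ns_scal (1 - l) (ns_sub y' (A w'))),
        (ns_add (ns_scal l (ns_sub ys vs)) (ns_scal (1 - l) (ns_sub ys' vs')),
         ns_add (ns_scal l (ns_sub xi (adj A vs))) (ns_scal (1 - l) (ns_sub xi' (adj A vs')))));
        [reflexivity|].
      rewrite bl_add, !bl_scal, adj_add, !adj_scal. f_equal; [|f_equal]; vec.
    * rewrite adj_add, !adj_scal. linall.
      apply (Rmult_le_compat_l l) in A3; [|lra].
      apply (Rmult_le_compat_l (1 - l)) in B3; lra.
  + intros r (u & xi & r1 & y & ys & r2 & w & vs & A1 & A2 & E & A3).
    assert (E1 : ns_zero = ns_sub y (A w)) by exact (f_equal fst E).
    assert (E2 : ns_zero = ns_sub ys vs) by exact (f_equal (fun p => fst (snd p)) E).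
    assert (E3 : ns_zero = ns_sub xi (adj A vs)) by exact (f_equal (fun p => snd (snd p)) E).
    assert (F1 : A w = y).
    { replace y with (ns_add (ns_sub y (A w)) (A w)) by vec. rewrite <- E1. vec. }
    assert (F2 : vs = ys).
    { replace ys with (ns_add (ns_sub ys vs) vs) by vec. rewrite <- E2. vec. }
    assert (F3 : adj A vs = xi).
    { replace xi with (ns_add (ns_sub xi (adj A vs)) (adj A vs)) by vec. rewrite <- E3. vec. }
    generalize (Hm (ns_add u w) xi (r1 + r2)). intros K. assert (K' : _) by
      (apply K; exists u, w, vs, r1, r2; cbn [fst snd]; rewrite F3, F1, F2; repeat split; auto; lra).
    rewrite dapp_addr in K'. rewrite F3 in A3. lra.
  + exact Hd.
  + intros e r t (u & xi & r1 & y & ys & r2 & w & vs & A1 & A2 & E & _) Hlt.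
    destruct (Hopen (ns_scal t e)) as (v & [V1 V2] & V3 & V4); [|exact Hlt|].
    { replace (ns_scal t e) with (ns_add (ns_scal t e) (ns_scal 0 e)) by vec.
      assert (We : aff_hull D e)
        by (apply aff_hull_incl; exists u, xi, r1, y, ys, r2, w, vs; now split).
      now apply aff_hull_subspace. }
    rewrite HG in V4. destruct v as [[[u' xi'] r1'] [[[y' ys'] r2'] [w' vs']]].
    cbn [fst snd] in V1, V2.
    change (ns_norm u' + ns_norm xi' + Rabs r1' + (ns_norm y' + ns_norm ys' + Rabs r2' +
      (ns_norm w' + ns_norm vs')) <= N) in V3.
    exists (r1' + r2' - dapp xs u' - dapp xs w' - dapp xx (adj A vs') + m). split.
    * generalize (nm_ge0 u') (nm_ge0 xi') (Rabs_pos r1') (nm_ge0 y') (nm_ge0 ys')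
        (Rabs_pos r2') (nm_ge0 w') (nm_ge0 vs') (Rle_abs r1') (Rle_abs r2')
        (dapp_lb xs u') (dapp_lb xs w') (dapp_lb xx (adj A vs')).
      intros.
      assert (ns_norm xs * ns_norm u' <= ns_norm xs * N)
        by (apply Rmult_le_compat_l; [apply nm_ge0|lra]).
      assert (ns_norm xs * ns_norm w' <= ns_norm xs * N)
        by (apply Rmult_le_compat_l; [apply nm_ge0|lra]).
      assert (ns_norm xx * ns_norm (adj A vs') <= ns_norm xx * (NA * N)).
      { apply Rmult_le_compat_l; [apply nm_ge0|]. eapply Rle_trans; [apply HA|].
        apply Rmult_le_compat_l; lra. }
      lra.
    * exists u', xi', r1', y', ys', r2', w', vs'.
      split; [auto|split; [auto|split; [|lra]]]. now rewrite <- V4.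
  + destruct (dual_of_prod L C HL HC Hb) as (al & th & Hth).
    destruct (dual_of_prod (fun e => dapp th e) (ns_norm th)) as (be & ga & Hbg).
    { split; intros; linall; ring. }
    { apply nm_ge0. }
    { intros e; apply dapp_le. }
    assert (key : forall u xi r1 y ys r2 w vs, HS (u, xi) r1 -> HT (y, ys) r2 ->
      0 <= dapp al y - dapp al (A w) + (dapp be ys - dapp be vs + (dapp ga xi - dapp ga (adj A vs)))
       + (r1 + r2 - dapp xs u - dapp xs w - dapp xx (adj A vs) + m)).
    { intros u xi r1 y ys r2 w vs K1 K2.
      generalize (HK (ns_sub y (A w), (ns_sub ys vs, ns_sub xi (adj A vs)))
        (r1 + r2 - dapp xs u - dapp xs w - dapp xx (adj A vs) + m)).
      intros K. assert (K' : _) by (apply K; exists u, xi, r1, y, ys, r2, w, vs;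
        repeat split; auto; lra).
      rewrite Hth, Hbg in K'. revert K'. linall. lra. }
    destruct D0 as (u0 & xi0 & r10 & y0 & ys0 & r20 & _ & _ & B1 & B2 & _).
    (* The variables [w] and [vs] range over whole spaces, so an affine lower bound forces their
       coefficients to vanish: [F1] gives the condition on [A^*], [F2] the one on the biadjoint. *)
    assert (F1 : forall w, dapp al (A w) + dapp xs w = 0).
    { intros w. apply affine_nonneg with
        (dapp al y0 + dapp be ys0 + dapp ga xi0 + (r10 + r20 - dapp xs u0 + m)).
      intros t. generalize (key _ _ _ _ _ _ (ns_scal (- t) w) ns_zero B1 B2).
      rewrite bl_scal. linall.
      replace (adj A ns_zero) with (ns_zero : Dual X) by (apply dual_ext; reflexivity).
      linall. lra. }
    assert (F2 : forall vs, dapp be vs + dapp ga (adj A vs) + dapp xx (adj A vs) = 0).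
    { intros vs. apply affine_nonneg with
        (dapp al y0 + dapp be ys0 + dapp ga xi0 + (r10 + r20 - dapp xs u0 + m)).
      intros t. generalize (key _ _ _ _ _ _ ns_zero (ns_scal (- t) vs) B1 B2).
      rewrite bl_zero.
      rewrite adj_scal. linall. lra. }
    destruct (split_supremum
      (fun a => exists u xi r, HS (u, xi) r /\ a = dapp xs u - dapp ga xi - r)
      (fun b => exists y ys r, HT (y, ys) r /\ b = - dapp al y - dapp be ys - r) m)
      as (s & t & S1 & S2 & S3).
    { eexists; exists u0, xi0, r10; split; [auto|reflexivity]. }
    { eexists; exists y0, ys0, r20; split; [auto|reflexivity]. }
    { intros a b (u & xi & r & K1 & ->) (y & ys & r' & K2 & ->).
      generalize (key _ _ _ _ _ _ ns_zero ns_zero K1 K2).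
      rewrite bl_zero.
      replace (adj A ns_zero) with (ns_zero : Dual X) by (apply dual_ext; reflexivity).
      linall. lra. }
    exists (ns_opp ga), (ns_opp al), (ns_opp be), s, t. split; [|split; [|split; [|split]]].
    * intros y ys r Hr. rewrite dapp_oppl. generalize (S1 _ (ex_intro _ y (ex_intro _ ys
        (ex_intro _ r (conj Hr eq_refl))))). lra.
    * intros y ys r Hr. rewrite !dapp_oppl. generalize (S2 _ (ex_intro _ y (ex_intro _ ys
        (ex_intro _ r (conj Hr eq_refl))))). lra.
    * apply dual_ext. intros w. rewrite adjE, dapp_oppl. generalize (F1 w). lra.
    * intros g. rewrite Hzz, !dapp_oppl. generalize (F2 g). lra.
    * exact S3.
Qed.


(** * Extended-real-valued functions and their epigraphs *)

Lemma ER_sup_lub (E : ER -> Prop) : ER_is_lub E (ER_sup E).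
Proof.
unfold ER_sup. apply epsilon_spec.
destruct (classic (exists B, forall e, E e -> ER_le e (ERfin B))) as [[B HB]|Hn].
- destruct (classic (exists x, E (ERfin x))) as [[x Hx]|Hx].
  + destruct (completeness (fun x => E (ERfin x))) as [s [S1 S2]].
    * exists B. intros y Hy. exact (HB _ Hy).
    * now exists x.
    * exists (ERfin s). split.
      -- intros [y| |] He; simpl; [now apply S1|exact (HB _ He)|easy].
      -- intros [t| |] Ht; simpl; auto; [|exact (Ht _ Hx)].
         apply S2. intros y Hy. exact (Ht _ Hy).
  + exists ERminf. split.
    * intros [y| |] He; simpl; auto; [exfalso; eauto|exact (HB _ He)].
    * intros [t| |] _; simpl; auto.
- exists ERpinf. split; [intros [y| |] _; simpl; auto|].
  intros [t| |] Ht; simpl; auto; apply Hn.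
  + now exists t.
  + exists 0. intros e He. specialize (Ht e He). destruct e; simpl in *; tauto.
Qed.

Lemma ER_inf_glb (E : ER -> Prop) : ER_is_glb E (ER_inf E).
Proof.
unfold ER_inf. apply epsilon_spec.
destruct (ER_sup_lub (fun t => forall e, E e -> ER_le t e)) as [H1 H2].
exists (ER_sup (fun t => forall e, E e -> ER_le t e)). split; auto.
Qed.

Lemma ER_le_trans a b c : ER_le a b -> ER_le b c -> ER_le a c.
Proof. destruct a, b, c; simpl; auto; try tauto. lra. Qed.

Lemma ER_le_fin_char c e : (forall s, ER_le e (ERfin s) -> c <= s) -> ER_le (ERfin c) e.
Proof.
destruct e as [y| |]; simpl; intros H; auto; [apply H; lra|].
specialize (H (c - 1) I). lra.
Qed.

Lemma ER_le_eps e r : (forall eps, 0 < eps -> ER_le e (ERfin (r + eps))) -> ER_le e (ERfin r).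
Proof.
destruct e as [y| |]; simpl; intros H; auto; [|exact (H 1 Rlt_0_1)].
now apply Rle_plus_epsilon.
Qed.

Lemma ER_not_le e r : ~ ER_le e (ERfin r) -> ER_le (ERfin r) e.
Proof. destruct e; simpl; auto; try tauto. lra. Qed.

Lemma ER_inf_le (E : ER -> Prop) r eps : ER_le (ER_inf E) (ERfin r) -> 0 < eps ->
  exists e, E e /\ ER_le e (ERfin (r + eps)).
Proof.
intros H He. apply NNPP; intros Hno.
assert (K : ER_le (ERfin (r + eps)) (ER_inf E)).
{ apply (proj2 (ER_inf_glb E)). intros e HE. apply ER_not_le. intros H1. apply Hno; eauto. }
generalize (ER_le_trans _ _ _ K H). simpl. lra.
Qed.

Lemma ER_plus_le a b s t r : ER_le a (ERfin s) -> ER_le b (ERfin t) -> s + t <= r ->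
  ER_le (ER_plus a b) (ERfin r).
Proof. destruct a, b; simpl; try tauto. lra. Qed.

Lemma ER_plus_le_inv a b r : a <> ERminf -> b <> ERminf -> ER_le (ER_plus a b) (ERfin r) ->
  exists s t, ER_le a (ERfin s) /\ ER_le b (ERfin t) /\ s + t <= r.
Proof.
destruct a as [s| |], b as [t| |]; simpl; try tauto.
intros _ _ H. exists s, t. repeat split; lra.
Qed.

Lemma ER_fin_ub e : e <> ERpinf -> exists r, ER_le e (ERfin r).
Proof. destruct e as [r| |]; intros H; [exists r; apply Rle_refl|easy|now exists 0]. Qed.

Lemma ER_fin_lb e c : ER_le (ERfin c) e -> e <> ERminf.
Proof. intros H ->. exact H. Qed.

Definition epi {X : NSpace} (h : EFun X) : nsprod X (Dual X) -> R -> Prop :=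
  fun p r => ER_le (h (fst p) (snd p)) (ERfin r).

Lemma conjugate_le {X : NSpace} (h : EFun X) xs xx s :
  ER_le (conjugate h xs xx) (ERfin s) <-> conj_le (epi h) xs xx s.
Proof.
unfold conjugate. set (E := fun e => exists x ys, _).
destruct (ER_sup_lub E) as [H1 H2]. split.
- intros H y ys r Hr. unfold epi in Hr; cbn [fst snd] in Hr.
  assert (K : ER_le (ER_sub (dapp xs y + dapp xx ys) (h y ys)) (ERfin s)).
  { eapply ER_le_trans; [apply H1; now exists y, ys|exact H]. }
  destruct (h y ys); simpl in *; try tauto. lra.
- intros H. apply H2. intros e (y & ys & ->). specialize (H y ys). unfold epi in H; cbn [fst snd] in H.
  destruct (h y ys) as [v| |]; simpl in *; auto.
  + apply H. lra.
  (* At a value -oo the epigraph contains every height, in particular the one that would give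
     [s + 1 <= s]. *)
  + specialize (H (dapp xs y + dapp xx ys - s - 1) I). lra.
Qed.

Lemma conjugate_proper {X : NSpace} (h : EFun X) xs xx :
  (exists p r, epi h p r) -> conjugate h xs xx <> ERminf.
Proof.
intros ([y ys] & r & Hr) E.
assert (K : ER_le (conjugate h xs xx) (ERfin (dapp xs y + dapp xx ys - r - 1))) by now rewrite E.
apply conjugate_le in K. specialize (K y ys r Hr). lra.
Qed.

Lemma inv_INR_pos n : 0 < / (INR n + 1).
Proof. apply Rinv_0_lt_compat. generalize (pos_INR n). lra. Qed.

Lemma inv_INR_small eps : 0 < eps -> exists N, forall n, (N <= n)%nat -> / (INR n + 1) < eps.
Proof.
intros He. destruct (archimed_cor1 eps He) as (N & HN & HN0). exists N. intros n Hn.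
eapply Rle_lt_trans; [|exact HN]. apply le_INR in Hn. apply lt_INR in HN0. simpl in HN0.
apply Rinv_le_contravar; lra.
Qed.

Lemma seq_conv_inv {V : NSpace} (u : nat -> V) l :
  (forall n, ns_norm (ns_sub (u n) l) < / (INR n + 1)) -> seq_conv u l.
Proof.
intros H eps He. destruct (inv_INR_small eps He) as [N HN]. exists N. intros n Hn.
eapply Rlt_trans; [apply H|auto].
Qed.

Lemma strong_rep_epi {X : NSpace} (S : Op X) (h : EFun X) :
  strong_rep S h -> strong_epi (epi h).
Proof.
intros [(H1 & H2 & H3 & _) H4]. split; [|split; [|split]].
- intros [x xs] r [y ys] s l Hl Hx Hy. exact (H1 _ _ _ _ _ _ _ Hl Hx Hy).
- intros x xs r H. apply ER_le_eps. intros eps He.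
  (* Lower semicontinuity speaks of sequences in one sublevel set, so the level [r + eps] is fixed
     and only the distances go to 0. *)
  assert (K : forall n : nat, exists q : X * Dual X, ER_le (h (fst q) (snd q)) (ERfin (r + eps)) /\
     ns_norm (ns_sub (fst q) x) < / (INR n + 1) /\ ns_norm (ns_sub (snd q) xs) < / (INR n + 1)).
  { intros n. destruct (H (Rmin eps (/ (INR n + 1)))) as (y & ys & s & K1 & K2 & K3 & K4).
    { apply Rmin_pos; [auto|apply inv_INR_pos]. }
    generalize (Rmin_l eps (/ (INR n + 1))) (Rmin_r eps (/ (INR n + 1))). intros.
    exists (y, ys). cbn [fst snd]. split; [|lra].
    eapply ER_le_trans; [exact K1|]. simpl; lra. }
  destruct (choice _ K) as [q Hq].
  apply (H2 _ (fun n => fst (q n)) (fun n => snd (q n))).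
  + intros n; apply Hq.
  + apply seq_conv_inv; intros n; apply Hq.
  + apply seq_conv_inv; intros n; apply Hq.
- intros x xs r H. exact (ER_le_trans _ _ _ (H3 x xs) H).
- intros xs xx s H. apply conjugate_le in H. exact (ER_le_trans _ _ _ (H4 xs xx) H).
Qed.

(** * The closed epigraph of the infimal convolution *)

Definition epi_closure {X : NSpace} (K : nsprod X (Dual X) -> R -> Prop) :
    nsprod X (Dual X) -> R -> Prop :=
  fun p r => forall eps, 0 < eps -> exists y ys s, K (y, ys) s /\
    ns_norm (ns_sub y (fst p)) < eps /\ ns_norm (ns_sub ys (snd p)) < eps /\ s < r + eps.

Lemma epi_closure_incl {X : NSpace} {HX : normed X} (K : nsprod X (Dual X) -> R -> Prop) x xs r :
  K (x, xs) r -> epi_closure K (x, xs) r.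
Proof.
intros H eps He. exists x, xs, r. cbn [fst snd]. rewrite !nm_sub_zero.
repeat split; auto; lra.
Qed.

Lemma epi_closure_closed {X : NSpace} {HX : normed X} (K : nsprod X (Dual X) -> R -> Prop) :
  epi_closed (epi_closure K).
Proof.
intros x xs r H eps He. destruct (H (eps / 2)) as (y & ys & s & H1 & H2 & H3 & H4); [lra|].
destruct (H1 (eps / 2)) as (z & zs & t & K1 & K2 & K3 & K4); [lra|].
cbn [fst snd] in *. exists z, zs, t. split; [auto|].
generalize (nm_sub_tri z y x) (nm_sub_tri zs ys xs). lra.
Qed.

Lemma nm_sub_convex {V : NSpace} {HV : normed V} (y y' x x' : V) l eps : 0 <= l <= 1 ->
  ns_norm (ns_sub y x) < eps -> ns_norm (ns_sub y' x') < eps ->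
  ns_norm (ns_sub (ns_add (ns_scal l y) (ns_scal (1 - l) y'))
    (ns_add (ns_scal l x) (ns_scal (1 - l) x'))) < eps.
Proof.
intros Hl H1 H2.
replace (ns_sub _ _) with (ns_add (ns_scal l (ns_sub y x)) (ns_scal (1 - l) (ns_sub y' x'))) by vec.
eapply Rle_lt_trans; [apply nm_tri|]. rewrite !nm_scal, !Rabs_pos_eq by lra.
destruct (Req_dec l 0) as [->|Hz]; nra.
Qed.

Lemma epi_closure_convex {X : NSpace} {HX : normed X} (K : nsprod X (Dual X) -> R -> Prop) :
  convex_rel K -> convex_rel (epi_closure K).
Proof.
intros HK [x xs] r [x' xs'] r' l Hl H H' eps He.
destruct (H eps He) as (y & ys & s & A1 & A2 & A3 & A4).
destruct (H' eps He) as (y' & ys' & s' & B1 & B2 & B3 & B4).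
cbn [fst snd] in *.
exists (ns_add (ns_scal l y) (ns_scal (1 - l) y')), (ns_add (ns_scal l ys) (ns_scal (1 - l) ys')),
  (l * s + (1 - l) * s').
split; [exact (HK _ _ _ _ _ Hl A1 B1)|split; [|split]].
- exact (nm_sub_convex _ _ _ _ _ _ Hl A2 B2).
- exact (nm_sub_convex _ _ _ _ _ _ Hl A3 B3).
- destruct (Req_dec l 0) as [->|Hz]; nra.
Qed.

Lemma epi_closure_above {X : NSpace} {HX : normed X} (K : nsprod X (Dual X) -> R -> Prop) :
  above_coupling K -> above_coupling (epi_closure K).
Proof.
intros HK x xs r H. apply Rle_plus_epsilon. intros eps He.
destruct (coupling_continuous x xs (eps / 2)) as (d & Hd & Hc); [lra|].
destruct (H (Rmin d (eps / 2))) as (y & ys & s & A1 & A2 & A3 & A4); [apply Rmin_pos; lra|].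
cbn [fst snd] in *. generalize (Rmin_l d (eps / 2)) (Rmin_r d (eps / 2)). intros.
specialize (Hc y ys ltac:(lra) ltac:(lra)). apply Rabs_def2 in Hc. apply HK in A1. lra.
Qed.

Lemma inf_conv_convex {X Y : NSpace} {HX : vspace X} {HY : vspace Y} (A : BLin X Y)
    (HS : nsprod X (Dual X) -> R -> Prop) (HT : nsprod Y (Dual Y) -> R -> Prop) :
  convex_rel HS -> convex_rel HT -> convex_rel (inf_conv A HS HT).
Proof.
intros HS1 HT1 [x xs] r [x' xs'] r' l Hl (u & w & vs & s & t & A1 & A2 & A3 & A4 & A5)
  (u' & w' & vs' & s' & t' & B1 & B2 & B3 & B4 & B5).
cbn [fst snd] in *. subst x xs x' xs'.
exists (ns_add (ns_scal l u) (ns_scal (1 - l) u')), (ns_add (ns_scal l w) (ns_scal (1 - l) w')),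
 (ns_add (ns_scal l vs) (ns_scal (1 - l) vs')), (l * s + (1 - l) * s'), (l * t + (1 - l) * t').
rewrite !prod_scalE, prod_addE, adj_add, !adj_scal, bl_add, !bl_scal.
split; [|split; [|split; [|split]]].
- cbn [fst]. change (ns_add (ns_scal l (ns_add u w)) (ns_scal (1 - l) (ns_add u' w')) =
   ns_add (ns_add (ns_scal l u) (ns_scal (1 - l) u')) (ns_add (ns_scal l w) (ns_scal (1 - l) w'))).
  vec.
- reflexivity.
- exact (HS1 _ _ _ _ _ Hl A3 B3).
- exact (HT1 _ _ _ _ _ Hl A4 B4).
- apply (Rmult_le_compat_l l) in A5; [|lra]. apply (Rmult_le_compat_l (1 - l)) in B5; lra.
Qed.

Lemma inf_conv_above {X Y : NSpace} (A : BLin X Y)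
    (HS : nsprod X (Dual X) -> R -> Prop) (HT : nsprod Y (Dual Y) -> R -> Prop) :
  above_coupling HS -> above_coupling HT -> above_coupling (inf_conv A HS HT).
Proof.
intros HS1 HT1 x xs r (u & w & vs & s & t & A1 & A2 & A3 & A4 & A5). cbn [fst snd] in *.
apply HS1 in A3. apply HT1 in A4. rewrite A1, dapp_addr. rewrite A2 in *.
rewrite (adjE A vs w). lra.
Qed.

(** Three infima or limits are approximated, each within [eps / 4]: the closure, the sequence of
    heights, and the convolution. Excluding -oo lets the extended sum be split into two finite
    heights. *)
Lemma norm_closure_infconv_epi {X Y : NSpace} (A : BLin X Y) (hS : EFun X) (hT : EFun Y) x xs r :
  (forall x xs, hS x xs <> ERminf) -> (forall y ys, hT y ys <> ERminf) ->
  epi (norm_closure (infconv A hS hT)) (x, xs) r <->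
  epi_closure (inf_conv A (epi hS) (epi hT)) (x, xs) r.
Proof.
intros PS PT. unfold epi at 1. cbn [fst snd]. split.
- intros H eps He.
  destruct (ER_inf_le _ _ (eps / 4) H) as (e & (r' & -> & xn & xsn & rn & K1 & K2 & K3 & K4) & Hr');
    [lra|]. simpl in Hr'.
  destruct (K2 eps He) as [N1 HN1]. destruct (K3 eps He) as [N2 HN2].
  destruct (K4 (eps / 4)) as [N3 HN3]; [lra|].
  set (n := Nat.max N1 (Nat.max N2 N3)).
  specialize (HN1 n ltac:(lia)). specialize (HN2 n ltac:(lia)). specialize (HN3 n ltac:(lia)).
  unfold Rdist in HN3. apply Rabs_def2 in HN3.
  destruct (ER_inf_le _ _ (eps / 4) (K1 n)) as (e & (u & w & vs & E1 & E2 & ->) & He'); [lra|].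
  apply ER_plus_le_inv in He'; auto. destruct He' as (s & t & S1 & S2 & S3).
  exists (xn n), (xsn n), (s + t). cbn [fst snd].
  split; [|repeat split; auto; lra].
  exists u, w, vs, s, t. cbn [fst snd]. repeat split; auto. lra.
- intros H.
  assert (K : forall n : nat, exists q : X * Dual X,
     ER_le (infconv A hS hT (fst q) (snd q)) (ERfin (r + / (INR n + 1))) /\
     ns_norm (ns_sub (fst q) x) < / (INR n + 1) /\ ns_norm (ns_sub (snd q) xs) < / (INR n + 1)).
  { intros n. destruct (H _ (inv_INR_pos n)) as (y & ys & s & (u & w & vs & s1 & t1 & A1 & A2 & A3 & A4 & A5)
      & B2 & B3 & B4). cbn [fst snd] in *.
    exists (y, ys). cbn [fst snd]. split; [|auto].
    eapply ER_le_trans; [apply (proj1 (ER_inf_glb _)); exists u, w, vs; repeat split; auto|].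
    apply (ER_plus_le _ _ s1 t1); [exact A3|exact A4|lra]. }
  destruct (choice _ K) as [q Hq].
  apply (proj1 (ER_inf_glb _)). exists r. split; [reflexivity|].
  exists (fun n => fst (q n)), (fun n => snd (q n)), (fun n => r + / (INR n + 1)).
  split; [intros n; apply Hq|split; [|split]].
  + apply seq_conv_inv; intros n; apply Hq.
  + apply seq_conv_inv; intros n; apply Hq.
  + intros eps He. destruct (inv_INR_small eps He) as [N HN]. exists N. intros n Hn.
    unfold Rdist. replace (r + / (INR n + 1) - r) with (/ (INR n + 1)) by ring.
    rewrite Rabs_pos_eq by (left; apply inv_INR_pos). auto.
Qed.

(** * Exactness from (b) or (a), and the contact set of the closure *)

Lemma biadjoint_ex {X Y : NSpace} {HX : normed X} {HY : normed Y} (A : BLin X Y)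
    (xx : Dual (Dual X)) :
  exists zz : Dual (Dual Y), forall g, dapp zz g = dapp xx (adj A g).
Proof.
destruct (adj_le A) as (NA & HNA & HA).
apply (@dual_of_linear (Dual Y) (fun g => dapp xx (adj A g)) (ns_norm xx * NA)).
- split; intros; rewrite ?adj_add, ?adj_scal; linall; ring.
- apply Rmult_le_pos; [apply nm_ge0|auto].
- intros g. eapply Rle_trans; [apply dapp_le|]. rewrite Rmult_assoc.
  apply Rmult_le_compat_l; [apply nm_ge0|auto].
Qed.

(** Provides the affine minorant required for biconjugation: the tangent at a contact point. *)
Lemma strong_epi_conj_proper {X : NSpace} (HX : banach X) (H : nsprod X (Dual X) -> R -> Prop) :
  strong_epi H -> exists zs zz s, conj_le H zs zz s.
Proof.
intros HH. destruct (contact_nonempty H HH) as (m & ms & Hm).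
destruct (canon_ex m) as (mm & Hmm & _). exists ms, mm, (dapp ms m).
apply contact_minorant; auto; apply HH.
Qed.

Lemma conjugate_exact_of_cond_b {X Y : NSpace} (HX : banach X) (HY : banach Y) (A : BLin X Y)
    (hS : EFun X) (hT : EFun Y) :
  strong_epi (epi hS) -> strong_epi (epi hT) ->
  (exists p r, inf_conv A (epi hS) (epi hT) p r) ->
  cond_b A hS hT -> conjugate_exact A (epi hS) (epi hT).
Proof.
intros ES ET Hne Hb xs xx m zz Hm Hzz.
assert (PS := strong_epi_conj_proper HX _ ES). assert (PT := strong_epi_conj_proper HY _ ET).
assert (Hdense := dual_pair_weak_star_dense A (epi hS) (epi hT) xs xx m zz
  (proj1 ES) (proj1 (proj2 ES)) PS (proj1 ET) (proj1 (proj2 ET)) PT Hne Hm Hzz).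
assert (HbS : forall us uu, conjugate hS us uu <> ERminf).
{ intros; apply conjugate_proper. destruct Hne as (p & r & u & w & vs & s & t & _ & _ & K & _).
  now exists (u, snd p), s. }
assert (HbT : forall us uu, conjugate hT us uu <> ERminf).
{ intros; apply conjugate_proper.
  destruct Hne as (p & r & u & w & vs & s & t & _ & _ & _ & K & _).
  now exists (A w, vs), t. }
(* [Some q] tests the three weak* coordinates jointly and [None] the height; a triple with two zero
   entries later isolates one coordinate. *)
destruct (net_of_finite_approximations (Bpt X Y) (option (X * (X * Dual Y)))
  (cond_b_set A hS hT)
  (fun j p => match j with
    | Some q => triple_eval q (fst (fst (fst p)), (snd (fst (fst p)), snd (fst p)))
    | None => snd p end)
  (fun j => match j with Some q => triple_eval q (xs, (xs, zz)) | None => m end))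
  as (D & pn & Hgood & Hlim).
{ intros l eps He.
  destruct (Hdense (map (fun o => match o with Some q => q | None => (ns_zero, (ns_zero, ns_zero)) end) l)
    eps He) as (us & bs & z & r & (uu & vs & vv & s & t & A1 & A2 & A3 & A4 & A5) & Hr & Hl).
  exists (us, bs, z, r). split.
  - exists us, uu, vs, vv, z, r. split; [exact A4|split; [|now rewrite A3]].
    apply (ER_plus_le _ _ s t); [now apply conjugate_le|now apply conjugate_le|auto].
  - intros [q|] Hj; [|exact Hr]. apply Hl. apply in_map_iff. now exists (Some q). }
destruct (proj1 (Hb (xs, xs, zz, m))) as [(us & uu & vs & vv & z & r & A1 & A2 & A3) _].
{ split; [|split; [reflexivity|now exists xx]].
  exists D, pn. split; [exact Hgood|split; [|split; [|split]]].
  - intros x eps He. destruct (Hlim (Some (x, (ns_zero, ns_zero))) eps He) as [i0 Hi].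
    exists i0. intros i Hi'. specialize (Hi i Hi'). destruct (pn i) as [[[a' b'] z'] r'].
    unfold triple_eval in Hi; cbn [fst snd] in Hi. rewrite !dapp_zeror, !Rplus_0_r in Hi. exact Hi.
  - intros x eps He. destruct (Hlim (Some (ns_zero, (x, ns_zero))) eps He) as [i0 Hi].
    exists i0. intros i Hi'. specialize (Hi i Hi'). destruct (pn i) as [[[a' b'] z'] r'].
    unfold triple_eval in Hi; cbn [fst snd] in Hi.
    rewrite !dapp_zeror, !Rplus_0_r, !Rplus_0_l in Hi. exact Hi.
  - intros g eps He. destruct (Hlim (Some (ns_zero, (ns_zero, g))) eps He) as [i0 Hi].
    exists i0. intros i Hi'. specialize (Hi i Hi'). destruct (pn i) as [[[a' b'] z'] r'].
    unfold triple_eval in Hi; cbn [fst snd] in Hi.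
    rewrite !dapp_zeror, !Rplus_0_r, !Rplus_0_l in Hi. exact Hi.
  - intros eps He. destruct (Hlim None eps He) as [i0 Hi].
    exists i0. intros i Hi'. specialize (Hi i Hi'). destruct (pn i) as [[[a' b'] z'] r']. exact Hi. }
assert (E1 : xs = us) by exact (f_equal (fun p : Bpt X Y => fst (fst (fst p))) A3).
assert (E2 : xs = adj A vs) by exact (f_equal (fun p : Bpt X Y => snd (fst (fst p))) A3).
assert (E3 : zz = z) by exact (f_equal (fun p : Bpt X Y => snd (fst p)) A3).
assert (E4 : m = r) by exact (f_equal (fun p : Bpt X Y => snd p) A3).
rewrite <- E1, <- E4 in A2. rewrite <- E3 in A1.
apply ER_plus_le_inv in A2; auto. destruct A2 as (s & t & S1 & S2 & S3).
exists uu, vs, vv, s, t. repeat split; auto; now apply conjugate_le.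
Qed.

Lemma conjugate_exact_of_cond_a {X Y : NSpace} (HX : banach X) (HY : banach Y) (A : BLin X Y)
    (hS : EFun X) (hT : EFun Y) :
  strong_epi (epi hS) -> strong_epi (epi hT) ->
  (exists p r, inf_conv A (epi hS) (epi hT) p r) ->
  cond_a A hS hT -> conjugate_exact A (epi hS) (epi hT).
Proof.
intros ES ET (p & r & u0 & w0 & vs0 & s0 & t0 & _ & E0 & K1 & K2 & _) Ha.
apply conjugate_exact_interior; try apply ES; try apply ET; auto.
- exists u0, (snd p), s0, (A w0), vs0, t0, w0, vs0. split; [auto|split; [auto|]].
  rewrite E0. symmetry. pvec.
- unfold cond_a in Ha. cbv zeta in Ha.
  match type of Ha with ic_mem ?P _ => replace (interiority_set A (epi hS) (epi hT)) with P; auto end.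
  apply functional_extensionality. intros z. apply propositional_extensionality. split.
  + intros (y & ys & xi & w & vs & H1 & [u H2] & ->).
    destruct (ER_fin_ub _ H1) as [r2 H1']. destruct (ER_fin_ub _ H2) as [r1 H2'].
    exists u, xi, r1, y, ys, r2, w, vs. split; [exact H2'|split; [exact H1'|reflexivity]].
  + intros (u & xi & r1 & y & ys & r2 & w & vs & H1 & H2 & ->).
    exists y, ys, xi, w, vs. split; [|split; [|reflexivity]].
    * intros E. unfold epi in H2; cbn [fst snd] in H2. now rewrite E in H2.
    * exists u. intros E. unfold epi in H1; cbn [fst snd] in H1. now rewrite E in H1.
Qed.

(** The coupling is additive on an exact dual pair: [<uu, A^* vs> + <vv, vs>] is the biadjoint of
    [xx] at [vs], that is [<xx, xs>]. The strong inequalities of the two summands therefore add up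
    to the one required. *)
Lemma closure_strong_epi {X Y : NSpace} {HX : normed X} {HY : normed Y} (A : BLin X Y)
    (HS : nsprod X (Dual X) -> R -> Prop) (HT : nsprod Y (Dual Y) -> R -> Prop) :
  strong_epi HS -> strong_epi HT -> conjugate_exact A HS HT ->
  strong_epi (epi_closure (inf_conv A HS HT)).
Proof.
intros (S1 & S2 & S3 & S4) (T1 & T2 & T3 & T4) Hex. split; [|split; [|split]].
- apply epi_closure_convex. now apply inf_conv_convex.
- apply epi_closure_closed.
- apply epi_closure_above. now apply inf_conv_above.
- intros xs xx m Hm. destruct (biadjoint_ex A xx) as [zz Hzz].
  destruct (Hex xs xx m zz) as (uu & vs & vv & s & t & A1 & A2 & A3 & A4 & A5); auto.
  { intros y ys r Hr. apply Hm. now apply epi_closure_incl. }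
  apply S4 in A1. apply T4 in A2. rewrite A3 in *. rewrite <- Hzz, A4. lra.
Qed.

Lemma contact_closure_par_sum {X Y : NSpace} {HX : normed X} {HY : normed Y} (A : BLin X Y)
    (S : Op X) (T : Op Y) (HS : nsprod X (Dual X) -> R -> Prop) (HT : nsprod Y (Dual Y) -> R -> Prop) :
  maximal_monotone S -> maximal_monotone T ->
  (forall x xs, S x xs -> contact_set HS x xs) -> (forall y ys, T y ys -> contact_set HT y ys) ->
  (forall xx xs, gossez_cl S xx xs -> exists x : X, canon x xx) ->
  strong_epi HS -> strong_epi HT -> conjugate_exact A HS HT ->
  contact_set (epi_closure (inf_conv A HS HT)) = par_sum A S T.
Proof.
intros [_ MS] [_ MT] CS CT Hdom ES ET Hex.
assert (EH := closure_strong_epi A HS HT ES ET Hex).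
apply functional_extensionality; intros x. apply functional_extensionality; intros xs.
apply propositional_extensionality. split.
- intros Hx. destruct (canon_ex x) as (cx & Hcx & _). destruct (biadjoint_ex A cx) as [zz Hzz].
  assert (Hm := contact_minorant _ _ _ _ (proj1 EH) (proj1 (proj2 (proj2 EH))) Hx Hcx).
  destruct (Hex xs cx (dapp xs x) zz) as (uu & vs & vv & s & t & A1 & A2 & A3 & A4 & A5); auto.
  { intros y ys r Hr. apply Hm. now apply epi_closure_incl. }
  assert (B1 := proj2 (proj2 (proj2 ES)) _ _ _ A1).
  assert (B2 := proj2 (proj2 (proj2 ET)) _ _ _ A2).
  assert (B3 : dapp uu xs + dapp vv vs = dapp xs x).
  { rewrite <- (Hcx xs), A3, <- Hzz, A4. reflexivity. }
  (* [B1], [B2], [B3] and [A5] force [s = <uu, xs>] and [t = <vv, vs>]; with [s] so determined, the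
     conjugate bound tested on the graph of [S] is monotone relatedness. *)
  assert (GS : gossez_cl S uu xs).
  { intros y ys Hy. specialize (A1 y ys _ (CS y ys Hy)). linall. lra. }
  destruct (Hdom uu xs GS) as [u Hu].
  exists u, (ns_sub x u). split; [|split].
  + apply MS. intros y ys Hy. specialize (GS y ys Hy). rewrite (Hu (ns_sub xs ys)) in GS.
    rewrite dapp_subr. exact GS.
  + exists vs. split; [|exact A3]. apply MT. intros y ys Hy.
    specialize (A2 y ys _ (CT y ys Hy)).
    (* Both [cx] and [uu] now come from points of [X], so the difference of their biadjoint images
       is an evaluation in [Y]. *)
    assert (Hvv : forall g, dapp vv g = dapp g (A (ns_sub x u))).
    { intros g. specialize (A4 g). rewrite Hzz, (Hcx (adj A g)), (Hu (adj A g)) in A4.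
      rewrite <- adjE, dapp_subr. lra. }
    rewrite !Hvv in *. linall. lra.
  + vec.
- intros (u & w & Hu & (vs & Hw & E) & ->).
  apply epi_closure_incl. exists u, w, vs, (dapp xs u), (dapp vs (A w)). cbn [fst snd].
  split; [reflexivity|split; [exact E|split; [now apply CS|split; [now apply CT|]]]].
  rewrite dapp_addr. assert (dapp xs w = dapp vs (A w)) by now rewrite E. lra.
Qed.

Theorem theorem3p2 (X Y : NSpace)
  (HX : banach X) (HY : banach Y) (HX0 : nonzero_space X) (HY0 : nonzero_space Y)
  (S : Op X) (T : Op Y) (HS : gossez_D S) (HT : gossez_D T)
  (hS : EFun X) (hT : EFun Y) (HhS : strong_rep S hS) (HhT : strong_rep T hT)
  (A : BLin X Y)
  (Hne : exists (y : Y) (ys : Dual Y) (xs : Dual X) (w : X),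
           dom_fun hT y ys /\ pr_dom hS xs /\ y = A w /\ xs = adj A ys)
  (HdomS : forall (xx : Dual (Dual X)) (xs : Dual X), gossez_cl S xx xs ->
             exists x : X, canon x xx)
  (Hab : cond_a A hS hT \/ cond_b A hS hT) :
  strong_rep (par_sum A S T) (norm_closure (infconv A hS hT)) /\
  gossez_D (par_sum A S T).
Proof.
assert (ES := strong_rep_epi _ _ HhS). assert (ET := strong_rep_epi _ _ HhT).
assert (CS : forall x xs, S x xs -> contact_set (epi hS) x xs).
{ intros x xs H. unfold contact_set, epi; cbn [fst snd].
  rewrite (proj2 (proj2 (proj2 (proj1 HhS))) x xs H). apply Rle_refl. }
assert (CT : forall y ys, T y ys -> contact_set (epi hT) y ys).
{ intros y ys H. unfold contact_set, epi; cbn [fst snd].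
  rewrite (proj2 (proj2 (proj2 (proj1 HhT))) y ys H). apply Rle_refl. }
assert (PS : forall x xs, hS x xs <> ERminf)
  by (intros x xs; exact (ER_fin_lb _ _ (proj1 (proj2 (proj2 (proj1 HhS))) x xs))).
assert (PT : forall y ys, hT y ys <> ERminf)
  by (intros y ys; exact (ER_fin_lb _ _ (proj1 (proj2 (proj2 (proj1 HhT))) y ys))).
assert (Hdom : exists p r, inf_conv A (epi hS) (epi hT) p r).
{ destruct Hne as (y & ys & xs & w & H1 & [u H2] & -> & ->).
  destruct (ER_fin_ub _ H1) as [t Ht]. destruct (ER_fin_ub _ H2) as [s Hs].
  exists (ns_add u w, adj A ys), (s + t), u, w, ys, s, t.
  split; [reflexivity|split; [reflexivity|split; [exact Hs|split; [exact Ht|lra]]]]. }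
assert (Hex : conjugate_exact A (epi hS) (epi hT)).
{ destruct Hab; [now apply conjugate_exact_of_cond_a|now apply conjugate_exact_of_cond_b]. }
assert (EH := closure_strong_epi A _ _ ES ET Hex).
assert (EC := contact_closure_par_sum A S T _ _ (proj1 HS) (proj1 HT) CS CT HdomS ES ET Hex).
assert (EE : epi (norm_closure (infconv A hS hT)) = epi_closure (inf_conv A (epi hS) (epi hT))).
{ apply functional_extensionality; intros [x xs]. apply functional_extensionality; intros r.
  apply propositional_extensionality. now apply norm_closure_infconv_epi. }
split; [|rewrite <- EC; now apply contact_gossez_D].
rewrite <- EC. rewrite <- EE in *. destruct EH as (H1 & H2 & H3 & H4).
(* Proved ahead of the clauses since it also rules out -oo when a contact inequality is turned into
   an equality. *)
assert (Hge : forall x xs, ER_le (ERfin (dapp xs x)) (norm_closure (infconv A hS hT) x xs)).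
{ intros x xs. apply ER_le_fin_char. intros s Hs. exact (H3 x xs s Hs). }
split; [split; [|split; [|split]]|].
- intros x1 xs1 x2 xs2 a b l Hl Ha Hb. exact (H1 (x1, xs1) a (x2, xs2) b l Hl Ha Hb).
- intros r xn xsn x xs Hn Hx Hxs. apply (H2 x xs r). intros eps He.
  destruct (Hx eps He) as [N1 HN1]. destruct (Hxs eps He) as [N2 HN2].
  exists (xn (Nat.max N1 N2)), (xsn (Nat.max N1 N2)), r.
  split; [apply Hn|split; [apply HN1; lia|split; [apply HN2; lia|lra]]].
- exact Hge.
- intros x xs Hx. specialize (Hge x xs). unfold contact_set, epi in Hx; cbn [fst snd] in Hx.
  destruct (norm_closure (infconv A hS hT) x xs) as [v| |]; simpl in *; try tauto.
  f_equal; lra.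
- intros xs xx. apply ER_le_fin_char. intros s Hs. apply H4. now apply conjugate_le.
Qed.
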